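(* Let $c_0\in\mathbb R\setminus\{0\}$ and let $\psi$ be the (degenerate) unitary character $\psi(n(u_0,u_1,u_2,u_3))=\exp(2\pi\sqrt{-1}\,c_0u_0)$ of $N_0$. Let $\mathcal D_\lambda$ be a large discrete series representation of $G=\mathrm{Sp}_4(\mathbb R)$ with Harish-Chandra parameter $\lambda$ and minimal $K$-type $\tau_\Lambda$, $d_\Lambda=\Lambda_1-\Lambda_2$, and let $\Phi=\sum_{i=0}^{d_\Lambda}\varphi_i(g)u_i^*$ be a Whittaker function for $\mathcal D_\lambda$ and $\psi$ with $K$-type $\tau_\Lambda$, assumed of moderate growth. Put $a_0=\mathrm{diag}(a_1,a_2,a_1^{-1},a_2^{-1})$, $a_1,a_2>0$. (1) If $\lambda\in\Xi_{II}$, then with arbitrary constants $C_0,C_1$ independent of $i$, $\varphi_i(a_0)$ is given by $$C_0\alpha_i(a_1a_2)^{\frac{d_\Lambda+2}{2}}W_{\mathrm{sgn}(c_0)\left(i-\frac{d_\Lambda}{2}\right),\frac{\Lambda_1+\Lambda_2-1}{2}}\Bigl(4\pi|c_0|\frac{a_1}{a_2}\Bigr)+C_1\beta_ia_1^{\Lambda_1+1}a_2^{\Lambda_2+1}\exp\Bigl(-2\pi|c_0|\frac{a_1}{a_2}\Bigr),$$ where, for $c_0>0$: $\alpha_i=0$ for $0\le i\le\Lambda_1-1$, $\alpha_i=\frac1{(i-\Lambda_1)!}$ for $\Lambda_1\le i\le d_\Lambda$, and $\beta_i=\delta_{i,d_\Lambda}$; and for $c_0<0$: $\alpha_i=\frac1{(-\Lambda_2-i)!}$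 for $0\le i\le-\Lambda_2$, $\alpha_i=0$ for $-\Lambda_2+1\le i\le d_\Lambda$, and $\beta_i=\delta_{i,0}$. (2) If $\lambda\in\Xi_{III}$, then with arbitrary constants $C_0,C_1$ independent of $i$, $\varphi_i(a_0)$ is given by $$C_0\alpha_i(a_1a_2)^{\frac{d_\Lambda+2}{2}}W_{\mathrm{sgn}(c_0)\left(i-\frac{d_\Lambda}{2}\right),\frac{\Lambda_1+\Lambda_2+1}{2}}\Bigl(4\pi|c_0|\frac{a_1}{a_2}\Bigr)+C_1\beta_ia_1^{-\Lambda_2+1}a_2^{-\Lambda_1+1}\exp\Bigl(-2\pi|c_0|\frac{a_1}{a_2}\Bigr),$$ where, for $c_0>0$: $\alpha_i=0$ for $0\le i\le-\Lambda_2-1$, $\alpha_i=\frac{(-1)^i}{(i+\Lambda_2)!}$ for $-\Lambda_2\le i\le d_\Lambda$, and $\beta_i=(-1)^i\delta_{i,d_\Lambda}$; and for $c_0<0$: $\alpha_i=\frac{(-1)^i}{(\Lambda_1-i)!}$ for $0\le i\le\Lambda_1$, $\alpha_i=0$ for $\Lambda_1+1\le i\le d_\Lambda$, and $\beta_i=(-1)^i\delta_{i,0}$.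
   Context: $G=\mathrm{Sp}_4(\mathbb R)=\{g\in\mathrm{GL}_4(\mathbb R):{}^tgJ_4g=J_4\}$, $J_4=\begin{pmatrix}0_2&1_2\\-1_2&0_2\end{pmatrix}$, $\mathfrak g=\mathrm{Lie}(G)$. $N_0$ is the group of $$n(u_0,u_1,u_2,u_3)=\begin{pmatrix}1&0&u_1&u_2\\0&1&u_2&u_3\\0&0&1&0\\0&0&0&1\end{pmatrix}\begin{pmatrix}1&u_0&0&0\\0&1&0&0\\0&0&1&0\\0&0&-u_0&1\end{pmatrix},\quad u_i\in\mathbb R.$$ $A_0^\infty=\{\mathrm{diag}(a_1,a_2,a_1^{-1},a_2^{-1}):a_i>0\}$, and $K=G\cap\mathrm O(4)\cong\mathrm U(2)$ via $\begin{pmatrix}A&B\\-B&A\end{pmatrix}\mapsto A+\sqrt{-1}B$; one has $G=N_0A_0^\infty K$. Weights $(a,b)$ mean $\mathrm{diag}(e^{\sqrt{-1}\theta_1},e^{\sqrt{-1}\theta_2})\mapsto e^{\sqrt{-1}(a\theta_1+b\theta_2)}$. $\Xi_{II}=\{(\lambda_1,\lambda_2)\in\mathbb Z_{>0}\times\mathbb Z_{<0}:\lambda_1>-\lambda_2\}$, $\Xi_{III}=\{(\lambda_1,\lambda_2)\in\mathbb Z_{>0}\times\mathbb Z_{<0}:\lambda_1<-\lambda_2\}$ are the Harish-Chandra parameters of the large discrete series $\mathcal D_\lambda$. The minimal $K$-type $\tau_\Lambda$ has highest weight $\Lambda=(\Lambda_1,\Lambda_2)=(\lambda_1+1,\lambda_2)$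 for $\lambda\in\Xi_{II}$ and $(\lambda_1,\lambda_2-1)$ for $\lambda\in\Xi_{III}$, and occurs in $\mathcal D_\lambda$ with multiplicity one. $\tau_\Lambda$ is realized on the space $V_\Lambda$ of homogeneous polynomials of degree $d_\Lambda$ in $x_1,x_2$ as $\det^{\Lambda_2}\otimes\mathrm{Sym}^{d_\Lambda}$ of the standard representation of $\mathrm U(2)$ on $\mathbb Cx_1\oplus\mathbb Cx_2$ ($h\cdot x_j=\sum_ih_{ij}x_i$). Put $u_i=(x_1+\sqrt{-1}x_2)^i(x_1-\sqrt{-1}x_2)^{d_\Lambda-i}$, $0\le i\le d_\Lambda$, and let $\{u_i^*\}$ be the basis of $V_\Lambda^*$ dual to $\{u_i\}$. Whittaker functions: $C_\psi^\infty(N_0\backslash G)$ is the space of smooth $f:G\to\mathbb C$ with $f(ng)=\psi(n)f(g)$. Given $\phi\in\mathrm{Hom}_{(\mathfrak g,K)}(\mathcal D_\lambda,C_\psi^\infty(N_0\backslash G))$ and the $K$-inclusion $\iota:\tau_\Lambda\hookrightarrow\mathcal D_\lambda$, the associated Whittaker function for $\mathcal D_\lambda$ with $K$-type $\tau_\Lambda$ is $\Phi:G\to V_\Lambda^*$ with $\langle\Phi(g),v\rangle=\phi(\iota(v))(g)$; so $\varphi_i(g)=\langle\Phi(g),u_i\rangle$ and $\Phi(ngk)=\psi(n)\tau_\Lambda^*(k)^{-1}\Phi(g)$. $W_{\kappa,\mu}(y)$ ($y>0$) is the classical Whittaker function, the moderate growth solution of $W''+\bigl(-\frac14+\frac\kappa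 y+\frac{1/4-\mu^2}{y^2}\bigr)W=0$, normalized so that $W_{\kappa,\mu}(y)\sim y^\kappa e^{-y/2}$ as $y\to\infty$. $\delta_{i,j}$ is the Kronecker delta. *)

(* Defs.v *)
(* Elements of G, K, N_0 and of their Lie algebras are 4 x 4 real matrices
   satisfying a predicate; functions on these groups are total functions on
   matrices, whose values outside of the group are never used. *)
From HB Require Import structures.
From mathcomp Require Import all_boot all_order all_algebra.
From mathcomp Require Import all_classical all_reals all_analysis.
From mathcomp Require Import complex.
From mathcomp Require mpoly.
(* the notations of mpoly clash with those of mathcomp-analysis *)
Import (canonicals, hints, coercions) mpoly.

Set Implicit Arguments.
Unset Strict Implicit.
Unset Printing Implicit Defensive.

Import Order.TTheory GRing.Theory Num.Theory.
Import numFieldNormedType.Exports.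
Local Open Scope classical_set_scope.
Local Open Scope ring_scope.
Local Open Scope complex_scope.

Definition mx2 (S : Type) (a b c d : S) : 'M[S]_2 :=
  \matrix_(i, j) (if i == 0 then (if j == 0 then a else b)
                  else (if j == 0 then c else d)).

Section Groups.
Variable R : realType.

Definition J4 : 'M[R]_4 := block_mx (0 : 'M[R]_2) 1%:M (- 1%:M) (0 : 'M[R]_2).

Definition Sp4 (g : 'M[R]_4) : bool := g^T *m J4 *m g == J4.
Definition sp4 (X : 'M[R]_4) : bool := X^T *m J4 + J4 *m X == 0.

Definition maxK (k : 'M[R]_4) : bool := Sp4 k && (k^T *m k == 1%:M).
Definition lieK (X : 'M[R]_4) : bool := sp4 X && (X^T + X == 0).

Definition K_to_U2 (k : 'M[R]_4) : 'M[R[i]]_2 :=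
  \matrix_(i, j) (ulsubmx (k : 'M[R]_(2 + 2)) i j +i* ursubmx (k : 'M[R]_(2 + 2)) i j).

Definition n0 (u0 u1 u2 u3 : R) : 'M[R]_4 :=
  (block_mx 1%:M (mx2 u1 u2 u2 u3) 0 1%:M : 'M[R]_(2 + 2)) *m
  (block_mx (mx2 1 u0 0 1) 0 0 (mx2 1 0 (- u0) 1) : 'M[R]_(2 + 2)).

Definition a0 (a1 a2 : R) : 'M[R]_4 :=
  (block_mx (mx2 a1 0 0 a2) 0 0 (mx2 a1^-1 0 0 a2^-1) : 'M[R]_(2 + 2)).

Definition expm (X : 'M[R]_4) : 'M[R]_4 :=
  lim ((fun n : nat => \sum_(k < n) (k`!%:R)^-1 *: X ^+ k) @ \oo).

End Groups.

Section Functions.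
Variable R : realType.

Definition cexpi (t : R) : R[i] := cos t +i* sin t.

Definition derivableC (f : R -> R[i]) (t : R) : Prop :=
  derivable (fun s => complex.Re (f s)) t 1 /\
  derivable (fun s => complex.Im (f s)) t 1.
Definition deriveC (f : R -> R[i]) (t : R) : R[i] :=
  derive1 (fun s => complex.Re (f s)) t +i* derive1 (fun s => complex.Im (f s)) t.

Definition continuousC (A : set 'M[R]_4) (f : 'M[R]_4 -> R[i]) : Prop :=
  {within A, continuous (fun g => complex.Re (f g))} /\
  {within A, continuous (fun g => complex.Im (f g))}.

(* differential of the right regular representation *)
Definition lieD (X : 'M[R]_4) (f : 'M[R]_4 -> R[i]) (g : 'M[R]_4) : R[i] :=
  deriveC (fun t => f (g *m expm (t *: X))) 0.

(* C^oo on G: all iterated derivatives along left-invariant vector fields exist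
   and are continuous *)
Definition smoothG (f : 'M[R]_4 -> R[i]) : Prop :=
  forall s : seq 'M[R]_4, all (@sp4 R) s ->
    continuousC [set g | Sp4 g] (foldr lieD f s) /\
    forall X g, sp4 X -> Sp4 g ->
      derivableC (fun t => foldr lieD f s (g *m expm (t *: X))) 0.

Definition borelM : Type := g_sigma_algebraType (@open 'M[R]_4).

Definition is_haar (mu : {measure set borelM -> \bar R}) : Prop :=
  [/\ mu (~` [set g : 'M[R]_4 | Sp4 g]) = 0%E,
      mu [set g : 'M[R]_4 | Sp4 g] <> 0%E,
      forall A : set 'M[R]_4, compact A -> (mu A < +oo)%E &
      forall (g : 'M[R]_4) (A : set borelM), Sp4 g -> measurable A ->
        mu [set g *m x | x in (A : set 'M[R]_4)] = mu A].

Definition square_integrable (mu : {measure set borelM -> \bar R})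
    (f : 'M[R]_4 -> R[i]) : Prop :=
  (\int[mu]_(g in [set g : 'M[R]_4 | Sp4 g])
     ((complex.Re (f g) ^+ 2 + complex.Im (f g) ^+ 2)%:E) < +oo)%E.

End Functions.

Section Modules.
Variable R : realType.
Local Notation C := R[i].

Definition lie_rep (M : lmodType C) (act : 'M[R]_4 -> M -> M) : Prop :=
  [/\ forall X, sp4 X -> linear (act X),
      forall (a : R) X Y v, sp4 X -> sp4 Y ->
        act (a *: X + Y) v = a%:C *: act X v + act Y v &
      forall X Y v, sp4 X -> sp4 Y ->
        act (X *m Y - Y *m X) v = act X (act Y v) - act Y (act X v)].

Record gkmodule := GKModule {
  gk_sort :> lmodType C;
  gact : 'M[R]_4 -> gk_sort -> gk_sort;
  kact : 'M[R]_4 -> gk_sort -> gk_sort;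
  gact_rep : lie_rep gact;
  kact_linear : forall k, maxK k -> linear (kact k);
  kact1 : forall v, kact 1%:M v = v;
  kactM : forall k l v, maxK k -> maxK l -> kact (k *m l) v = kact k (kact l v);
  kact_Ad : forall k X v, maxK k -> sp4 X ->
    kact k (gact X v) = gact (k *m X *m invmx k) (kact k v);
  (* every vector lies in a K-stable subspace with finite basis w on which K
     acts by a continuous matrix representation rho, whose differential is the
     action of Lie(K) *)
  kact_finite : forall v, exists n (w : 'I_n -> gk_sort)
      (rho : 'I_n -> 'I_n -> 'M[R]_4 -> C),
    [/\ (exists c : 'I_n -> C, v = \sum_j c j *: w j),
        (forall c : 'I_n -> C, \sum_j c j *: w j = 0 -> forall j, c j = 0),
        (forall k j, maxK k -> kact k (w j) = \sum_i rho i j k *: w i),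
        (forall i j, continuousC [set k | maxK k] (rho i j)) &
        (forall X j, lieK X ->
           (forall i, derivableC (fun t => rho i j (expm (t *: X))) 0) /\
           gact X (w j) =
             \sum_i deriveC (fun t => rho i j (expm (t *: X))) 0 *: w i)]
}.

Definition gk_irreducible (V : gkmodule) : Prop :=
  (exists v : V, v != 0) /\
  forall W : set V, W 0 ->
    (forall (c : C) u v, W u -> W v -> W (c *: u + v)) ->
    (forall X v, sp4 X -> W v -> W (gact X v)) ->
    (forall k v, maxK k -> W v -> W (kact k v)) ->
    (exists2 v, W v & v != 0) -> forall v, W v.

(* (g,K)-homomorphisms into C^oo(G), G acting by right translation *)
Definition gk_hom (V : gkmodule) (f : V -> 'M[R]_4 -> C) : Prop :=
  [/\ forall v, smoothG (f v),
      forall (c : C) u v g, Sp4 g -> f (c *: u + v) g = c * f u g + f v g,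
      forall X v g, sp4 X -> Sp4 g -> f (gact X v) g = lieD X (f v) g &
      forall k v g, maxK k -> Sp4 g -> f (kact k v) g = f v (g *m k)].

Definition is_discrete_series (V : gkmodule) : Prop :=
  gk_irreducible V /\
  exists (mu : {measure set (borelM R) -> \bar R}) (f : V -> 'M[R]_4 -> C),
    [/\ is_haar mu, gk_hom f, forall v, square_integrable mu (f v) &
        exists v g, Sp4 g /\ f v g != 0].

(* Expressions for the elements of U(g_C).  By the universal property of U(g_C)
   (and as it acts faithfully on itself), two of them denote the same element
   iff they act in the same way on every representation of g. *)
Inductive uexpr : Type :=
| UConst of C
| UGen (X : 'M[R]_4) of sp4 X
| UAdd of uexpr & uexpr
| UMul of uexpr & uexpr.

Fixpoint ueval (M : lmodType C) (act : 'M[R]_4 -> M -> M) (e : uexpr) (v : M)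
    : M :=
  match e with
  | UConst c => c *: v
  | UGen X _ => act X v
  | UAdd e1 e2 => ueval act e1 v + ueval act e2 v
  | UMul e1 e2 => ueval act e1 (ueval act e2 v)
  end.

Definition ueq (e1 e2 : uexpr) : Prop :=
  forall (M : lmodType C) (act : 'M[R]_4 -> M -> M), lie_rep act ->
    forall v, ueval act e1 v = ueval act e2 v.

Definition ucentral (z : uexpr) : Prop :=
  forall X (hX : sp4 X), ueq (UMul z (UGen hX)) (UMul (UGen hX) z).

(* the compact Cartan subalgebra; exp (torus t1 t2) corresponds to
   diag (e^(i t1), e^(i t2)) in U(2) *)
Definition torus (t1 t2 : R) : 'M[R]_4 :=
  block_mx (0 : 'M[R]_2) (mx2 t1 0 0 t2) (- mx2 t1 0 0 t2) (0 : 'M[R]_2).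

Definition dweight (a : int * int) (t1 t2 : R) : C :=
  'i * (a.1%:~R * t1 + a.2%:~R * t2)%:C.

Definition actC (M : lmodType C) (act : 'M[R]_4 -> M -> M) (Z : 'M[C]_4) (v : M)
    : M :=
  act (map_mx (@complex.Re R) Z) v + 'i *: act (map_mx (@complex.Im R) Z) v.

Definition root_vector (a : int * int) (Z : 'M[C]_4) : Prop :=
  [/\ sp4 (map_mx (@complex.Re R) Z), sp4 (map_mx (@complex.Im R) Z) &
      forall t1 t2, let H := map_mx (real_complex R) (torus t1 t2) in
        H *m Z - Z *m H = dweight a t1 t2 *: Z].

Definition positive_roots : seq (int * int) :=
  [:: (1, -1); (1, 1); (2, 0); (0, 2)].
Definition rho_weight : int * int := (2, 1).

Definition highest_weight_vector (M : lmodType C) (act : 'M[R]_4 -> M -> M)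
    (a : int * int) (m : M) : Prop :=
  [/\ m != 0,
      forall t1 t2, act (torus t1 t2) m = dweight a t1 t2 *: m &
      forall b Z, b \in positive_roots -> root_vector b Z -> actC act Z m = 0].

(* Z(g) acts on V as it does on highest weight modules of highest weight
   lam - rho *)
Definition has_infinitesimal_character (V : gkmodule) (lam : int * int) : Prop :=
  forall z, ucentral z ->
  forall (M : lmodType C) (act : 'M[R]_4 -> M -> M) (m : M) (c : C),
    lie_rep act ->
    highest_weight_vector act
      (lam.1 - rho_weight.1, lam.2 - rho_weight.2) m ->
    ueval act z m = c *: m ->
    forall v : V, ueval (@gact V) z v = c *: v.

(* homogeneous polynomials of degree d in x_1, x_2 (variables 0 and 1) *)
Definition binform (d : nat) : Type := mpoly.dhomog 2 C d.
HB.instance Definition _ (d : nat) := GRing.Lmodule.copy (binform d) (mpoly.dhomog 2 C d).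

Definition xvar (i : 'I_2) : mpoly.mpoly 2 C :=
  mpoly.mpolyX C (mpoly.mnm1 i).

(* the substitution x_j |-> \sum_i h_ij x_i *)
Definition subst_form (h : 'M[C]_2) (p : mpoly.mpoly 2 C) : mpoly.mpoly 2 C :=
  mpoly.comp_mpoly [tuple \sum_i h i j *: xvar i | j < 2] p.


Lemma linform_homog (c : 'I_2 -> C) :
  \sum_i c i *: xvar i \is mpoly.ishomog1 1 (@mpoly.mdeg 2).
Proof.
apply: rpred_sum => i _; apply: rpredZ.
by rewrite mpoly.dhomogX /= mpoly.mdeg1.
Qed.

Lemma subst_form_homog d (h : 'M[C]_2) (p : binform d) :
  subst_form h p \is mpoly.ishomog1 d (@mpoly.mdeg 2).
Proof.
rewrite /subst_form mpoly.comp_mpolyE big_seq.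
apply: rpred_sum => m m_p; apply: rpredZ.
have/mpoly.dhomogP/(_ m m_p) /= <- := mpoly.dhomog_is_dhomog p.
rewrite mpoly.mdegE.
elim/big_rec2: _ => [|i e q _ Hq]; first exact: mpoly.dhomog1.
apply: mpoly.dhomogM => //; rewrite -[X in mpoly.ishomog1 X]mul1n.
by apply: mpoly.dhomogMn; rewrite tnth_mktuple; exact: linform_homog.
Qed.

(* det^b (x) Sym^d of the standard representation *)
Definition tau (b : int) (d : nat) (h : 'M[C]_2) (p : binform d) : binform d :=
  \det h ^ b *: mpoly.DHomog (subst_form_homog h p).

Definition uform (d : nat) (i : 'I_d.+1) : mpoly.mpoly 2 C :=
  (xvar 0 + 'i *: xvar 1) ^+ i * (xvar 0 - 'i *: xvar 1) ^+ (d - i).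

Lemma uform_homog d (i : 'I_d.+1) :
  uform i \is mpoly.ishomog1 d (@mpoly.mdeg 2).
Proof.
have lin (c : C) : xvar 0 + c *: xvar 1 \is mpoly.ishomog1 1 (@mpoly.mdeg 2).
  have := linform_homog (fun i => if i == 0 then 1 else c).
  by rewrite !big_ord_recl big_ord0 /= addr0 scale1r.
rewrite -[X in mpoly.ishomog1 X](subnKC (leq_ord i)) /uform -scaleNr.
by apply: mpoly.dhomogM; rewrite -[X in mpoly.ishomog1 X]mul1n;
  apply: mpoly.dhomogMn.
Qed.

Definition uvec (d : nat) (i : 'I_d.+1) : binform d :=
  mpoly.DHomog (uform_homog i).

(* highest weights (a.1, a.2) are dominant, i.e. a.2 <= a.1 *)
Definition hwdeg (a : int * int) : nat := absz (a.1 - a.2).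

Definition is_K_hom (V : gkmodule) (a : int * int)
    (f : {linear binform (hwdeg a) -> V}) : Prop :=
  forall k p, maxK k -> f (tau a.2 (K_to_U2 k) p) = kact k (f p).

Definition occurs_in (V : gkmodule) (a : int * int) : Prop :=
  exists f : {linear binform (hwdeg a) -> V},
    is_K_hom f /\ exists p, f p != 0.

Definition multiplicity_one (V : gkmodule) (a : int * int) : Prop :=
  occurs_in V a /\
  forall f g : {linear binform (hwdeg a) -> V},
    is_K_hom f -> is_K_hom g -> (exists p, f p != 0) ->
    exists c : C, forall p, g p = c *: f p.

(* |a + 2 rho_c|^2, where 2 rho_c = (1, -1) *)
Definition vogan_norm (a : int * int) : int := (a.1 + 1) ^+ 2 + (a.2 - 1) ^+ 2.

Definition is_minimal_K_type (V : gkmodule) (a : int * int) : Prop :=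
  [/\ a.2 <= a.1, occurs_in V a &
      forall b : int * int, b.2 <= b.1 -> occurs_in V b ->
        vogan_norm a <= vogan_norm b].

Definition Xi_II (lam : int * int) : bool :=
  [&& 0 < lam.1, lam.2 < 0 & - lam.2 < lam.1].
Definition Xi_III (lam : int * int) : bool :=
  [&& 0 < lam.1, lam.2 < 0 & lam.1 < - lam.2].

(* highest weight of the minimal K-type, for lam in Xi_II or Xi_III *)
Definition Lam (lam : int * int) : int * int :=
  if - lam.2 < lam.1 then (lam.1 + 1, lam.2) else (lam.1, lam.2 - 1).

(* V is (the (g,K)-module of) the discrete series representation with
   Harish-Chandra parameter lam in Xi_II or Xi_III: the discrete series with
   infinitesimal character lam and minimal K-type (Blattner parameter) Lam lam *)
Definition is_large_discrete_series (lam : int * int) (V : gkmodule) : Prop :=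
  [/\ Xi_II lam || Xi_III lam,
      is_discrete_series V,
      has_infinitesimal_character V lam,
      is_minimal_K_type V (Lam lam) &
      multiplicity_one V (Lam lam)].

Definition psi_equivariant (c0 : R) (f : 'M[R]_4 -> C) : Prop :=
  forall u0 u1 u2 u3 g, Sp4 g ->
    f (n0 u0 u1 u2 u3 *m g) = cexpi (2 * pi * c0 * u0) * f g.

(* Phi g is an element of the dual of V_Lambda *)
Definition is_whittaker_function (c0 : R) (V : gkmodule) (a : int * int)
    (Phi : 'M[R]_4 -> {scalar binform (hwdeg a)}) : Prop :=
  exists (phi : V -> 'M[R]_4 -> C) (iota : {linear binform (hwdeg a) -> V}),
    [/\ gk_hom phi,
        forall v, psi_equivariant c0 (phi v),
        is_K_hom iota, injective iota &
        forall g v, Sp4 g -> Phi g v = phi (iota v) g].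

Definition moderate_growth (d : nat) (Phi : 'M[R]_4 -> {scalar binform d})
    : Prop :=
  forall v, exists (c : R) (N : nat),
    forall g, Sp4 g -> `|Phi g v| <= (c * `|g| ^+ N)%:C.

End Modules.

Section ClassicalWhittaker.
Variable R : realType.

Definition is_whittakerW (kappa mu : R) (w : R -> R) : Prop :=
  (forall y, 0 < y ->
     [/\ derivable w y 1, derivable (derive1 w) y 1 &
         derive1 (derive1 w) y
           + (- 4^-1 + kappa / y + (4^-1 - mu ^+ 2) / y ^+ 2) * w y = 0]) /\
  (w y / (y `^ kappa * expR (- y / 2)) @[y --> +oo] --> (1 : R)).

(* only the values at y > 0 are specified *)
Definition whittakerW (kappa mu : R) : R -> R :=
  xget (fun=> 0) [set w | is_whittakerW kappa mu w].

End ClassicalWhittaker.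

Section Coefficients.
Variables (R : realType) (c0 : R) (L : int * int).

Definition alphaII (i : nat) : R :=
  if 0 < c0 then (if i%:Z < L.1 then 0 else ((absz (i%:Z - L.1))`!)%:R^-1)
  else (if i%:Z <= - L.2 then ((absz (- L.2 - i%:Z))`!)%:R^-1 else 0).

Definition betaII (i : nat) : R :=
  if 0 < c0 then (i == hwdeg L)%:R else (i == 0%N)%:R.

Definition alphaIII (i : nat) : R :=
  if 0 < c0 then
    (if i%:Z < - L.2 then 0 else (-1) ^+ i / ((absz (i%:Z + L.2))`!)%:R)
  else (if i%:Z <= L.1 then (-1) ^+ i / ((absz (L.1 - i%:Z))`!)%:R else 0).

Definition betaIII (i : nat) : R :=
  if 0 < c0 then (-1) ^+ i * (i == hwdeg L)%:R else (-1) ^+ i * (i == 0%N)%:R.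

(* \varphi_i(a_0) for given alpha_i, beta_i, second index mu of W and exponents
   (e1, e2) of (a_1, a_2) *)
Definition whittaker_formula (C0 C1 : R[i]) (alpha beta mu : R) (e1 e2 : int)
    (i : nat) (a1 a2 : R) : R[i] :=
  let d : R := (hwdeg L)%:R in
  C0 * (alpha * (a1 * a2) `^ ((d + 2) / 2)
        * whittakerW (Num.sg c0 * (i%:R - d / 2)) mu
            (4 * pi * `|c0| * (a1 / a2)))%:C
  + C1 * (beta * a1 ^ e1 * a2 ^ e2 * expR (- (2 * pi * `|c0| * (a1 / a2))))%:C.

End Coefficients.

(* Main.v *)
(* In the coordinates a_1 = e^(s+t), a_2 = e^(s-t) put F_k = phi_k.  Minimality
   of tau_Lambda for the Vogan norm means that the K-types of smaller norm do
   not occur in D_lambda; composing the action of p_+ and p_- on iota(V_Lambda)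
   with the K-projections of p_+- (x) V_Lambda onto V_(Lambda + (0,2)),
   V_(Lambda - (2,0)) and V_(Lambda - (1,1)) (case II) or V_(Lambda + (1,1))
   (case III) therefore gives 0.  Evaluated at a_0, where N_0 acts by psi and K
   by tau_Lambda, these identities become first order equations relating
   F_(k-1), F_k and F_(k+1) whose coefficients are real and depend on c_0 only
   through 4 pi c_0 e^(2t).  Replacing k by d - k exchanges c_0 and -c_0, and
   F_k by (-1)^k F_k exchanges the two cases, so one real system remains.
   There F_k = 0 for k < Lambda_1 by descending induction, as the homogeneous
   solutions grow doubly exponentially; F_(Lambda_1) is then determined up to a
   constant, the other components with k > Lambda_1 follow, and one further
   constant enters at k = d.  No Casimir equation is needed: the Whittaker
   functions that occur are z^m e^(-z/2) times Laguerre polynomials. *)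
From HB Require Import structures.
Require Import Defs.
From mathcomp Require Import all_boot all_order all_algebra.
From mathcomp Require Import all_classical all_reals all_analysis.
From mathcomp Require Import complex.
From mathcomp Require mpoly.
From mathcomp Require Import ring lra zify.

Set Implicit Arguments.
Unset Strict Implicit.
Unset Printing Implicit Defensive.

Import Order.TTheory GRing.Theory Num.Theory.
Import numFieldNormedType.Exports.
Import (canonicals, hints, coercions) mpoly.
Local Open Scope ring_scope.
Local Open Scope complex_scope.

(** * Ordinary differential equations on the half line *)

Section Derivatives.
Variable R : realType.
Implicit Types (f g : R -> R) (x a b : R).

(** The maps attached to the three K-types are equivariant embeddings into p_+ or p_- tensor
    V_Lambda, built in two ways. Lambda + (0,2) and Lambda - (2,0) have degree d - 2, and
    multiplication by binary quadratics contragredient to a basis of p_+ or p_- does it. For Lambda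
    + (1,1) and Lambda - (1,1) the degree remains d; there p_+ and p_- are sl_2 twisted by det and
    its inverse, and sl_2 inside k_C acts on V_Lambda itself. The relations of the second kind
    contain products of two Lie algebra elements; their inner factor is brought back into the image
    of iota at the level of the functions phi v on G. The sign of Lambda_1 + Lambda_2 decides which
    of Lambda + (1,1) and Lambda - (1,1) has the smaller norm, and so separates the two families.
    For 0 < k < d the three relations determine the s-derivative of F_k and both neighbour
    expressions. At k = d only the last relation remains, so F_d is no longer an algebraic
    consequence of F_(d-1): this is the source of the second constant. *)

Lemma dcst c x : is_derive x 1 (fun _ : R => c : R) 0.
Proof. exact: is_derive_cst. Qed.

Lemma did x : is_derive x 1 (fun y : R => y) 1.
Proof. exact: is_derive_id. Qed.

Lemma dD f g x a b : is_derive x 1 f a -> is_derive x 1 g b ->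
  is_derive x 1 (fun y => f y + g y) (a + b).
Proof. exact: is_deriveD. Qed.

Lemma dB f g x a b : is_derive x 1 f a -> is_derive x 1 g b ->
  is_derive x 1 (fun y => f y - g y) (a - b).
Proof. exact: is_deriveB. Qed.

Lemma dN f x a : is_derive x 1 f a -> is_derive x 1 (fun y => - f y) (- a).
Proof. exact: is_deriveN. Qed.

Lemma dM f g x a b : is_derive x 1 f a -> is_derive x 1 g b ->
  is_derive x 1 (fun y => f y * g y) (a * g x + f x * b).
Proof.
move=> df dg; apply: is_derive_eq (is_deriveM df dg) _.
by rewrite /GRing.scale /= addrC mulrC.
Qed.

Lemma dZ c f x a : is_derive x 1 f a -> is_derive x 1 (fun y => c * f y) (c * a).
Proof. by move=> df; apply: is_derive_eq (dM (dcst c x) df) _; rewrite mul0r add0r. Qed.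

Lemma dX f n x a : is_derive x 1 f a ->
  is_derive x 1 (fun y => f y ^+ n) (n%:R * f x ^+ n.-1 * a).
Proof. by move=> df; have := is_deriveX n df; rewrite exprfctE. Qed.

Lemma dV f x a : f x != 0 -> is_derive x 1 f a ->
  is_derive x 1 (fun y => (f y)^-1) (- (f x) ^- 2 * a).
Proof. by move=> fx df; apply: is_deriveV. Qed.

Lemma dexp f x a : is_derive x 1 f a ->
  is_derive x 1 (fun y => expR (f y)) (expR (f x) * a).
Proof. by move=> df; apply: is_derive1_comp. Qed.

Lemma dcomp f g x a b : is_derive (g x) 1 f a -> is_derive x 1 g b ->
  is_derive x 1 (fun y => f (g y)) (a * b).
Proof. exact: is_derive1_comp. Qed.

Lemma MVT_derivable f (df : R -> R) a b : a < b ->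
  (forall x, a <= x <= b -> is_derive x 1 f (df x)) ->
  exists2 c, a < c < b & f b - f a = df c * (b - a).
Proof.
move=> ab D; case: (@MVT R f df a b ab).
- by move=> x; rewrite in_itv /= => /andP[ax xb]; apply: D; rewrite !ltW.
- apply: derivable_within_continuous => x; rewrite in_itv /= => H.
  by case: (D x H).
- by move=> c; rewrite in_itv /= => Hc E; exists c.
Qed.

(** The factor exp(Kx) makes f nondecreasing. The information travels from right to left, because
    solutions will be compared near infinity first and then at smaller arguments. *)
Lemma gronwall_zero f (df : R -> R) K a b : a <= b ->
  (forall x, a <= x <= b -> is_derive x 1 f (df x)) ->
  (forall x, a <= x <= b -> - (K * f x) <= df x) ->
  f b = 0 -> f a <= 0.
Proof.
rewrite le_eqVlt => /orP[/eqP -> _ _ -> //|ab] D H fb.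
pose g x := f x * expR (K * x).
have Dg x : a <= x <= b -> is_derive x 1 g ((df x + K * f x) * expR (K * x)).
  move=> Hx; have Dx := D _ Hx.
  by apply: is_derive_eq (dM Dx (dexp (dZ K (did x)))) _; ring.
have [c /andP[ac cb] E] := MVT_derivable ab Dg.
have Hc : a <= c <= b by rewrite !ltW.
have : 0 <= g b - g a.
  rewrite E; apply: mulr_ge0; last by rewrite subr_ge0 ltW.
  by apply: mulr_ge0; [have := H _ Hc; lra | exact: expR_ge0].
by rewrite /g fb mul0r sub0r oppr_ge0 pmulr_lle0 ?expR_gt0.
Qed.

Lemma derive_const_gt0 f c : (forall x, 0 < x -> is_derive x 1 f 0) ->
  0 < c -> forall x, 0 < x -> f x = f c.
Proof.
move=> D c0 x x0; wlog xc : x c x0 c0 / x <= c.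
  move=> H; case: (leP x c) => [|/ltW] Hxc; first exact: H.
  by apply/esym/H.
move: xc; rewrite le_eqVlt => /orP[/eqP -> //|xc].
have [z _ E] := @MVT_derivable f (fun=> 0) x c xc
   (fun z Hz => D z (lt_le_trans x0 (proj1 (andP Hz)))).
by apply/esym/eqP; rewrite -subr_eq0 E mul0r.
Qed.

Lemma derive_const f : (forall x, is_derive x 1 f 0) -> forall x y, f x = f y.
Proof. by move=> D x y; apply: is_derive_0_is_cst. Qed.

End Derivatives.

(** * Uniqueness of the normalized Whittaker function *)

Section WhittakerUniqueness.
Variable R : realType.
Implicit Types (w : R -> R) (kappa mu : R).

(** The energy u^2 + v^2 has derivative 2uv(1 + q), which is at least -K times the energy, so
    [gronwall_zero] applies to it. *)
Lemma linear_ode2_zero (q u v : R -> R) (K a b : R) : 0 < a -> a <= b ->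
  (forall x : R, 0 < x -> is_derive x 1 u (v x)) ->
  (forall x : R, 0 < x -> is_derive x 1 v (q x * u x)) ->
  (forall x : R, a <= x <= b -> `|1 + q x| <= K) ->
  u b = 0 -> v b = 0 -> u a = 0.
Proof.
move=> a0 ab Du Dv HK ub vb.
pose E x := u x * u x + v x * v x.
pose dE x := 2 * (u x * v x) * (1 + q x).
suff : E a <= 0.
  by rewrite /E => H; apply/eqP; rewrite -sqrf_eq0 eq_le sqr_ge0 andbT expr2;
     nra.
apply: (@gronwall_zero _ E dE K a b) => //.
- move=> x /andP[ax _]; have x0 := lt_le_trans a0 ax.
  apply: is_derive_eq (dD (dM (Du _ x0) (Du _ x0)) (dM (Dv _ x0) (Dv _ x0))) _.
  by rewrite /dE; ring.
- move=> x Hx; rewrite /dE /E.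
  have E0 : `|2 * (u x * v x)| <= u x * u x + v x * v x.
    have h1 := sqr_ge0 (u x - v x); have h2 := sqr_ge0 (u x + v x).
    by rewrite ler_norml; apply/andP; split; rewrite !expr2 in h1 h2; lra.
  have := ler_pM (normr_ge0 _) (normr_ge0 _) E0 (HK x Hx).
  by rewrite -normrM ler_norml => /andP[+ _]; rewrite mulrC.
- by rewrite /E ub vb !mulr0 addr0.
Qed.

(** Squaring turns exp(-y/2) into exp(-y), which beats y^n for the integer n above 2 kappa. The
    bound is used to keep 1/w^2 away from 0 in the Wronskian argument. *)
Lemma powR_expR_bounded kappa : exists2 M : R, 0 < M &
  forall y, 1 <= y -> (y `^ kappa * expR (- y / 2)) ^+ 2 <= M.
Proof.
pose n := (Num.truncn `|2 * kappa|).+1.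
exists (n`!%:R); first by rewrite ltr0n fact_gt0.
move=> y y1; have y0 : 0 < y := lt_le_trans ltr01 y1.
rewrite exprMn -expRM_natl -[(_ `^ _) ^+ 2]powR_mulrn ?powR_ge0 // -powRrM.
have -> : 2 * (- y / 2) = - y by field.
have kn : kappa * 2 <= n%:R.
  by rewrite (le_trans (ler_norm _)) // mulrC ltW // truncnS_gt.
apply: (@le_trans _ _ (y ^+ n * expR (- y))).
  by rewrite ler_wpM2r ?expR_ge0 // -powR_mulrn ?ler_powR // ltW.
rewrite expRN ler_pdivrMr ?expR_gt0 // mulrC -ler_pdivrMr ?ltr0n ?fact_gt0 //.
have := @expR_ge1Dxn _ y n.-1 (ltW y0); rewrite /n /= -/n.
by apply: le_trans; rewrite lerDr.
Qed.

Lemma whittaker_ode kappa mu w : is_whittakerW kappa mu w ->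
  (forall y : R, 0 < y -> is_derive y 1 w (derive1 w y)) /\
  (forall y : R, 0 < y -> is_derive y 1 (derive1 w)
      ((4^-1 - kappa / y - (4^-1 - mu ^+ 2) / y ^+ 2) * w y)).
Proof.
case=> H _; split=> y y0; have [Dw Dw' E] := H y y0.
  by rewrite derive1E; exact: (derivableP Dw).
apply: is_derive_eq (derivableP Dw') _.
rewrite -derive1E; apply/eqP; rewrite -subr_eq0; apply/eqP.
by rewrite -[RHS]E; ring.
Qed.

(** The Wronskian c of two solutions is constant and (w1/w2)' = c/w2^2. Since w2 is bounded near
    infinity, c <> 0 would make the ratio grow linearly, whereas it tends to 1. Uniqueness is what
    identifies the function chosen by [xget] in [whittakerW]. *)
Lemma whittakerW_unique kappa mu w1 w2 : is_whittakerW kappa mu w1 ->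
  is_whittakerW kappa mu w2 -> forall y : R, 0 < y -> w1 y = w2 y.
Proof.
move=> W1 W2.
have [D1 D1'] := whittaker_ode W1; have [D2 D2'] := whittaker_ode W2.
pose q (y : R) : R := 4^-1 - kappa / y - (4^-1 - mu ^+ 2) / y ^+ 2.
set v1 := derive1 w1 in D1 D1'; set v2 := derive1 w2 in D2 D2'.
pose wr y := v1 y * w2 y - w1 y * v2 y.
have wrc : forall y, 0 < y -> wr y = wr 1.
  apply: derive_const_gt0 => // y y0.
  apply: is_derive_eq (dB (dM (D1' _ y0) (D2 _ y0)) (dM (D1 _ y0) (D2' _ y0))) _.
  by rewrite /q; ring.
set c := wr 1 in wrc.
pose g (y : R) : R := y `^ kappa * expR (- y / 2).
have g_gt0 y : 0 < y -> 0 < g y by move=> y0; rewrite mulr_gt0 ?powR_gt0 ?expR_gt0.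
have [M M0 HM] := powR_expR_bounded kappa.
(* Past A both functions are within a factor 1 - 1/4 to 1 + 1/4 of the model g: they are positive
   and their ratio is at most 5/3. *)
have [A A1 HA] : exists2 A : R, 1 <= A & forall y, A <= y ->
    `|1 - w1 y / g y| < 4^-1 /\ `|1 - w2 y / g y| < 4^-1.
  have e0 : (0 : R) < 4^-1 by rewrite invr_gt0.
  move/cvgrPdist_lt: (W1.2) => /(_ _ e0) [A1 [_ H1]].
  move/cvgrPdist_lt: (W2.2) => /(_ _ e0) [A2 [_ H2]].
  exists (`|A1| + `|A2| + 1); first by rewrite lerDr addr_ge0.
  move=> y Hy; have n1 := ler_norm A1; have n2 := ler_norm A2.
  have p1 := normr_ge0 A1; have p2 := normr_ge0 A2.
  by split; [apply: H1|apply: H2]; lra.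
have A0 : 0 < A by exact: lt_le_trans A1.
have HB y : A <= y -> [/\ 3/4 * g y <= w1 y, w1 y <= 5/4 * g y,
    3/4 * g y <= w2 y & w2 y <= 5/4 * g y].
  move=> Ay; have gy := g_gt0 _ (lt_le_trans A0 Ay).
  have [] := HA _ Ay; rewrite !ltr_norml => /andP[a1 a2] /andP[b1 b2].
  have E w : w y = (w y / g y) * g y by rewrite divfK // gt_eqF.
  by rewrite (E w1) (E w2); split; rewrite ler_pM2r //; lra.
have w2_gt0 y : A <= y -> 0 < w2 y.
  move=> Ay; have [_ _ + _] := HB _ Ay; apply: lt_le_trans.
  by have := g_gt0 _ (lt_le_trans A0 Ay); lra.
have Dr y : A <= y -> is_derive y 1 (fun z => w1 z / w2 z) (c / (w2 y) ^+ 2).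
  move=> Ay; have y0 := lt_le_trans A0 Ay; have nz : w2 y != 0 by rewrite gt_eqF ?w2_gt0.
  apply: is_derive_eq (dM (D1 _ y0) (dV nz (D2 _ y0))) _.
  by rewrite -(wrc _ y0) /wr; field.
have r_itv y : A <= y -> 0 < w1 y / w2 y < 2.
  move=> Ay; have [h1 h2 h3 h4] := HB _ Ay; have p := w2_gt0 _ Ay.
  have gy := g_gt0 _ (lt_le_trans A0 Ay).
  by rewrite divr_gt0 ?ltr_pdivrMr //=; lra.
have c0 : c = 0.
  apply/eqP; apply: contraT => cn0; exfalso.
  have cp : 0 < `|c| by rewrite normr_gt0.
  (* Over an interval of length T the ratio changes by 4M/w2^2 in absolute value, and w2^2 <=
     (25/16) M makes this exceed 2, the width of the interval containing the ratio. *)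
  pose T := 4 * M / `|c|.
  have T0 : 0 < T by rewrite divr_gt0 // mulr_gt0.
  have AT : A < A + T by rewrite ltrDl.
  have [z /andP[/ltW Az _] E] := @MVT_derivable _ _ _ _ _ AT
     (fun x Hx => Dr x (proj1 (andP Hx))).
  have /andP[r1 r2] := r_itv _ (lexx A).
  have /andP[r3 r4] := r_itv _ (ltW AT).
  have : `|w1 (A + T) / w2 (A + T) - w1 A / w2 A| < 2 by rewrite ltr_norml; lra.
  have -> : w1 (A + T) / w2 (A + T) - w1 A / w2 A = c / w2 z ^+ 2 * T.
    by rewrite E; congr (_ * _); ring.
  rewrite (normrM _ T) (gtr0_norm T0) normrM normrV ?unitfE ?expf_neq0 ?gt_eqF ?w2_gt0 //.
  have p := w2_gt0 _ Az; rewrite (ger0_norm (sqr_ge0 (w2 z))).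
  have -> : `|c| / w2 z ^+ 2 * T = 4 * M / w2 z ^+ 2.
    by rewrite /T; field; rewrite normr_eq0 cn0 gt_eqF.
  rewrite ltr_pdivrMr ?exprn_gt0 // ltNge => /negP; apply.
  have [_ _ _ h] := HB _ Az.
  have := HM z (le_trans A1 Az); rewrite -/(g z) => hM.
  have gz := g_gt0 _ (lt_le_trans A0 Az).
  have : w2 z ^+ 2 <= (5/4 * g z) ^+ 2 by rewrite ler_sqr ?nnegrE; lra.
  rewrite exprMn => h'; lra.
have wr0 y : 0 < y -> v1 y * w2 y = w1 y * v2 y.
  by move=> y0; apply/eqP; rewrite -subr_eq0 -/(wr y) wrc // c0.
pose r := w1 A / w2 A.
have rE y : A <= y -> w1 y = r * w2 y.
  rewrite le_eqVlt => /orP[/eqP <-|Ay].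
    by rewrite /r divfK // gt_eqF // w2_gt0.
  have [z _ E] := @MVT_derivable _ _ _ _ _ Ay (fun x Hx => Dr x (proj1 (andP Hx))).
  have p := w2_gt0 _ (ltW Ay).
  rewrite /r; move: E; rewrite c0 !mul0r => /eqP; rewrite subr_eq0 => /eqP <-.
  by rewrite divfK // gt_eqF.
have r1 : r = 1.
  have C2 : (r * (w2 y / (y `^ kappa * expR (- y / 2))) @[y --> +oo] --> r * 1)%classic.
    by apply: cvgM; [exact: cvg_cst | exact: W2.2].
  have C1 := W1.2.
  have E : (r * (w2 y / (y `^ kappa * expR (- y / 2))) @[y --> +oo] --> (1 : R))%classic.
    apply: cvg_trans C1; apply: near_eq_cvg.
    by exists A; split; [exact: num_real | move=> y /ltW Ay /=; rewrite mulrA rE].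
  have := @cvg_unique _ (@norm_hausdorff _ _) _ _ _ _ E C2.
  by rewrite mulr1 => h; rewrite h.
have weq y : A <= y -> w1 y = w2 y by move=> Ay; rewrite rE // r1 mul1r.
(* Below A the asymptotics say nothing. The difference w1 - w2 solves the same linear equation and
   vanishes at A together with its derivative, the latter because the Wronskian is 0 and w2 A is
   not. *)
move=> y y0; case: (leP A y) => [/weq //|/ltW yA].
apply/eqP; rewrite -subr_eq0; apply/eqP.
pose K : R := 1 + 4^-1 + `|kappa| / y + `|4^-1 - mu ^+ 2| / y ^+ 2.
apply: (@linear_ode2_zero q (fun z => w1 z - w2 z) (fun z => v1 z - v2 z) K y A) => //.
- by move=> x x0; apply: dB; [exact: D1 | exact: D2].
- by move=> x x0; apply: is_derive_eq (dB (D1' _ x0) (D2' _ x0)) _; rewrite /q; ring.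
- move=> x /andP[yx _]; have x0 := lt_le_trans y0 yx.
  have -> : 1 + q x = 1 + 4^-1 + (- (kappa / x) + - ((4^-1 - mu ^+ 2) / x ^+ 2)).
    by rewrite /q; ring.
  have h1 : `|1 + 4^-1 : R| <= 1 + 4^-1 by rewrite ger0_norm //; lra.
  have h2 : `|kappa / x| <= `|kappa| / y.
    rewrite normrM ler_wpM2l // ger0_norm ?invr_ge0 ?(ltW x0) //.
    by rewrite lef_pV2 // posrE.
  have h3 : `|(4^-1 - mu ^+ 2) / x ^+ 2| <= `|4^-1 - mu ^+ 2| / y ^+ 2.
    rewrite normrM ler_wpM2l // ger0_norm ?invr_ge0 ?sqr_ge0 //.
    by rewrite lef_pV2 ?posrE ?exprn_gt0 // ler_sqr ?nnegrE // ltW.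
  have := ler_normD (- (kappa / x)) (- ((4^-1 - mu ^+ 2) / x ^+ 2)).
  rewrite !normrN => h4; apply: (le_trans (ler_normD _ _)).
  by rewrite /K; lra.
- by rewrite weq // subrr.
- have := wr0 _ A0; rewrite weq // mulrC => /mulfI -> //; first by rewrite subrr.
  by rewrite gt_eqF // w2_gt0.
Qed.

End WhittakerUniqueness.

(** * Laguerre polynomials and the Whittaker functions of polynomial type *)

Section Laguerre.
Variable R : realType.
Implicit Types (m z : R) (n : nat).

(* n! (-1)^n times the Laguerre polynomial L_n^(2m-1) *)
Fixpoint lagp m n : {poly R} :=
  if n is p.+1 then
    ('X - (2 * m + p%:R)%:P) * lagp m p - 'X * (lagp m p)^`()
  else 1.

Arguments lagp : simpl never.

Lemma lagp0 m : lagp m 0 = 1.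
Proof. by []. Qed.

Lemma lagpS m n :
  lagp m n.+1 = ('X - (2 * m + n%:R)%:P) * lagp m n - 'X * (lagp m n)^`().
Proof. by []. Qed.

(** The lowering relation; the definition of [lagp] is the raising one. Together they give the
    three-term recurrence and replace the Laguerre differential equation. Derivatives are kept
    multiplied by 'X so that the induction hypothesis can substitute for them. *)
Lemma deriv_lagpS m n : 'X * (lagp m n.+1)^`() =
  (n.+1%:R)%:P * (lagp m n.+1 + (2 * m + n%:R)%:P * lagp m n).
Proof.
elim: n => [|n IH].
  by rewrite lagpS lagp0 !poly.derivE; ring.
have E1 : 'X * (lagp m n)^`() = ('X - (2 * m + n%:R)%:P) * lagp m n - lagp m n.+1.
  by rewrite lagpS; ring.
have E2 : lagp m n.+2 = ('X - (2 * m + n.+1%:R)%:P) * lagp m n.+1 -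
     (n.+1%:R)%:P * (lagp m n.+1 + (2 * m + n%:R)%:P * lagp m n).
  by rewrite -IH.
have E3 : 'X * (lagp m n.+2)^`() = 'X * lagp m n.+1 +
    ('X - (2 * m + n.+1%:R)%:P) * ('X * (lagp m n.+1)^`()) -
    (n.+1%:R)%:P * ('X * (lagp m n.+1)^`() +
       (2 * m + n%:R)%:P * ('X * (lagp m n)^`())).
  by rewrite E2 !poly.derivE; ring.
by rewrite E3 IH E1 E2 -!natr1; ring.
Qed.

Lemma lagpSS m n : lagp m n.+2 =
  ('X - (2 * m + 2 * n.+1%:R)%:P) * lagp m n.+1 -
  (n.+1%:R * (2 * m + n%:R))%:P * lagp m n.
Proof. by rewrite lagpS deriv_lagpS -!natr1; ring. Qed.

(** This is W_(m+n, m-1/2): the parameters satisfy kappa - mu - 1/2 = n, the case in which the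
    confluent hypergeometric factor is a polynomial. *)
Definition wlag m n z : R := z `^ m * expR (- z / 2) * (lagp m n).[z].

Lemma wlag0 m z : wlag m 0 z = z `^ m * expR (- z / 2).
Proof. by rewrite /wlag lagp0 hornerC mulr1. Qed.

Lemma is_derive_wlag m n z : 0 < z -> is_derive z 1 (wlag m n)
  ((m / z - 2^-1) * wlag m n z + z `^ m * expR (- z / 2) * (lagp m n)^`().[z]).
Proof.
move=> z0.
have E : z `^ (m - 1) = z `^ m / z.
  by rewrite powRB ?powRr1 ?ltW // (gt_eqF z0) implybT.
apply: is_derive_eq (dM (dM (is_derive1_powR m z0)
   (dexp (dM (dN (did z)) (dcst 2^-1 z)))) (is_derive_poly (lagp m n) z)) _.
rewrite /wlag E; field; by rewrite gt_eqF.
Qed.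

Lemma is_derive_wlag_raise m n z : 0 < z -> is_derive z 1 (wlag m n)
  ((2^-1 - (m + n%:R) / z) * wlag m n z - wlag m n.+1 z / z).
Proof.
move=> z0; apply: is_derive_eq (is_derive_wlag m n z0) _.
rewrite /wlag lagpS !(hornerD, hornerN, hornerM, hornerX, hornerC).
by field; rewrite gt_eqF.
Qed.

Lemma is_derive_wlag_lower m n z : 0 < z -> is_derive z 1 (wlag m n.+1)
  (((m + n.+1%:R) / z - 2^-1) * wlag m n.+1 z
   + n.+1%:R * (2 * m + n%:R) / z * wlag m n z).
Proof.
move=> z0; apply: is_derive_eq (is_derive_wlag m n.+1 z0) _.
have := congr1 (fun p => p.[z]) (deriv_lagpS m n).
rewrite hornerM hornerX => E.
have -> : (lagp m n.+1)^`().[z] =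
    (n.+1%:R * ((lagp m n.+1).[z] + (2 * m + n%:R) * (lagp m n).[z])) / z.
  apply: (mulfI (lt0r_neq0 z0)); rewrite E !(hornerD, hornerN, hornerM, hornerX, hornerC); field.
  by rewrite gt_eqF.
by rewrite /wlag; field; rewrite gt_eqF.
Qed.

Lemma lagp_cvg m n : ((lagp m n).[z] / z ^+ n @[z --> +oo] --> (1 : R))%classic.
Proof.
have Vcvg : ((z : R)^-1 @[z --> +oo] --> (0 : R))%classic.
  apply/cvgrPdist_lt => e e0; exists e^-1; split=> [|z ez]; first exact: num_real.
  have z0 : 0 < z by apply: lt_trans ez; rewrite invr_gt0.
  by rewrite sub0r normrN gtr0_norm ?invr_gt0 // invf_plt.
(* The recurrence [lagpSS] involves two earlier terms, so two consecutive indices are carried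
   through the induction. *)
suff: ((lagp m n).[z] / z ^+ n @[z --> +oo] --> (1 : R))%classic /\
      ((lagp m n.+1).[z] / z ^+ n.+1 @[z --> +oo] --> (1 : R))%classic by case.
elim: n => [|n [IH1 IH2]].
  split.
    apply: cvg_near_cst.
    by exists 0; split=> // z z0 /=; rewrite lagp0 hornerC expr0 divr1.
  have C : ((1 : R) - (2 * m) * z^-1 @[z --> +oo] --> (1 : R) - (2 * m) * 0)%classic.
    by apply: cvgB; [exact: cvg_cst | apply: cvgM => //; exact: cvg_cst].
  rewrite mulr0 subr0 in C; apply: cvg_trans C; apply: near_eq_cvg.
  exists 0; split=> // z z0 /=; rewrite lagpS lagp0
    !(poly.derivE, hornerD, hornerN, hornerM, hornerX, hornerC).
  by field; rewrite gt_eqF.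
split=> //.
have C : ((1 - (2 * m + 2 * n.+1%:R) * z^-1) * ((lagp m n.+1).[z] / z ^+ n.+1)
   - (n.+1%:R * (2 * m + n%:R)) * z^-1 * z^-1 * ((lagp m n).[z] / z ^+ n)
   @[z --> +oo] --> (1 - (2 * m + 2 * n.+1%:R) * 0) * 1
     - (n.+1%:R * (2 * m + n%:R)) * 0 * 0 * (1 : R))%classic.
  apply: cvgB; apply: cvgM => //.
    by apply: cvgB; [exact: cvg_cst | apply: cvgM => //; exact: cvg_cst].
  by apply: cvgM => //; apply: cvgM => //; exact: cvg_cst.
rewrite !mulr0 mul0r subr0 mulr1 subr0 in C.
apply: cvg_trans C; apply: near_eq_cvg; exists 0; split=> // z z0 /=.
rewrite lagpSS !(hornerD, hornerN, hornerM, hornerX, hornerC) !exprS; field.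
by rewrite expf_neq0 ?gt_eqF.
Unshelve. all: by end_near.
Qed.

(** The second derivative comes from raising n to n+1 and then lowering back to n, which closes up
    on [wlag m n]. Only mu^2 enters the equation, so both signs of m - 1/2 are covered. *)
Lemma wlag_whittaker m n mu : mu ^+ 2 = (m - 2^-1) ^+ 2 ->
  is_whittakerW (m + n%:R) mu (wlag m n).
Proof.
move=> hmu; split; last first.
  apply: cvg_trans (lagp_cvg m n); apply: near_eq_cvg.
  exists 0; split=> // z z0 /=.
  rewrite /wlag powRD; last by rewrite (gt_eqF z0) implybT.
  rewrite powR_mulrn ?ltW //; field.
  by rewrite ?expf_neq0 ?gt_eqF ?powR_gt0 ?expR_gt0.
move=> y y0; have D := is_derive_wlag_raise m n y0.
pose w' (z : R) : R := (2^-1 - (m + n%:R) / z) * wlag m n z - wlag m n.+1 z / z.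
have D' : is_derive y 1 (derive1 (wlag m n))
   (((m + n%:R) / y ^+ 2) * wlag m n y + (2^-1 - (m + n%:R) / y) * w' y
    + wlag m n.+1 y / y ^+ 2 - (((m + n.+1%:R) / y - 2^-1) * wlag m n.+1 y
   + n.+1%:R * (2 * m + n%:R) / y * wlag m n y) / y).
  apply: (@near_eq_is_derive _ _ _ w').
  - near=> z; have z0 : 0 < z by near: z; exact: lt_nbhsr.
    have Dz := is_derive_wlag_raise m n z0.
    by rewrite derive1E derive_val.
  - have Dv : is_derive y 1 (fun z : R => z^-1) (- y ^- 2 * 1).
      by apply: dV (did y); rewrite gt_eqF.
    apply: is_derive_eq (dB (dM (dB (dcst 2^-1 y) (dM (dcst (m + n%:R) y) Dv)) D)
       (dM (is_derive_wlag_lower m n y0) Dv)) _.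
    by rewrite /w'; field; rewrite gt_eqF.
split.
- by case: D.
- by case: D'.
- rewrite derive1E derive_val hmu /w' -!natr1; field.
  by rewrite gt_eqF.
Unshelve. all: by end_near.
Qed.

Lemma whittakerW_wlag m n mu z : mu ^+ 2 = (m - 2^-1) ^+ 2 -> 0 < z ->
  whittakerW (m + n%:R) mu z = wlag m n z.
Proof.
move=> hmu; have W := @wlag_whittaker m n mu hmu.
move=> z0; apply: (whittakerW_unique _ W z0).
by rewrite /whittakerW; case: xgetP => [w _ //|/(_ _ W)].
Qed.

End Laguerre.

(** * The radial system *)

Section SchmidSystem.
Variable R : realType.

Lemma is_derive_unique (f : R -> R) (x a b : R) :
  is_derive x 1 f a -> is_derive x 1 f b -> a = b.
Proof. by move=> Da Db; rewrite -(@derive_val _ _ _ _ _ _ _ Da) -(@derive_val _ _ _ _ _ _ _ Db). Qed.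

Lemma ode1_solution (f h H : R -> R) : (forall t : R, is_derive t 1 f (h t * f t)) ->
  (forall t : R, is_derive t 1 H (h t)) -> forall t, f t = f 0 * expR (H t - H 0).
Proof.
move=> Df DH t.
have C : f t * expR (- H t) = f 0 * expR (- H 0).
  apply: (@derive_const _ (fun t => f t * expR (- H t))) => x.
  by apply: is_derive_eq (dM (Df x) (dexp (dN (DH x)))) _; ring.
have E : expR (- H t) * expR (H t) = 1 by rewrite -expRD addNr expR0.
by rewrite -[LHS]mulr1 -E mulrA C -mulrA [H t - _]addrC (expRD (- H 0)).
Qed.

Lemma double_exponential_growth_zero (q a c C N : R) : 0 < q ->
  (forall t : R, 0 <= t -> `|c * expR (q / 2 * expR (2 * t) + a * t)| <= C * expR (N * t)) ->
  c = 0.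
Proof.
move=> q0 H; apply/eqP; apply: contraT => cn0; exfalso.
have c0 : 0 < `|c| by rewrite normr_gt0.
(* The first summand forces the exponent to exceed N t by at least t, through exp(2t) >= 2 t^2; the
   second forces |c| (1 + t) > C. *)
pose t : R := `|(1 + N - a) / q| + `|C| / `|c|.
have h1 : (1 + N - a) / q <= t.
  by rewrite (le_trans (ler_norm _)) // /t lerDl divr_ge0.
have h2 : `|C| <= t * `|c| by rewrite -ler_pdivrMr // /t lerDr.
have t0 : 0 <= t by rewrite addr_ge0 // divr_ge0.
have := H t t0; rewrite normrM (ger0_norm (expR_ge0 _)).
move=> H0.
have H1 : `|c| * expR (q / 2 * expR (2 * t) + a * t - N * t) <= C.
  by rewrite expRD mulrA expRN ler_pdivrMr ?expR_gt0.
have h3 : t <= q / 2 * expR (2 * t) + a * t - N * t.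
  have := @expR_ge1Dxn _ (2 * t) 1 (mulr_ge0 (ltW (ltr0n _ 2)) t0).
  have -> : (2`! = 2)%N by [].
  move: h1; rewrite ler_pdivrMr // => h1 h4.
  have h5 : 2 * t ^+ 2 <= expR (2 * t) by move: h4; rewrite exprMn; lra.
  have h6 : q / 2 * (2 * t ^+ 2) <= q / 2 * expR (2 * t).
    by rewrite ler_wpM2l //; lra.
  have h7 : t * (1 + N - a) <= t * (t * q) by rewrite ler_wpM2l.
  move: h6; rewrite expr2; lra.
have h4 : 1 + t <= expR (q / 2 * expR (2 * t) + a * t - N * t).
  by rewrite (le_trans (expR_ge1Dx t)) // ler_expR.
have : `|c| * (1 + t) <= C by apply: le_trans H1; rewrite ler_wpM2l.
have := ler_norm C; lra.
Qed.

Lemma is_derive_gauge (q t : R) :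
  is_derive t 1 (fun t => q * expR (2 * t)) (2 * (q * expR (2 * t))).
Proof. by apply: is_derive_eq (dZ q (dexp (dZ 2 (did t)))) _; ring. Qed.

Lemma is_derive_wlag_exp_raise (q m t : R) n : 0 < q ->
  is_derive t 1 (fun t => wlag m n (q * expR (2 * t)))
    ((q * expR (2 * t) - 2 * (m + n%:R)) * wlag m n (q * expR (2 * t))
     - 2 * wlag m n.+1 (q * expR (2 * t))).
Proof.
move=> q0; have z0 : 0 < q * expR (2 * t) by rewrite mulr_gt0 ?expR_gt0.
apply: is_derive_eq (dcomp (g := fun t => q * expR (2 * t))
  (is_derive_wlag_raise m n z0) (is_derive_gauge q t)) _.
by field; rewrite !gt_eqF ?expR_gt0.
Qed.

Lemma is_derive_wlag_exp_lower (q m t : R) n : 0 < q ->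
  is_derive t 1 (fun t => wlag m n.+1 (q * expR (2 * t)))
    ((2 * (m + n.+1%:R) - q * expR (2 * t)) * wlag m n.+1 (q * expR (2 * t))
     + 2 * n.+1%:R * (2 * m + n%:R) * wlag m n (q * expR (2 * t))).
Proof.
move=> q0; have z0 : 0 < q * expR (2 * t) by rewrite mulr_gt0 ?expR_gt0.
apply: is_derive_eq (dcomp (g := fun t => q * expR (2 * t))
  (is_derive_wlag_lower m n z0) (is_derive_gauge q t)) _.
by field; rewrite !gt_eqF ?expR_gt0.
Qed.

(* The equations are those satisfied by F k = phi_k at a_1 = e^(s+t),
   a_2 = e^(s-t), for lambda in Xi_II and c_0 > 0, with L = Lambda_1,
   q = 4 pi c_0. *)
Lemma schmid_system_solution (q : R) (d L : nat) (F Fs Ft : nat -> R -> R -> R) :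
  0 < q -> (1 < L < d)%N ->
  (forall k (s t : R), (k <= d)%N -> is_derive s 1 (fun s => F k s t) (Fs k s t)) ->
  (forall k (s t : R), (k <= d)%N -> is_derive t 1 (F k s) (Ft k s t)) ->
  (forall k s t, (0 < k < d)%N -> Fs k s t = (d%:R + 2) * F k s t) ->
  (forall k s t, (0 < k < d)%N ->
     Ft k.+1 s t + (q * expR (2 * t) - (2 * k%:R - d%:R) - 2) * F k.+1 s t
     = 2 * (k%:R + L%:R - d%:R) * F k s t) ->
  (forall k s t, (0 < k < d)%N ->
     Ft k.-1 s t + (- (q * expR (2 * t)) + (2 * k%:R - d%:R) - 2) * F k.-1 s t
     = 2 * (L%:R - k%:R) * F k s t) ->
  (forall s t, Ft d.-1 s t + (- (q * expR (2 * t)) + d%:R - 2) * F d.-1 s t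
     = - Fs d s t + (2 * (L%:R - d%:R) + d%:R + 2) * F d s t) ->
  (forall k s, (k <= d)%N -> exists C N : R, forall t : R, 0 <= t ->
     `|F k s t| <= C * expR (N * t)) ->
  exists C0 C1 : R, forall k s t, (k <= d)%N ->
    F k s t = C0 * (if (k < L)%N then 0 else ((k - L)`!)%:R^-1)
        * expR ((d%:R + 2) * s) * wlag (L%:R - d%:R / 2) (k - L) (q * expR (2 * t))
      + C1 * (k == d)%:R * expR ((2 * L%:R - d%:R + 2) * s + d%:R * t
           - q * expR (2 * t) / 2).
Proof.
move=> q0 /andP[L1 Ld] Ds Dt Hth HA HB Hbd Hgr.
pose z (t : R) := q * expR (2 * t); pose m : R := L%:R - d%:R / 2.
pose E n (t : R) := wlag m n (z t).
have Dz := @is_derive_gauge q.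
have Dz2 (a t : R) : is_derive t 1 (fun t => a * t - q * expR (2 * t) / 2) (a - z t).
  apply: is_derive_eq (dB (dZ a (did t)) (dM (Dz t) (dcst 2^-1 t))) _.
  by rewrite /z; field.
(* When its right side vanishes, [HB] at k+1 says F_k' = (z + d - 2k) F_k, whose nonzero solutions
   are multiples of exp(z/2 + (d - 2k) t); moderate growth excludes them. *)
have descend k : (k.+1 < d)%N ->
    (forall s t, 2 * (L%:R - k.+1%:R) * F k.+1 s t = 0) ->
    forall s t, F k s t = 0.
  move=> kd Z s t; have kd' : (k <= d)%N by lia.
  pose a : R := d%:R - 2 * k%:R.
  have S u : F k s u = F k s 0 *
      expR (q * expR (2 * u) / 2 + a * u - (q * expR (2 * 0) / 2 + a * 0)).
    apply: (@ode1_solution (F k s) (fun t => z t + a)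
      (fun u => q * expR (2 * u) / 2 + a * u)) => v.
      apply: is_derive_eq (Dt k s v kd') _.
      have := HB k.+1 s v kd; rewrite Z /= -/(z v) -natr1 /a.
      by move=> /eqP; rewrite addr_eq0 => /eqP ->; ring.
    apply: is_derive_eq (dD (dM (Dz v) (dcst 2^-1 v)) (dZ a (did v))) _.
    by rewrite /z; field.
  have [C [N G]] := Hgr k s kd'.
  have Z0 : F k s 0 * expR (- (q * expR (2 * 0) / 2 + a * 0)) = 0.
    apply: (@double_exponential_growth_zero q a _ C N) => // u u0.
    have := G u u0; rewrite (S u) expRD mulrA mulrAC.
    by rewrite (_ : q / 2 * expR (2 * u) = q * expR (2 * u) / 2) //; field.
  by rewrite (S t) expRD [expR _ * _]mulrC mulrA Z0 mul0r.
(* The descent starts at k = L - 1, where the coefficient L - (k+1) is 0 whatever F_L is; below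
   that, F_(k+1) = 0 is already known. *)
have F0 j : (j < L)%N -> forall s t, F (L.-1 - j)%N s t = 0.
  elim: j => [|j IH] jL; apply: descend; try lia; move=> s t.
    by rewrite subn0 prednK ?subrr ?mulr0 ?mul0r //; lia.
  by rewrite (_ : (L.-1 - j.+1).+1 = L.-1 - j)%N ?IH ?mulr0 //; lia.
have Fz k s t : (k < L)%N -> F k s t = 0.
  by move=> kL; rewrite (_ : k = L.-1 - (L.-1 - k))%N ?F0 //; lia.
have m2 : 2 * m = 2 * L%:R - d%:R by rewrite /m; field.
(* [E 0] takes the value q^m exp(-q/2) at t = 0, so C0 is the quotient of F_L by it at the
   origin. *)
pose C0 := F L 0 0 * expR (q / 2) / q `^ m.
have E0 t : E 0%N t = q `^ m * expR (2 * m * t - z t / 2).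
  rewrite /E wlag0 /z powRM ?ltW ?expR_gt0 // -expRM -mulrA -expRD.
  by congr (_ * expR _); ring.
have Lint : (0 < L < d)%N by lia.
(* At k = L - 1 the other family [HA] has right side 0, because F_(L-1) = 0; it becomes a
   homogeneous equation for F_L, with decaying solutions this time. The bound 1 < L makes this index
   admissible. *)
have FL s t : F L s t = C0 * expR ((d%:R + 2) * s) * E 0%N t.
  have S1 : F L s 0 = F L 0 0 * expR ((d%:R + 2) * s - (d%:R + 2) * 0).
    apply: (@ode1_solution (fun s => F L s 0) (fun=> d%:R + 2) (fun s => (d%:R + 2) * s)).
      by move=> u; apply: is_derive_eq (Ds L u 0 (ltnW Ld)) _; rewrite (Hth _ _ _ Lint).
    by move=> u; apply: is_derive_eq (dZ _ (did u)) _; rewrite mulr1.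
  have S2 : F L s t = F L s 0 * expR ((2 * m * t - z t / 2) - (2 * m * 0 - z 0 / 2)).
    apply: (@ode1_solution (F L s) (fun t => 2 * m - z t) (fun t => 2 * m * t - z t / 2)).
      move=> u; apply: is_derive_eq (Dt L s u (ltnW Ld)) _.
      have kd : (0 < L.-1 < d)%N by lia.
      have := HA L.-1 s u kd; rewrite (Fz L.-1) ?mulr0 ?prednK ?(ltnW L1) //.
      move=> /eqP; rewrite addr_eq0 => /eqP ->; rewrite -/(z u) m2.
      have -> : L%:R = L.-1%:R + 1 :> R by rewrite natr1 prednK // (ltnW L1).
      by ring.
  rewrite S2 S1 E0 mulr0 subr0 mulr0 sub0r opprK expRD /z mulr0 expR0 mulr1 /C0.
  by field; rewrite gt_eqF // powR_gt0.
(* From here on [HB] is algebraic: it gives F_(L+n+1) from F_(L+n) and its derivative, as the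
   raising relation does for [wlag]. The coefficient -2(n+1) produces the factorial. *)
have FLn n : (L + n < d)%N -> forall s t,
    F (L + n)%N s t = C0 / (n`!)%:R * expR ((d%:R + 2) * s) * E n t.
  elim: n => [|n IH] nd s t; first by rewrite addn0 FL fact0 divr1.
  have nd' : (L + n < d)%N by lia.
  have kd : (0 < (L + n).+1 < d)%N by lia.
  have := HB (L + n).+1 s t kd; rewrite /= -addnS => H.
  have D : is_derive t 1 (F (L + n)%N s) (C0 / (n`!)%:R * expR ((d%:R + 2) * s) *
      ((z t - 2 * (m + n%:R)) * E n t - 2 * E n.+1 t)).
    rewrite (_ : F (L + n)%N s = fun t => C0 / (n`!)%:R * expR ((d%:R + 2) * s) * E n t).
      by apply: dZ; exact: is_derive_wlag_exp_raise.
    by apply/funext => u; exact: IH.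
  have E1 := is_derive_unique (Dt _ s t (ltnW nd')) D.
  move: H; rewrite E1 IH // -/(z t) => H.
  have nz : 2 * (L%:R - (L + n.+1)%:R) != 0 :> R.
    by rewrite natrD opprD addrA subrr sub0r mulrN oppr_eq0 mulf_neq0 // pnatr_eq0.
  apply: (mulfI nz); rewrite -H factS natrM.
  have f0 : n`!%:R != 0 :> R by rewrite pnatr_eq0 -lt0n fact_gt0.
  have n0 : 1 + n%:R != 0 :> R by rewrite nat1r pnatr_eq0.
  by rewrite !natrD /m -nat1r; field; rewrite f0 n0.
pose n := (d - L).-1; have dn : d = (L + n.+1)%N by rewrite /n; lia.
pose P (s t : R) := C0 / (n.+1`!)%:R * expR ((d%:R + 2) * s) * E n.+1 t.
have LN : (L%:R = d%:R - (n%:R + 1) :> R) by rewrite dn natrD -natr1; ring.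
have dE : d%:R = d.-1%:R + 1 :> R by rewrite natr1 prednK //; lia.
have Fd1 s t : F d.-1 s t = C0 / (n`!)%:R * expR ((d%:R + 2) * s) * E n t.
  by rewrite (_ : d.-1 = L + n)%N ?FLn //; lia.
have f0 : n`!%:R != 0 :> R by rewrite pnatr_eq0 -lt0n fact_gt0.
have fN : n.+1`!%:R = (1 + n%:R) * n`!%:R :> R by rewrite factS natrM nat1r.
have n0 : 1 + n%:R != 0 :> R by rewrite nat1r pnatr_eq0.
have Rt s : forall t : R, is_derive t 1 (fun t => F d s t - P s t)
   ((d%:R - z t) * (F d s t - P s t)).
  move=> t; have D : is_derive t 1 (P s) (C0 / (n.+1`!)%:R * expR ((d%:R + 2) * s) *
     ((2 * (m + n.+1%:R) - z t) * E n.+1 t + 2 * n.+1%:R * (2 * m + n%:R) * E n t)).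
    by apply: dZ; exact: is_derive_wlag_exp_lower.
  apply: is_derive_eq (dB (Dt d s t (leqnn d)) D) _.
  have kd : (0 < d.-1 < d)%N by lia.
  have := HA d.-1 s t kd; rewrite prednK; last by lia.
  move=> /(canRL (addrK _)) ->; rewrite Fd1 /P -/(z t) fN.
  rewrite /m -natr1 LN (_ : d.-1%:R = d%:R - 1); last by rewrite dE; ring.
  by field; rewrite f0 n0.
have Rs t : forall s : R, is_derive s 1 (fun s => F d s t - P s t)
   ((2 * L%:R - d%:R + 2) * (F d s t - P s t)).
  move=> s; have D : is_derive s 1 (fun s => P s t) ((d%:R + 2) * P s t).
    apply: is_derive_eq (dM (dZ _ (dexp (dZ _ (did s)))) (dcst (E n.+1 t) s)) _.
    by rewrite /P; ring.
  apply: is_derive_eq (dB (Ds d s t (leqnn d)) D) _.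
  have D1 : is_derive t 1 (F d.-1 s) (C0 / (n`!)%:R * expR ((d%:R + 2) * s) *
      ((z t - 2 * (m + n%:R)) * E n t - 2 * E n.+1 t)).
    rewrite (_ : F d.-1 s = fun t => C0 / (n`!)%:R * expR ((d%:R + 2) * s) * E n t).
      by apply: dZ; exact: is_derive_wlag_exp_raise.
    by apply/funext => u; exact: Fd1.
  have dd : (d.-1 <= d)%N by lia.
  have := Hbd s t; rewrite (is_derive_unique (Dt _ s t dd) D1) Fd1 -/(z t) => H.
  have -> : Fs d s t = (2 * (L%:R - d%:R) + d%:R + 2) * F d s t -
    (- Fs d s t + (2 * (L%:R - d%:R) + d%:R + 2) * F d s t) by ring.
  rewrite -H /P fN /m LN.
  by field; rewrite f0 n0.
(* The exponent of the second solution equals -q/2 at s = t = 0, which the factor exp(q/2)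
   compensates. *)
pose C1 := (F d 0 0 - P 0 0) * expR (q / 2).
have Rst s t : F d s t - P s t =
    C1 * expR ((2 * L%:R - d%:R + 2) * s + d%:R * t - z t / 2).
  have S1 : F d s 0 - P s 0 = (F d 0 0 - P 0 0) *
      expR ((2 * L%:R - d%:R + 2) * s - (2 * L%:R - d%:R + 2) * 0).
    apply: (@ode1_solution (fun s => F d s 0 - P s 0) (fun=> 2 * L%:R - d%:R + 2)
      (fun s => (2 * L%:R - d%:R + 2) * s)) => u //.
    by apply: is_derive_eq (dZ _ (did u)) _; rewrite mulr1.
  have -> : F d s t - P s t = (F d s 0 - P s 0) *
      expR ((d%:R * t - z t / 2) - (d%:R * 0 - z 0 / 2)).
    exact: (@ode1_solution (fun t => F d s t - P s t) (fun t => d%:R - z t)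
      (fun t => d%:R * t - z t / 2)).
  rewrite S1 /C1 -!mulrA -!expRD; congr (_ * expR _).
  by rewrite /z !mulr0 expR0; ring.
exists C0, C1 => k s t kd; case: ifP => kL.
  rewrite Fz // (_ : (k == d) = false) ?mulr0 ?mul0r ?addr0 ?mul0r //.
  by apply/eqP => kE; lia.
case: eqP => [->|/eqP kd']; last first.
  rewrite mulr0 mul0r addr0 (_ : F k s t = F (L + (k - L))%N s t).
    by rewrite FLn //; lia.
  by congr F; lia.
rewrite mulr1 -(Rst s t) (_ : (d - L)%N = n.+1); last by lia.
by rewrite /P /E /z /m; ring.
Qed.

End SchmidSystem.

(** * Matrix exponentials and one-parameter subgroups acting on binary forms *)

Section MatrixExponential.
Variable R : realType.
Implicit Types (X : 'M[R]_4) (eps t : R).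

(** All generators used below square to 0, 1 or -1. The even powers of X are then scalars and the
    odd ones multiples of X, so the exponential splits into two scalar series. *)
Lemma expm_quadratic X eps t (c s : R) : X *m X = eps%:M ->
  (series (fun k => (~~ odd k)%:R * eps ^+ k./2 * t ^+ k / k`!%:R) @ \oo --> c)%classic ->
  (series (fun k => (odd k)%:R * eps ^+ k./2 * t ^+ k / k`!%:R) @ \oo --> s)%classic ->
  expm (t *: X) = c%:M + s *: X.
Proof.
move=> XX Cc Cs.
have pX k : X ^+ k = eps ^+ k./2 *: (if odd k then X else 1).
  elim: k => [|k IH]; first by rewrite /= expr0 scale1r.
  rewrite exprS IH -[k.+1./2]/(uphalf k) uphalf_half /=; case: (odd k) => /=.
    by rewrite add1n exprSr -scalerA -scalerAr -[X * X]/(X *m X) XX scalemx1.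
  by rewrite add0n -scalerAr mulr1.
rewrite /expm -scalemx1; apply: cvg_lim => //.
pose ce n := series (fun k => (~~ odd k)%:R * eps ^+ k./2 * t ^+ k / k`!%:R) n.
pose co n := series (fun k => (odd k)%:R * eps ^+ k./2 * t ^+ k / k`!%:R) n.
rewrite (_ : (fun n => _) = (fun n => ce n *: (1%:M : 'M[R]_4) + co n *: X)).
  by apply: cvgD; apply: cvgZr_tmp.
apply/funext => n; rewrite /ce /co /series /= !scaler_suml -big_split /= big_mkord.
apply: eq_bigr => k _; rewrite exprZn pX !scalerA; case: (odd k) => /=.
  by rewrite !mul0r scale0r add0r; congr (_ *: _); ring.
by rewrite !mul0r scale0r addr0; congr (_ *: _); ring.
Qed.

Lemma expm_nilpotent X t : X *m X = 0 -> expm (t *: X) = 1%:M + t *: X.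
Proof.
move=> XX; apply: (@expm_quadratic X 0); first by rewrite XX raddf0.
  apply: cvg_near_cst; exists 1%N => // n /= n0.
  rewrite /series /= big_ltn // big_nat_cond big1 ?addr0 ?expr0 ?fact0 ?divr1 ?mulr1 //.
  move=> [|[|k]] //; first by rewrite /= !mul0r.
  by rewrite /= exprS mul0r mulr0 !mul0r.
apply: cvg_near_cst; exists 2%N => // n /= n0.
rewrite /series /= big_ltn ?(ltnW n0) // big_ltn //= !mul0r add0r.
rewrite big_nat_cond big1 ?addr0 ?expr0 ?fact0 ?expr1 ?divr1 ?mul1r //.
by move=> [|[|k]] //= _; rewrite exprS mul0r mulr0 !mul0r.
Qed.

Lemma expm_rotation X t : X *m X = - 1%:M ->
  expm (t *: X) = (cos t)%:M + sin t *: X.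
Proof.
move=> XX; apply: (@expm_quadratic X (-1)); first by rewrite XX raddfN.
  rewrite cos.unlock; have := @is_cvg_series_cos_coeff _ t; exact.
rewrite sin.unlock.
rewrite (_ : (fun k => _) = sin_coeff t); first exact: is_cvg_series_sin_coeff.
apply/funext => k; rewrite /sin_coeff /=.
by case: k => [|k] /=; rewrite ?mul0r // uphalf_half; case: (odd k); rewrite ?mul0r.
Qed.

Lemma expm_involution X t : X *m X = 1%:M ->
  expm (t *: X) = ((expR t + expR (- t)) / 2)%:M + ((expR t - expR (- t)) / 2) *: X.
Proof.
move=> XX; apply: (@expm_quadratic X 1) => //.
  rewrite (_ : series _ = fun n => (series (exp_coeff t) n + series (exp_coeff (- t)) n) / 2).
    by apply: cvgM; [apply: cvgD; exact: is_cvg_series_exp_coeff | exact: cvg_cst].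
  apply/funext => n; rewrite /series /= -big_split mulr_suml; apply: eq_bigr => k _ /=.
  by rewrite /exp_coeff /= exprNn expr1n -signr_odd; case: (odd k) => /=; rewrite ?expr0 ?expr1; field.
rewrite (_ : series _ = fun n => (series (exp_coeff t) n - series (exp_coeff (- t)) n) / 2).
  by apply: cvgM; [apply: cvgB; exact: is_cvg_series_exp_coeff | exact: cvg_cst].
apply/funext => n; rewrite /series /= -sumrB mulr_suml; apply: eq_bigr => k _ /=.
by rewrite /exp_coeff /= exprNn expr1n -signr_odd; case: (odd k) => /=; rewrite ?expr0 ?expr1; field.
Qed.

End MatrixExponential.

Section ComplexDerivative.
Variable R : realType.
Local Notation C := R[i].

Lemma ReD (x y : C) : complex.Re (x + y) = complex.Re x + complex.Re y.
Proof. by case: x; case: y. Qed.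
Lemma ImD (x y : C) : complex.Im (x + y) = complex.Im x + complex.Im y.
Proof. by case: x; case: y. Qed.
Lemma ReM (x y : C) :
  complex.Re (x * y) = complex.Re x * complex.Re y - complex.Im x * complex.Im y.
Proof. by case: x; case: y. Qed.
Lemma ImM (x y : C) :
  complex.Im (x * y) = complex.Re x * complex.Im y + complex.Im x * complex.Re y.
Proof. by case: x; case: y. Qed.

Definition is_deriveC (f : R -> C) (t : R) (z : C) : Prop :=
  is_derive t 1 (fun s => complex.Re (f s)) (complex.Re z) /\
  is_derive t 1 (fun s => complex.Im (f s)) (complex.Im z).

Lemma deriveC_val f t z : is_deriveC f t z -> deriveC f t = z.
Proof.
case=> Dr Di; rewrite /deriveC !derive1E.
by rewrite (@derive_val _ _ _ _ _ _ _ Dr) (@derive_val _ _ _ _ _ _ _ Di); case: z {Dr Di}.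
Qed.

Lemma derivableC_is_deriveC f t : derivableC f t -> is_deriveC f t (deriveC f t).
Proof. by case=> /derivableP Dr /derivableP Di; split; rewrite /deriveC /= derive1E. Qed.

Lemma is_deriveC_eq f t z z' : is_deriveC f t z -> z = z' -> is_deriveC f t z'.
Proof. by move=> ? <-. Qed.

Lemma is_deriveC_ext f g t z : (forall s, f s = g s) -> is_deriveC f t z ->
  is_deriveC g t z.
Proof. by move=> /funext ->. Qed.

Lemma is_deriveC_cst c t : is_deriveC (fun=> c) t 0.
Proof. by split; exact: dcst. Qed.

Lemma is_deriveCD f g t x y : is_deriveC f t x -> is_deriveC g t y ->
  is_deriveC (fun s => f s + g s) t (x + y).
Proof.
move=> [fr fi] [gr gi]; split.
  by rewrite ReD; under eq_fun do rewrite ReD; exact: dD.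
by rewrite ImD; under eq_fun do rewrite ImD; exact: dD.
Qed.

Lemma is_deriveC_realM (r : R -> R) (r' t : R) (z : C) : is_derive t 1 r r' ->
  is_deriveC (fun s => (r s)%:C * z) t (r'%:C * z).
Proof.
move=> Dr; split.
  have -> : (fun s => complex.Re ((r s)%:C * z)) = (fun s => r s * complex.Re z).
    by apply/funext => s; rewrite ReM /= mul0r subr0.
  apply: is_derive_eq (dM Dr (dcst _ t)) _.
  by rewrite ReM /= mul0r subr0 mulr0 addr0.
have -> : (fun s => complex.Im ((r s)%:C * z)) = (fun s => r s * complex.Im z).
  by apply/funext => s; rewrite ImM /= mul0r addr0.
apply: is_derive_eq (dM Dr (dcst _ t)) _.
by rewrite ImM /= mul0r addr0 mulr0 addr0.
Qed.

Lemma is_deriveC_sum n (f : 'I_n -> R -> C) t (z : 'I_n -> C) :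
  (forall i, is_deriveC (f i) t (z i)) ->
  is_deriveC (fun s => \sum_i f i s) t (\sum_i z i).
Proof.
elim: n f z => [|n IH] f z H.
  by rewrite big_ord0; apply: is_deriveC_ext (is_deriveC_cst 0 t) => s; rewrite big_ord0.
rewrite big_ord_recl; apply: is_deriveC_ext (is_deriveCD (H ord0) (IH _ _ (fun i => H (lift ord0 i)))) => s.
by rewrite big_ord_recl.
Qed.

End ComplexDerivative.

(** * Curves of binary forms and their derivatives at the identity *)

Section BinaryForms.
Variable R : realType.
Local Notation C := R[i].
Local Notation poly2 := (mpoly.mpoly 2 C).

(* f c s is homogeneous of degree m in (c, s), with P0 c^m + P1 c^(m-1) s as
   its first two terms *)
Definition hom_curve (m : nat) (f : C -> C -> poly2) (P0 P1 : poly2) : Prop :=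
  exists G : nat -> poly2, [/\ forall c s, f c s =
     \sum_(n < m.+1) (c ^+ (m - n) * s ^+ n) *: G n,
     forall n, (m < n)%N -> G n = 0, G 0%N = P0 & G 1%N = P1].

Lemma hom_curve1 : hom_curve 0 (fun _ _ => 1) 1 0.
Proof.
exists (fun n => if n is 0%N then 1 else 0); split=> //; last by case.
by move=> c s; rewrite big_ord1 subnn !expr0 mulr1 scale1r.
Qed.

Lemma hom_curveM m f P0 P1 p a : hom_curve m f P0 P1 ->
  hom_curve m.+1 (fun c s => (c *: p + s *: a) * f c s) (p * P0) (p * P1 + a * P0).
Proof.
move=> [G [fE Gz G0 G1]].
exists (fun n => p * G n + (if n is k.+1 then a * G k else 0)); split.
- move=> c s; rewrite fE mulrDl !mulr_sumr.
  under [RHS]eq_bigr do rewrite scalerDr.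
  rewrite big_split /=; congr (_ + _).
    rewrite [RHS]big_ord_recr /= (Gz m.+1) // mulr0 scaler0 addr0.
    apply: eq_bigr => i _; rewrite -scalerAl -scalerAr scalerA subSn; last exact: leq_ord.
    by rewrite exprS mulrA.
  rewrite [RHS]big_ord_recl /= scaler0 add0r; apply: eq_bigr => i _ /=.
  rewrite -scalerAl -scalerAr scalerA /bump /= add1n subSS exprS.
  by congr (_ *: _); ring.
- by case=> // n nm; rewrite !Gz ?mulr0 ?addr0 // ltnW.
- by rewrite addr0 G0.
- by rewrite G0 G1.
Qed.

Lemma derivationX_mul (A : comPzRingType) (p a P0 P1 : A) k :
  p * (p ^+ k * P1 + k%:R * p ^+ k.-1 * a * P0) + a * (p ^+ k * P0) =
  p ^+ k.+1 * P1 + k.+1%:R * p ^+ k * a * P0.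
Proof. by case: k => [|k] /=; rewrite ?exprS -?natr1; ring. Qed.

Lemma hom_curveX_mul p a k m f P0 P1 : hom_curve m f P0 P1 ->
  hom_curve (k + m) (fun c s => (c *: p + s *: a) ^+ k * f c s)
    (p ^+ k * P0) (p ^+ k * P1 + k%:R * p ^+ k.-1 * a * P0).
Proof.
move=> H; elim: k => [|k IH].
  case: H => G [fE Gz G0 G1]; exists G; split=> // [c s||].
  - by rewrite expr0 mul1r fE add0n.
  - by rewrite expr0 mul1r.
  - by rewrite expr0 mul1r !mul0r addr0.
have {IH} := hom_curveM p a IH.
rewrite derivationX_mul mulrA -exprS.
move=> [G [fE Gz G0 G1]]; exists G; split=> // c s.
by rewrite exprS -mulrA fE.
Qed.

Lemma hom_curve_forms p a q b k l :
  hom_curve (k + l) (fun c s => (c *: p + s *: a) ^+ k * (c *: q + s *: b) ^+ l)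
    (p ^+ k * q ^+ l)
    (p ^+ k * (l%:R * q ^+ l.-1 * b) + k%:R * p ^+ k.-1 * a * q ^+ l).
Proof.
have := hom_curveX_mul p a k (hom_curveX_mul q b l hom_curve1).
rewrite addn0 mulr0 !mulr1 add0r.
move=> [G [fE Gz G0 G1]]; exists G; split.
- by move=> c s; have := fE c s; rewrite mulr1.
- exact: Gz.
- exact: G0.
- exact: G1.

Qed.

Lemma is_derive_cos_sin_monomial (i j : nat) :
  is_derive (0 : R) 1 (fun t : R => cos t ^+ i * sin t ^+ j) (j == 1%N)%:R.
Proof.
have Dc : is_derive (0 : R) 1 (fun t : R => cos t ^+ i) 0.
  apply: is_derive_eq (dX i (is_derive_cos 0)) _.
  by rewrite sin0 oppr0 mulr0.
have Ds : is_derive (0 : R) 1 (fun t : R => sin t ^+ j) (j == 1%N)%:R.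
  apply: is_derive_eq (dX j (is_derive_sin 0)) _.
  by rewrite sin0 cos0 mulr1; case: j => [|[|j]] /=; rewrite ?mul0r ?expr0 ?mulr1 ?expr0n ?mulr0.
apply: is_derive_eq (dM Dc Ds) _.
by rewrite cos0 expr1n mul1r mul0r add0r.
Qed.

(** Along (cos t, sin t) the monomial c^i s^j has derivative 0 at t = 0 unless j = 1, so only the
    second coefficient of the curve survives. *)
Lemma hom_curve_derive m f P0 P1 (ell : poly2 -> C) : scalar ell ->
  hom_curve m f P0 P1 ->
  is_deriveC (fun t : R => ell (f (cos t)%:C (sin t)%:C)) 0 (ell P1).
Proof.
move=> lin [G [fE Gz _ <-]].
have ell0 : ell 0 = 0 by have := lin (-1) 0 0; rewrite scaler0 addr0 mulN1r addNr.
have ell_sum n (a : 'I_n -> C) (g : 'I_n -> poly2) :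
    ell (\sum_i a i *: g i) = \sum_i a i * ell (g i).
  elim: n a g => [|n IH] a g; first by rewrite !big_ord0.
  by rewrite !big_ord_recl lin IH.
apply: (@is_deriveC_ext _ (fun t => \sum_(n < m.+1)
    (cos t ^+ (m - n) * sin t ^+ n)%:C * ell (G n))).
  move=> t; rewrite fE ell_sum; apply: eq_bigr => n _.
  by rewrite rmorphM !rmorphXn.
apply: (is_deriveC_eq (is_deriveC_sum (fun n : 'I_m.+1 =>
  is_deriveC_realM (ell (G n)) (is_derive_cos_sin_monomial (m - n) n)))).
(* In degree 0 the sum has no term of index 1; there the clause G n = 0 for n > m supplies G 1 =
   0. *)
case: m {fE} Gz => [|m] Gz; first by rewrite big_ord1 mul0r Gz.
rewrite !big_ord_recl /= mul0r add0r mul1r big1 ?addr0 // => i _.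
by rewrite /bump /= mul0r.
Qed.

End BinaryForms.

Section Blocks.
Variable S : comNzRingType.
Implicit Types (A B C D : 'M[S]_2) (a b c d : S).

(** The identification of 4 with 2 + 2 is fixed here once, so that the block identities below
    rewrite at type 'M_4. *)
Definition b4 A B C D : 'M[S]_4 := block_mx A B C D : 'M[S]_(2 + 2).

Lemma b4M A B C D A' B' C' D' : b4 A B C D *m b4 A' B' C' D' =
  b4 (A *m A' + B *m C') (A *m B' + B *m D') (C *m A' + D *m C') (C *m B' + D *m D').
Proof. exact: (mulmx_block A B C D A' B' C' D'). Qed.

Lemma b4D A B C D A' B' C' D' : b4 A B C D + b4 A' B' C' D' =
  b4 (A + A') (B + B') (C + C') (D + D').
Proof. exact: (add_block_mx A B C D A' B' C' D'). Qed.

Lemma b4N A B C D : - b4 A B C D = b4 (- A) (- B) (- C) (- D).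
Proof. exact: (opp_block_mx A B C D). Qed.

Lemma b4Z a A B C D : a *: b4 A B C D = b4 (a *: A) (a *: B) (a *: C) (a *: D).
Proof. exact: (scale_block_mx a A B C D). Qed.

Lemma b4T A B C D : (b4 A B C D)^T = b4 A^T C^T B^T D^T.
Proof. exact: (tr_block_mx A B C D). Qed.

Lemma b4_scalar a : a%:M = b4 a%:M 0 0 a%:M.
Proof. exact: (scalar_mx_block 2 2 a). Qed.

Lemma b4_0 : 0 = b4 0 0 0 0.
Proof. exact: (esym (block_mx0 S 2 2 2 2)). Qed.

Lemma b4P (M : 'M[S]_4) : exists A B C D, M = b4 A B C D.
Proof.
exists (ulsubmx (M : 'M[S]_(2 + 2))), (ursubmx (M : 'M[S]_(2 + 2))),
  (dlsubmx (M : 'M[S]_(2 + 2))), (drsubmx (M : 'M[S]_(2 + 2))).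
exact: (esym (@submxK S 2 2 2 2 M)).
Qed.

Lemma mx2P A : exists a b c d, A = mx2 a b c d.
Proof.
exists (A 0 0), (A 0 1), (A 1 0), (A 1 1).
apply/matrixP => i j; rewrite !mxE.
by case: i => -[|[|//]] hi; case: j => -[|[|//]] hj /=; congr (A _ _); exact: val_inj.
Qed.

Lemma mx2D a b c d a' b' c' d' :
  mx2 a b c d + mx2 a' b' c' d' = mx2 (a + a') (b + b') (c + c') (d + d').
Proof. by apply/matrixP => i j; rewrite !mxE; do 2 case: eqP. Qed.

Lemma mx2N a b c d : - mx2 a b c d = mx2 (- a) (- b) (- c) (- d).
Proof. by apply/matrixP => i j; rewrite !mxE; do 2 case: eqP. Qed.

Lemma mx2Z e a b c d : e *: mx2 a b c d = mx2 (e * a) (e * b) (e * c) (e * d).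
Proof. by apply/matrixP => i j; rewrite !mxE; do 2 case: eqP. Qed.

Lemma mx2T a b c d : (mx2 a b c d)^T = mx2 a c b d.
Proof. by apply/matrixP => i j; rewrite !mxE; do 2 case: eqP. Qed.

Lemma mx2M a b c d a' b' c' d' : mx2 a b c d *m mx2 a' b' c' d' =
  mx2 (a * a' + b * c') (a * b' + b * d') (c * a' + d * c') (c * b' + d * d').
Proof.
apply/matrixP => i j; rewrite !mxE !big_ord_recl big_ord0 !mxE /= addr0.
by do 2 case: eqP.
Qed.

Lemma mx2_scalar a : a%:M = mx2 a 0 0 a.
Proof.
apply/matrixP => i j; rewrite !mxE.
by case: i => -[|[|//]] hi; case: j => -[|[|//]] hj.
Qed.

Lemma mx2_0 : 0 = mx2 0 0 0 (0 : S).
Proof. by apply/matrixP => i j; rewrite !mxE; do 2 case: eqP. Qed.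

Lemma mx2_det a b c d : \det (mx2 a b c d) = a * d - b * c.
Proof.
rewrite (expand_det_row _ 0) !big_ord_recl big_ord0 /cofactor !det_mx11 !mxE /=.
by rewrite /bump /= expr0 expr1 mul1r mulN1r mulrN addr0.
Qed.

Definition mx2E := (mx2_scalar, mx2_0, mx2M, mx2D, mx2N, mx2Z, mx2T).

End Blocks.

Section RealMatrices.
Variable R : realType.
Local Notation C := R[i].

Lemma J4E : J4 R = b4 0 1%:M (- 1%:M) 0.
Proof. by []. Qed.

Lemma a0E (a1 a2 : R) : a0 a1 a2 = b4 (mx2 a1 0 0 a2) 0 0 (mx2 a1^-1 0 0 a2^-1).
Proof. by []. Qed.

Lemma n0E (u0 u1 u2 u3 : R) : n0 u0 u1 u2 u3 =
  b4 1%:M (mx2 u1 u2 u2 u3) 0 1%:M *m b4 (mx2 1 u0 0 1) 0 0 (mx2 1 0 (- u0) 1).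
Proof. by []. Qed.

Lemma K_to_U2_b4 (A B D E : 'M[R]_2) :
  K_to_U2 (b4 A B D E) = \matrix_(i, j) (A i j +i* B i j).
Proof.
by rewrite /K_to_U2 /b4 block_mxKul block_mxKur.
Qed.

Lemma K_to_U2_mx2 (a b c d a' b' c' d' : R) A B :
  K_to_U2 (b4 (mx2 a b c d) (mx2 a' b' c' d') A B) =
  mx2 (a +i* a') (b +i* b') (c +i* c') (d +i* d').
Proof. by rewrite K_to_U2_b4; apply/matrixP => i j; rewrite !mxE; do 2 case: eqP. Qed.

(* the image of A + iB in the standard embedding of gl_2(C) in sp_4(R) *)
Definition kmx (A B : 'M[R]_2) : 'M[R]_4 := b4 A B (- B) A.

(** As X is skew with square -1, the transpose of cos t + sin t X is its inverse; as X is also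
    symplectic, it commutes with [J4]. *)
Lemma maxK_rotation (X : 'M[R]_4) t : X *m X = - 1%:M -> lieK X ->
  maxK (expm (t *: X)).
Proof.
move=> XX; rewrite /lieK /sp4 => /andP[/eqP X1]; rewrite addr_eq0 => /eqP X2.
rewrite expm_rotation //.
set k := _ + _; have kT : k^T = (cos t)%:M - sin t *: X.
  by rewrite /k linearD linearZ /= tr_scalar_mx X2 scalerN.
have kk : k^T *m k = 1%:M.
  have XX' : (sin t *: X) *m (sin t *: X) = - (sin t ^+ 2)%:M.
    by rewrite -scalemxAl -scalemxAr XX scalerA scalerN scalemx1 -expr2.
  rewrite kT /k mulmxDr !mulmxBl XX' (scalar_mxC (cos t) (sin t *: X)) opprK.
  by rewrite addrA subrK -scalar_mxM -raddfD -expr2 cos2Dsin2.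
have kJ : J4 R *m k = k *m J4 R.
  rewrite /k mulmxDr mulmxDl scalar_mxC -scalemxAr -scalemxAl; congr (_ + _ *: _).
  by move: X1; rewrite X2 mulNmx addrC => /eqP; rewrite subr_eq0 => /eqP.
by rewrite /maxK /Sp4 -mulmxA kJ mulmxA kk mul1mx !eqxx.
Qed.

End RealMatrices.

Section Forms.
Variable R : realType.
Local Notation C := R[i].
Local Notation poly2 := (mpoly.mpoly 2 C).

Definition pvar : poly2 := xvar R 0 + 'i *: xvar R 1.
Definition qvar : poly2 := xvar R 0 - 'i *: xvar R 1.

(** Indexing by nat allows neighbours k.-1 and k.+1 at the ends. An index out of range is harmless:
    these neighbours occur with the factors k and d - k. *)
Definition ub (d k : nat) : binform R d := uvec R (inord k : 'I_d.+1).

Lemma val_ub d k : (k <= d)%N -> val (ub d k) = pvar ^+ k * qvar ^+ (d - k).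
Proof. by move=> kd; rewrite /ub /uvec /= /uform inordK. Qed.

Lemma uvec_ub d (k : 'I_d.+1) : uvec R k = ub d k.
Proof. by rewrite /ub inord_val. Qed.

Lemma subst_formD h (p q : poly2) : subst_form h (p + q) = subst_form h p + subst_form h q.
Proof. exact: rmorphD. Qed.
Lemma subst_formM h (p q : poly2) : subst_form h (p * q) = subst_form h p * subst_form h q.
Proof. exact: rmorphM. Qed.
Lemma subst_formX h (p : poly2) n : subst_form h (p ^+ n) = subst_form h p ^+ n.
Proof. exact: rmorphXn. Qed.
Lemma subst_formZ h c (p : poly2) : subst_form h (c *: p) = c *: subst_form h p.
Proof. exact: mpoly.comp_mpolyZ. Qed.
Lemma subst_form_xvar h j : subst_form h (xvar R j) = h 0 j *: xvar R 0 + h 1 j *: xvar R 1.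
Proof.
rewrite /subst_form /xvar mpoly.comp_mpolyXU -tnth_nth tnth_mktuple.
by rewrite !big_ord_recl big_ord0 addr0; congr (_ + _ *: _); congr (h _ _); exact: val_inj.
Qed.

Lemma subst_form_uform h d k : (k <= d)%N ->
  subst_form h (val (ub d k)) = subst_form h pvar ^+ k * subst_form h qvar ^+ (d - k).
Proof. by move=> kd; rewrite val_ub // subst_formM !subst_formX. Qed.

Lemma val_tau b d h (p : binform R d) :
  val (tau b h p) = \det h ^ b *: subst_form h (val p).
Proof. by []. Qed.

(** A functional on forms of degree d is extended to all polynomials through the projection onto the
    degree d part, because curves of forms are handled in the polynomial ring. *)
Definition extend_form d (l : {scalar binform R d}) (p : poly2) : C :=
  l (mpoly.DHomog (mpoly.pihomogP (@mpoly.mdeg 2) d p)).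

Lemma extend_form_scalar d (l : {scalar binform R d}) : scalar (extend_form l).
Proof.
move=> a p q; rewrite /extend_form -linearP; congr (l _).
by apply: val_inj; rewrite /= linearP.
Qed.

Lemma extend_form_val d (l : {scalar binform R d}) (p : binform R d) :
  extend_form l (val p) = l p.
Proof.
congr (l _); apply: val_inj => /=; apply: mpoly.pihomog_dE.
exact: mpoly.dhomog_is_dhomog.
Qed.

(** The generator sends p to al p + be q and q to ga p + de q, and acts on p^k q^(d-k) as a
    derivation; this is the second coefficient given by [hom_curve_forms]. With determinant 1 the
    exponent b has no effect. *)
Lemma tau_rotation_derive d b k (l : {scalar binform R d}) (h : R -> 'M[C]_2)
    (al be ga de : C) : (k <= d)%N ->
  (forall t, \det (h t) = 1) ->
  (forall t, subst_form (h t) pvar =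
     (cos t)%:C *: pvar + (sin t)%:C *: (al *: pvar + be *: qvar)) ->
  (forall t, subst_form (h t) qvar =
     (cos t)%:C *: qvar + (sin t)%:C *: (ga *: pvar + de *: qvar)) ->
  is_deriveC (fun t => l (tau b (h t) (ub d k))) 0
    ((k%:R * al + (d - k)%:R * de) * l (ub d k) + k%:R * be * l (ub d k.-1)
     + (d - k)%:R * ga * l (ub d k.+1)).
Proof.
move=> kd hdet hp hq.
have := hom_curve_derive (extend_form_scalar l)
  (hom_curve_forms pvar (al *: pvar + be *: qvar) qvar (ga *: pvar + de *: qvar) k (d - k)).
set z := extend_form l _ => H.
have -> : (k%:R * al + (d - k)%:R * de) * l (ub d k) + k%:R * be * l (ub d k.-1)
     + (d - k)%:R * ga * l (ub d k.+1) = z.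
  pose L := extend_form l; have linL := extend_form_scalar l; rewrite -/L in linL.
  have L0 : L 0 = 0 by have := linL (-1) 0 0; rewrite scaler0 addr0 mulN1r addNr.
  have LD p q : L (p + q) = L p + L q by have := linL 1 p q; rewrite scale1r mul1r.
  have LZ c p : L (c *: p) = c * L p by have := linL c p 0; rewrite !addr0 L0 addr0.
  have natZ (n : nat) (p : poly2) : n%:R * p = (n%:R : C) *: p.
    by rewrite mulr_natl scaler_nat.
  rewrite /z -/L LD.
  have -> : L (pvar ^+ k * ((d - k)%:R * qvar ^+ (d - k).-1 * (ga *: pvar + de *: qvar))) =
     (d - k)%:R * ga * l (ub d k.+1) + (d - k)%:R * de * l (ub d k).
    rewrite -[_ * _ * (_ + _)]mulrA natZ -scalerAr LZ -!extend_form_val -/L.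
    case: (ltnP k d) => kd'; last first.
      by rewrite (_ : d - k = 0)%N ?mul0r ?addr0 //; lia.
    rewrite !val_ub // (_ : d - k = (d - k.+1).+1)%N /=; last by lia.
    rewrite -(mulrA _ ga) -(mulrA _ de) -mulrDr -(LZ ga) -(LZ de) -LD; congr (_ * L _).
    rewrite !mulrDr -!scalerAr; congr (_ *: _ + _ *: _).
      by rewrite mulrCA -exprSr mulrC.
    by rewrite -exprSr.
  have -> : L (k%:R * pvar ^+ k.-1 * (al *: pvar + be *: qvar) * qvar ^+ (d - k)) =
     k%:R * al * l (ub d k) + k%:R * be * l (ub d k.-1).
    rewrite -!mulrA natZ LZ -!extend_form_val -/L.
    case: k kd {H z hp hq} => [|k] kd; first by rewrite !mul0r addr0.
    rewrite !val_ub ?(ltnW kd) //= -mulrDr.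
    rewrite -(LZ al) -(LZ be) -LD; congr (_ * L _).
    rewrite mulrDl mulrDr -!scalerAl -!scalerAr; congr (_ *: _ + _ *: _).
      by rewrite mulrA -exprSr.
    by rewrite -exprS (_ : (d - k.+1).+1 = d - k)%N //; lia.
  ring.
apply: is_deriveC_ext H => t.
rewrite -hp -hq -(subst_form_uform _ kd) -(extend_form_val l (tau _ _ _)) val_tau.
by rewrite hdet exp1rz scale1r.
Qed.

Lemma cexpiD (s t : R) : cexpi (s + t) = cexpi s * cexpi t.
Proof. by rewrite /cexpi cosD sinD; apply/eqP; rewrite eq_complex /= [cos s * sin t + _]addrC !eqxx. Qed.

Lemma cexpi0 : cexpi (0 : R) = 1.
Proof. by rewrite /cexpi cos0 sin0. Qed.

Lemma cexpi_natM n (t : R) : cexpi t ^+ n = cexpi (n%:R * t).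
Proof.
elim: n => [|n IH]; first by rewrite expr0 mul0r cexpi0.
by rewrite exprS IH -cexpiD -natr1; congr cexpi; ring.
Qed.

Lemma cexpi_neq0 (t : R) : cexpi t != 0.
Proof.
apply/eqP => H; have := cexpiD t (- t).
by rewrite subrr cexpi0 H mul0r => /eqP; rewrite oner_eq0.
Qed.

Lemma cexpi_intM (n : int) (t : R) : cexpi t ^ n = cexpi (n%:~R * t).
Proof.
case: n => n; first by rewrite -cexpi_natM.
rewrite NegzE -exprnN cexpi_natM; apply: (mulfI (cexpi_neq0 (n.+1%:R * t))).
by rewrite divff ?cexpi_neq0 // -cexpiD -cexpi0; congr cexpi; rewrite mulrNz; ring.
Qed.

Lemma is_deriveC_cexpi (a : R) (z : C) :
  is_deriveC (fun t => cexpi (a * t) * z) 0 ('i%C * a%:C * z).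
Proof.
pose w := 'i * z.
apply: (@is_deriveC_ext _ (fun t => (cos (a * t))%:C * z + (sin (a * t))%:C * w)).
  by move=> t; rewrite /w mulrA -mulrDl; congr (_ * _); apply/eqP;
    rewrite eq_complex /=; apply/andP; split; apply/eqP; ring.
have Da : is_derive (0 : R) 1 (fun t => a * t) (a * 1) by exact: dZ (did _).
have Dc := dcomp (g := fun t => a * t) (is_derive_cos (a * 0)) Da.
have Ds := dcomp (g := fun t => a * t) (is_derive_sin (a * 0)) Da.
apply: is_deriveC_eq (is_deriveCD (is_deriveC_realM z Dc) (is_deriveC_realM w Ds)) _.
rewrite mulr0 sin0 cos0 oppr0 mul0r mul1r mulr1 /w mul0r add0r mulrA.
by congr (_ * _); rewrite mulrC.
Qed.

(** The centre of U(2) has nontrivial determinant and is not covered by [tau_rotation_derive]. A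
    scalar c acts by c^(2b) from the determinant times c^d from the form. *)
Lemma tau_scalar b d k (t : R) : (k <= d)%N ->
  tau b (cexpi t)%:M (ub d k) = cexpi ((2 * b%:~R + d%:R) * t) *: ub d k.
Proof.
move=> kd; apply: val_inj.
have hp (c : C) : subst_form c%:M pvar = c *: pvar.
  rewrite /pvar subst_formD subst_formZ !subst_form_xvar !mxE /= mulr1n mulr0n.
  by rewrite !scale0r addr0 add0r scalerDr !scalerA mulrC.
have hq (c : C) : subst_form c%:M qvar = c *: qvar.
  rewrite /qvar -scaleNr subst_formD subst_formZ !subst_form_xvar !mxE /= mulr1n mulr0n.
  by rewrite !scale0r addr0 add0r scalerDr !scalerA mulrC.
have -> : val (cexpi ((2 * b%:~R + d%:R) * t) *: ub d k) =
    cexpi ((2 * b%:~R + d%:R) * t) *: val (ub d k) by [].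
rewrite (val_tau b _ (ub d k)) (subst_form_uform _ kd) (val_ub kd) det_scalar hp hq.
rewrite !exprZn -scalerAl -scalerAr !scalerA (exprz_exp (cexpi t) 2 b : (cexpi t ^+ 2) ^ b = _).
rewrite cexpi_intM -mulrA -exprD subnKC // cexpi_natM -cexpiD.
by congr (cexpi _ *: _); rewrite intrM; ring.
Qed.

End Forms.

(** * The Lie algebra sp_4(C) as a K-module *)

Section ComplexSymplectic.
Variable R : realType.
Local Notation C := R[i].

Definition cmx m n (M : 'M[R]_(m, n)) : 'M[C]_(m, n) := map_mx (real_complex R) M.

Definition sp4C (Z : 'M[C]_4) : Prop :=
  sp4 (map_mx (@complex.Re R) Z) /\ sp4 (map_mx (@complex.Im R) Z).

Lemma sp4_comb (a : R) X Y : sp4 X -> sp4 Y -> sp4 (a *: X + Y).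
Proof.
rewrite /sp4 => /eqP hX /eqP hY; rewrite linearD linearZ /= mulmxDl mulmxDr.
rewrite -scalemxAl -scalemxAr addrACA -scalerDr hX hY scaler0 addr0.
exact: eqxx.
Qed.

Lemma sp4_0 : sp4 (0 : 'M[R]_4).
Proof. by rewrite /sp4 trmx0 mul0mx mulmx0 addr0. Qed.

Lemma sp4Z (a : R) (X : 'M[R]_4) : sp4 X -> sp4 (a *: X).
Proof. by move=> hX; have := sp4_comb a hX sp4_0; rewrite addr0. Qed.

Lemma sp4_b4 (A B D E : 'M[R]_2) :
  B^T = B -> D^T = D -> E = - A^T -> sp4 (b4 A B D E).
Proof.
move=> hB hD ->; have hE : (- A^T)^T = - A by rewrite linearN /= trmxK.
rewrite /sp4 J4E b4T !b4M b4D hB hD hE.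
rewrite !(mulmx0, mul0mx, mulmxN, mulNmx, mulmx1, mul1mx, add0r, addr0, opprK).
by rewrite !(addrN, addNr) -b4_0.
Qed.

Lemma Re_comb (c : C) m n (Z W : 'M[C]_(m, n)) :
  map_mx (@complex.Re R) (c *: Z + W) = complex.Re c *: map_mx (@complex.Re R) Z
   + ((- complex.Im c) *: map_mx (@complex.Im R) Z + map_mx (@complex.Re R) W).
Proof. by apply/matrixP => i j; rewrite !mxE ReD ReM; ring. Qed.

Lemma Im_comb (c : C) m n (Z W : 'M[C]_(m, n)) :
  map_mx (@complex.Im R) (c *: Z + W) = complex.Re c *: map_mx (@complex.Im R) Z
   + (complex.Im c *: map_mx (@complex.Re R) Z + map_mx (@complex.Im R) W).
Proof. by apply/matrixP => i j; rewrite !mxE ImD ImM; ring. Qed.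

Lemma Re_cmx m n (M : 'M[R]_(m, n)) : map_mx (@complex.Re R) (cmx M) = M.
Proof. by apply/matrixP => i j; rewrite !mxE. Qed.
Lemma Im_cmx m n (M : 'M[R]_(m, n)) : map_mx (@complex.Im R) (cmx M) = 0.
Proof. by apply/matrixP => i j; rewrite !mxE. Qed.

Lemma sp4C_comb (c : C) Z W : sp4C Z -> sp4C W -> sp4C (c *: Z + W).
Proof.
move=> [zr zi] [wr wi]; split; rewrite ?Re_comb ?Im_comb; apply: sp4_comb => //;
  exact: sp4_comb.
Qed.

Lemma sp4C_cmx X : sp4 X -> sp4C (cmx X).
Proof. by move=> hX; split; rewrite ?Re_cmx ?Im_cmx //; exact: sp4_0. Qed.

Lemma Re_cmx_mul (k l : 'M[R]_4) (Z : 'M[C]_4) :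
  map_mx (@complex.Re R) (cmx k *m Z *m cmx l) = k *m map_mx (@complex.Re R) Z *m l.
Proof.
have sumRe n (F : 'I_n -> C) : complex.Re (\sum_i F i) = \sum_i complex.Re (F i).
  by elim: n F => [|n IH] F; rewrite ?big_ord0 // !big_ord_recl ReD IH.
apply/matrixP => i j; rewrite !mxE sumRe; apply: eq_bigr => p _.
rewrite !mxE ReM /= mulr0 subr0 sumRe; congr (_ * _).
by apply: eq_bigr => q _; rewrite !mxE ReM /= mul0r subr0.
Qed.

Lemma Im_cmx_mul (k l : 'M[R]_4) (Z : 'M[C]_4) :
  map_mx (@complex.Im R) (cmx k *m Z *m cmx l) = k *m map_mx (@complex.Im R) Z *m l.
Proof.
have sumIm n (F : 'I_n -> C) : complex.Im (\sum_i F i) = \sum_i complex.Im (F i).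
  by elim: n F => [|n IH] F; rewrite ?big_ord0 // !big_ord_recl ImD IH.
apply/matrixP => i j; rewrite !mxE sumIm; apply: eq_bigr => p _.
rewrite !mxE ImM /= mulr0 add0r sumIm; congr (_ * _).
by apply: eq_bigr => q _; rewrite !mxE ImM /= mul0r addr0.
Qed.

Lemma iE : ('i : C) * 'i = -1.
Proof. by rewrite -expr2 sqr_i. Qed.

(* the elements of p_+ and p_- attached to a symmetric matrix S, on which
   k acts by S |-> h S h^T and its conjugate, h the image of k in U(2) *)
Definition PP (S : 'M[C]_2) : 'M[C]_4 := b4 S ('i *: S) ('i *: S) (- S).
Definition PM (S : 'M[C]_2) : 'M[C]_4 := b4 S (- 'i *: S) (- 'i *: S) (- S).
(* the complexification gl_2(C) -> k_C of the identification u(2) = k *)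
Definition KC (X : 'M[C]_2) : 'M[C]_4 :=
  b4 (2^-1 *: (X - X^T)) (2^-1 *: (- 'i *: (X + X^T)))
     (2^-1 *: ('i *: (X + X^T))) (2^-1 *: (X - X^T)).

Section Conjugation.
Variables (A B S : 'M[C]_2).
Let k := b4 A B (- B) A.

(** The block matrix is the column (1, v) times S times the row (1, u). For v^2 = -1 the column (1,
    v) is an eigenvector of the complex structure, and left multiplication by k becomes
    multiplication of S by A + vB; the row behaves likewise. Equal u and v give p_+ and p_-,
    opposite ones k_C. *)
Lemma conj_b4_scaled (u v : C) : u * u = -1 -> v * v = -1 ->
  k *m b4 S (u *: S) (v *: S) ((u * v) *: S) *m k^T =
  let T := (A + v *: B) *m S *m (A + u *: B)^T in b4 T (u *: T) (v *: T) ((u * v) *: T).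
Proof.
move=> uu vv /=; set T' := (A + v *: B) *m S.
have -> : k *m b4 S (u *: S) (v *: S) ((u * v) *: S) = b4 T' (u *: T') (v *: T') ((u * v) *: T').
  rewrite /k b4M /T' (mulmxDl A (v *: B) S) -(scalemxAl v B S).
  rewrite !(mulNmx B) -!(scalemxAr _ A S) -!(scalemxAr _ B S).
  move: (A *m S) (B *m S) => X Y; congr b4.
  - by rewrite scalerDr scalerA.
  - by rewrite scalerDr scalerA vv scaleN1r addrC.
  - by rewrite scalerDr scalerA -mulrA vv mulrN1 scaleNr addrC.
have trN (M : 'M[C]_2) : (- M)^T = - M^T by exact: linearN.
have -> : (A + u *: B)^T = A^T + u *: B^T by rewrite linearD linearZ.
rewrite /k b4T b4M trN.
rewrite (mulmxDr T' A^T) !(mulmxN _ B^T) -(scalemxAr u T' B^T) -!(scalemxAl _ T' A^T) -!(scalemxAl _ T' B^T).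
move: (T' *m A^T) (T' *m B^T) => X Y; congr b4.
- by rewrite scalerDr scalerA uu scaleN1r addrC.
- by rewrite scalerDr scalerA (mulrC v).
- by rewrite scalerDr scalerA mulrAC uu mulN1r scaleNr addrC.
Qed.

Lemma conj_PP : k *m PP S *m k^T = PP ((A + 'i *: B) *m S *m (A + 'i *: B)^T).
Proof.
have E X : PP X = b4 X ('i *: X) ('i *: X) (('i * 'i) *: X) by rewrite iE scaleN1r.
by rewrite !E; exact: (conj_b4_scaled iE iE).
Qed.

Lemma conj_PM : k *m PM S *m k^T = PM ((A - 'i *: B) *m S *m (A - 'i *: B)^T).
Proof.
have iE' : - 'i * - 'i = -1 :> C by rewrite mulrNN iE.
have E X : PM X = b4 X (- 'i *: X) (- 'i *: X) ((- 'i * - 'i) *: X).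
  by rewrite iE' scaleN1r.
by rewrite !E -(scaleNr 'i B); exact: (conj_b4_scaled iE' iE').
Qed.

End Conjugation.

(** [KC X] is half of N X minus its transpose, with N X the case u = -i, v = i of [conj_b4_scaled];
    the map Z |-> k Z k^T commutes with transposition. *)
Lemma conj_KC (A B S : 'M[C]_2) (k := b4 A B (- B) A) :
  k *m KC S *m k^T = KC ((A + 'i *: B) *m S *m (A - 'i *: B)^T).
Proof.
pose N (X : 'M[C]_2) := b4 X (- 'i *: X) ('i *: X) X.
have KCE X : KC X = 2^-1 *: (N X - (N X)^T).
  have tZ c : (c *: X)^T = c *: X^T by exact: linearZ.
  by rewrite /KC /N b4T b4N b4D b4Z !tZ -!(scaleNr _ X^T) opprK -!scalerDr.
have iE' : - 'i * - 'i = -1 :> C by rewrite mulrNN iE.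
have NE' X : N X = b4 X (- 'i *: X) ('i *: X) ((- 'i * 'i) *: X).
  by rewrite mulNr iE opprK scale1r.
have NE X : k *m N X *m k^T = N ((A + 'i *: B) *m X *m (A - 'i *: B)^T).
  by rewrite !NE' -(scaleNr 'i B); exact: (conj_b4_scaled A B X iE' iE).
rewrite !KCE -scalemxAr -scalemxAl mulmxBr mulmxBl NE; congr (_ *: (_ - _)).
by rewrite -NE !trmx_mul trmxK mulmxA.
Qed.

Lemma maxK_tr (k : 'M[R]_4) : maxK k -> k *m k^T = 1%:M /\ invmx k = k^T.
Proof.
move=> /andP[_ /eqP kk]; have kk' := mulmx1C kk; split=> //.
have [ku _] := mulmx1_unit kk'.
by apply: (can_inj (mulKmx ku)); rewrite mulmxV // kk'.
Qed.

Lemma maxK_blocks (k : 'M[R]_4) : maxK k -> exists A B,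
  [/\ k = kmx A B, A^T *m A + B^T *m B = 1%:M & A^T *m B = B^T *m A].
Proof.
move=> hk; have [kk' _] := maxK_tr hk.
move: hk; rewrite /maxK /Sp4 => /andP[/eqP hJ /eqP kk].
have kJ : J4 R *m k = k *m J4 R.
  by rewrite -[LHS]mul1mx -kk' -mulmxA (mulmxA k^T) hJ.
have [A [B [D [E kE]]]] := b4P k.
move: kJ; rewrite kE J4E !b4M !(mul0mx, mulmx0, mul1mx, mulmx1, mulNmx, mulmxN, add0r, addr0).
move=> /(@eq_block_mx _ 2 2 2 2) [D1 E1 A1 B1].
have DE : D = - B by rewrite D1.
have BT : (- B)^T = - B^T by rewrite linearN.
exists A, B; split.
  by rewrite DE E1.
  move: kk; rewrite kE DE E1 b4T b4M b4_scalar => /(@eq_block_mx _ 2 2 2 2) [+ _ _ _].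
  by rewrite BT mulNmx mulmxN opprK.
move: kk; rewrite kE DE E1 b4T b4M b4_scalar => /(@eq_block_mx _ 2 2 2 2) [_ + _ _].
by rewrite BT mulNmx => /eqP; rewrite subr_eq0 => /eqP.
Qed.

Lemma maxK_unitary (k : 'M[R]_4) : maxK k -> exists A B : 'M[C]_2,
  [/\ cmx k = b4 A B (- B) A, cmx k^T = (b4 A B (- B) A)^T,
      K_to_U2 k = A + 'i *: B & (A - 'i *: B)^T *m (A + 'i *: B) = 1%:M].
Proof.
move=> /maxK_blocks [A [B [-> h1 h2]]].
have E : cmx (kmx A B) = b4 (cmx A) (cmx B) (- cmx B) (cmx A).
  by rewrite /cmx -map_mxN; exact: (map_block_mx (real_complex R) A B (- B) A).
exists (cmx A), (cmx B); split=> //.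
- by rewrite -E /cmx matrix.map_trmx.
- rewrite K_to_U2_b4; apply/matrixP => i j; rewrite !mxE.
  by apply/eqP; rewrite eq_complex /= !mul0r !mul1r; apply/andP; split; apply/eqP; ring.
- rewrite linearB linearZ /= mulmxDr !mulmxBl -!scalemxAl -!scalemxAr scalerA iE.
  have e1 : (cmx A)^T *m cmx A + (cmx B)^T *m cmx B = 1%:M.
    rewrite -[RHS](map_mx1 (real_complex R)) -h1 map_mxD !map_mxM.
    by rewrite /cmx !matrix.map_trmx.
  have e2 : (cmx A)^T *m cmx B = (cmx B)^T *m cmx A.
    have := congr1 (map_mx (real_complex R)) h2; rewrite !map_mxM.
    by rewrite /cmx !matrix.map_trmx.
  by rewrite e2 scaleN1r opprK addrA subrK.
Qed.

End ComplexSymplectic.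

(** * The complexified action on a (g,K)-module and K-equivariant sums *)

Section KHoms.
Variables (R : realType) (V : gkmodule R).
Local Notation C := R[i].
Local Notation poly2 := (mpoly.mpoly 2 C).

Lemma gact_comb (a : R) X Y (v : V) : sp4 X -> sp4 Y ->
  gact (a *: X + Y) v = a%:C *: gact X v + gact Y v.
Proof. by have [_ H _] := gact_rep V; exact: H. Qed.

Lemma gactP X (a : C) (u v : V) : sp4 X ->
  gact X (a *: u + v) = a *: gact X u + gact X v.
Proof. by have [H _ _] := gact_rep V; move=> hX; exact: H. Qed.

Lemma gact0 (v : V) : gact 0 v = 0.
Proof.
have := @gact_comb 1 0 0 v (sp4_0 R) (sp4_0 R).
rewrite scaler0 addr0 scale1r => /eqP; rewrite -subr_eq0 opprD addrA subrr.
by rewrite sub0r oppr_eq0 => /eqP.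
Qed.

Lemma actC_comb (c : C) Z W (v : V) : sp4C Z -> sp4C W ->
  actC (@gact _ V) (c *: Z + W) v = c *: actC (@gact _ V) Z v + actC (@gact _ V) W v.
Proof.
move=> [zr zi] [wr wi]; rewrite /actC Re_comb Im_comb !gact_comb ?sp4_comb //.
set a := gact _ v; set b := gact _ v; set x := gact _ v; set y := gact _ v.
rewrite [in RHS](complexE c) !scalerDr !scalerDl !scalerA.
rewrite (mulrC 'i (complex.Re c)%:C) mulrAC iE mulN1r rmorphN /=.
rewrite [LHS]addrACA (addrACA _ x) [LHS]addrA; congr (_ + _).
  by rewrite [RHS]addrACA [X in _ = _ + X]addrC.
Qed.

Lemma actC0 (v : V) : actC (@gact _ V) 0 v = 0.
Proof. by rewrite /actC !raddf0 !gact0 scaler0 addr0. Qed.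

Lemma actC_cmx X (v : V) : actC (@gact _ V) (cmx X) v = gact X v.
Proof. by rewrite /actC Re_cmx Im_cmx gact0 scaler0 addr0. Qed.

Lemma actCP Z (a : C) (u v : V) : sp4C Z ->
  actC (@gact _ V) Z (a *: u + v) = a *: actC (@gact _ V) Z u + actC (@gact _ V) Z v.
Proof.
move=> [zr zi]; rewrite /actC !gactP // !scalerDr !scalerA (mulrC 'i a).
by rewrite addrACA.
Qed.

Lemma actCZ Z (a : C) (u : V) : sp4C Z ->
  actC (@gact _ V) Z (a *: u) = a *: actC (@gact _ V) Z u.
Proof.
move=> hZ; have A0 : actC (@gact _ V) Z 0 = 0.
  have := actCP 1 0 0 hZ; rewrite !scale1r addr0 => /eqP.
  by rewrite -subr_eq0 opprD addrA subrr sub0r oppr_eq0 => /eqP.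
by have := actCP a u 0 hZ; rewrite A0 !addr0.
Qed.

Lemma actC_sum n (c : 'I_n -> C) (Z : 'I_n -> 'M[C]_4) (v : V) :
  (forall i, sp4C (Z i)) ->
  actC (@gact _ V) (\sum_i c i *: Z i) v = \sum_i c i *: actC (@gact _ V) (Z i) v.
Proof.
move=> hZ; suff [] : sp4C (\sum_i c i *: Z i) /\
  actC (@gact _ V) (\sum_i c i *: Z i) v = \sum_i c i *: actC (@gact _ V) (Z i) v by [].
elim: n c Z hZ => [|n IH] c Z hZ.
  rewrite !big_ord0 actC0; split=> //.
  by split; rewrite raddf0; exact: sp4_0.
have [h1 h2] := IH (fun i => c (lift ord0 i)) _ (fun i => hZ (lift ord0 i)).
rewrite !big_ord_recl; split; first exact: sp4C_comb.
by rewrite actC_comb // h2.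
Qed.

Lemma actC_sumr n (c : 'I_n -> C) Z (v : 'I_n -> V) : sp4C Z ->
  actC (@gact _ V) Z (\sum_i c i *: v i) = \sum_i c i *: actC (@gact _ V) Z (v i).
Proof.
move=> hZ; elim: n c v => [|n IH] c v.
  by rewrite !big_ord0 -(scale0r (0 : V)) actCZ // !scale0r.
by rewrite !big_ord_recl actCP // IH.
Qed.

Lemma kact_sum k n (c : 'I_n -> C) (v : 'I_n -> V) : maxK k ->
  kact k (\sum_i c i *: v i) = \sum_i c i *: kact k (v i).
Proof.
move=> hk; have lin := @kact_linear _ V k hk.
elim: n c v => [|n IH] c v.
  rewrite !big_ord0; have := lin 1 0 0.
  rewrite !scale1r addr0 => /eqP; rewrite -subr_eq0 opprD addrA subrr.
  by rewrite sub0r oppr_eq0 => /eqP.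
by rewrite !big_ord_recl lin IH.
Qed.

Lemma kact_actC k Z (v : V) : maxK k -> sp4C Z ->
  kact k (actC (@gact _ V) Z v) =
  actC (@gact _ V) (cmx k *m Z *m cmx k^T) (kact k v).
Proof.
move=> hk [zr zi]; have [_ ki] := maxK_tr hk; rewrite /actC addrC.
rewrite (kact_linear hk) !kact_Ad // ki Re_cmx_mul Im_cmx_mul.
by rewrite addrC.
Qed.

(** The Z_a transform by M and the m_a contragrediently up to [tau], so M disappears from the sum of
    the Z_a applied to m_a once the two summations are exchanged. *)
Lemma K_equivariant_sum n k b e (Z : 'I_n -> 'M[C]_4) (m : 'I_n -> binform R e -> V)
    (M : 'I_n -> 'I_n -> C) : maxK k -> (forall a, sp4C (Z a)) ->
  (forall a, cmx k *m Z a *m cmx k^T = \sum_c M c a *: Z c) ->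
  (forall c w, \sum_a M c a *: kact k (m a w) = m c (tau b (K_to_U2 k) w)) ->
  forall w, kact k (\sum_a actC (@gact _ V) (Z a) (m a w)) =
    \sum_a actC (@gact _ V) (Z a) (m a (tau b (K_to_U2 k) w)).
Proof.
move=> hk hZ hM hm w.
have := kact_sum (fun=> 1) (fun a => actC (@gact _ V) (Z a) (m a w)) hk.
under eq_bigr do rewrite scale1r; move=> ->.
under eq_bigr => a _ do rewrite scale1r kact_actC // hM actC_sum //.
rewrite exchange_big; apply: eq_bigr => c _ /=.
by rewrite -hm actC_sumr.
Qed.

(** A nonzero L would exhibit a' as a K-type of norm below the minimum. The degree e is kept apart
    from [hwdeg a'] because the type of forms depends on it; the equation between them is eliminated
    in the proof. *)
Lemma not_occurs_eq0 (a a' : int * int) e (L : binform R e -> V) :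
  is_minimal_K_type V a -> hwdeg a' = e -> a'.2 <= a'.1 ->
  vogan_norm a' < vogan_norm a -> linear L ->
  (forall k p, maxK k -> L (tau a'.2 (K_to_U2 k) p) = kact k (L p)) ->
  forall p, L p = 0.
Proof.
move=> [_ _ hmin] he dom lt_norm; case: e / he L => L linL hL p.
apply/eqP; apply: contraT => Lp; exfalso.
pose mL := GRing.isLinear.Build _ _ _ _ L linL.
pose f : {linear binform R (hwdeg a') -> V} := HB.pack L mL.
have := hmin a' dom; rewrite leNgt lt_norm => H; apply: notF; apply: H.
by exists f; split; [exact: hL | exists p].
Qed.

End KHoms.

(** * K-equivariant maps from p tensor a K-type, and their vanishing by minimality *)

Section SchmidMaps.
Variables (R : realType) (V : gkmodule R).
Local Notation C := R[i].
Local Notation poly2 := (mpoly.mpoly 2 C).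
Local Notation homog d p := (p \is mpoly.ishomog1 d (@mpoly.mdeg 2)).

Definition sym2 (a : 'I_3) : 'M[C]_2 :=
  nth 0 [:: mx2 1 0 0 0; mx2 0 1 1 0; mx2 0 0 0 1] a.

(* the matrix of S |-> h S h^T in the basis sym2, for h = mx2 a b c d *)
Definition sym2_mx (a b c d : C) (i j : 'I_3) : C :=
  nth 0 (nth [::] [:: [:: a ^+ 2; 2 * a * b; b ^+ 2];
                      [:: a * c; a * d + b * c; b * d];
                      [:: c ^+ 2; 2 * c * d; d ^+ 2]] i) j.

Lemma ord3_ind (P : 'I_3 -> Prop) :
  P 0 -> P 1 -> P 2 -> forall i, P i.
Proof.
move=> h0 h1 h2 [[|[|[|//]]] hi].
- by rewrite (_ : Ordinal hi = 0) //; exact: val_inj.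
- by rewrite (_ : Ordinal hi = 1) //; exact: val_inj.
- by rewrite (_ : Ordinal hi = 2) //; exact: val_inj.
Qed.

Lemma sum3 (A : nmodType) (F : 'I_3 -> A) : \sum_i F i = F 0 + F 1 + F 2.
Proof.
rewrite !big_ord_recl big_ord0 addr0 addrA.
by congr (F _ + F _ + F _); exact: val_inj.
Qed.

Lemma PPE_sum n (c : 'I_n -> C) (S : 'I_n -> 'M[C]_2) :
  PP (\sum_i c i *: S i) = \sum_i c i *: PP (S i).
Proof.
elim: n c S => [|n IH] c S.
  by rewrite !big_ord0 /PP scaler0 oppr0 -b4_0.
by rewrite !big_ord_recl -IH /PP b4Z b4D !scalerDr !scalerA opprD scalerN (mulrC 'i).
Qed.

Lemma PME_sum n (c : 'I_n -> C) (S : 'I_n -> 'M[C]_2) :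
  PM (\sum_i c i *: S i) = \sum_i c i *: PM (S i).
Proof.
elim: n c S => [|n IH] c S.
  by rewrite !big_ord0 /PM scaler0 oppr0 -b4_0.
by rewrite !big_ord_recl -IH /PM b4Z b4D !scalerDr !scalerA opprD scalerN (mulrC (- 'i)).
Qed.

Lemma KCE_sum n (c : 'I_n -> C) (S : 'I_n -> 'M[C]_2) :
  KC (\sum_i c i *: S i) = \sum_i c i *: KC (S i).
Proof.
elim: n c S => [|n IH] c S.
  by rewrite !big_ord0 /KC linear0 subrr addr0 !scaler0 -b4_0.
rewrite !big_ord_recl -IH; move: (c ord0) (S ord0) => x A; set B := \sum_i _.
case: (mx2P A) => a1 [a2 [a3 [a4 ->]]]; case: (mx2P B) => b1 [b2 [b3 [b' ->]]].
rewrite /KC !mx2E b4Z b4D !mx2E.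
by congr (b4 (mx2 _ _ _ _) (mx2 _ _ _ _) (mx2 _ _ _ _) (mx2 _ _ _ _)); ring.
Qed.

Lemma sym2_conj (a b c d : C) (j : 'I_3) :
  mx2 a b c d *m sym2 j *m (mx2 a b c d)^T = \sum_i sym2_mx a b c d i j *: sym2 i.
Proof.
elim/ord3_ind: j; rewrite sum3 /sym2 /sym2_mx /= !mx2E; congr mx2; ring.
Qed.

Lemma sp4C_b4 (A B D E : 'M[C]_2) :
  B^T = B -> D^T = D -> E = - A^T -> sp4C (b4 A B D E).
Proof.
move=> hB hD ->.
have mapb4 (f : C -> R) X Y Z W : map_mx f (b4 X Y Z W) =
    b4 (map_mx f X) (map_mx f Y) (map_mx f Z) (map_mx f W).
  exact: (map_block_mx f X Y Z W).
split; rewrite mapb4; apply: sp4_b4; rewrite ?matrix.map_trmx ?hB ?hD //.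
  by apply/matrixP => i j; rewrite !mxE; case: (A j i).
by apply/matrixP => i j; rewrite !mxE; case: (A j i).
Qed.

Lemma sym2T j : (sym2 j)^T = sym2 j.
Proof. by elim/ord3_ind: j; rewrite /sym2 /= mx2T. Qed.

Lemma sp4C_PP (S : 'M[C]_2) : S^T = S -> sp4C (PP S).
Proof. by move=> hS; apply: sp4C_b4; rewrite ?linearZ /= ?hS. Qed.

Lemma sp4C_PM (S : 'M[C]_2) : S^T = S -> sp4C (PM S).
Proof. by move=> hS; apply: sp4C_b4; rewrite ?linearZ /= ?hS. Qed.

Lemma sp4C_KC (X : 'M[C]_2) : sp4C (KC X).
Proof.
case: (mx2P X) => a [b [c [d ->]]].
by apply: sp4C_b4; rewrite !mx2E; congr mx2; ring.
Qed.

(* the basis of sl_2 dual to sym2 under the U(2)-invariant contraction of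
   p_+ with k_C (X0 = f, X1 = (h_2 - h_1) / 2, X2 = -e) *)
Definition sl2_mx (j : 'I_3) : 'M[C]_2 :=
  nth 0 [:: mx2 0 0 1 0; mx2 (- 2^-1) 0 0 2^-1; mx2 0 (-1) 0 0] j.

(* the matrix of X |-> h X h^-1 in the basis sl2_mx *)
Definition sl2_conj_mx (a b c d D : C) (i j : 'I_3) : C :=
  nth 0 (nth [::] [:: [:: d ^+ 2 / D; - (c * d) / D; c ^+ 2 / D];
                      [:: - 2 * b * d / D; (a * d + b * c) / D; - 2 * a * c / D];
                      [:: b ^+ 2 / D; - (a * b) / D; a ^+ 2 / D]] i) j.

Lemma sl2_conj (a b c d D : C) (j : 'I_3) :
  mx2 a b c d *m sl2_mx j *m (D^-1 *: mx2 d (- b) (- c) a) =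
  \sum_i sl2_conj_mx a b c d D i j *: sl2_mx i.
Proof.
elim/ord3_ind: j; rewrite sum3 /sl2_mx /sl2_conj_mx /= !mx2E; move: D^-1 => D';
  congr mx2; by field.
Qed.

(** p_+ is the symmetric square of the standard representation, that is, det times the dual of the
    adjoint representation on sl_2. The factor D is the determinant that moves the K-type by
    (1,1). *)
Lemma sym2_sl2_dual (a b c d : C) i j : a * d - b * c != 0 ->
  \sum_k sym2_mx a b c d i k * sl2_conj_mx a b c d (a * d - b * c) j k =
  (a * d - b * c) * (i == j)%:R.
Proof.
move=> D0; elim/ord3_ind: i; elim/ord3_ind: j;
  rewrite sum3 /sym2_mx /sl2_conj_mx /=; by field.
Qed.

(* the same for p_-, which is dual to p_+ *)
Definition sl2_mx' (j : 'I_3) : 'M[C]_2 :=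
  nth 0 [:: mx2 0 (-1) 0 0; mx2 2^-1 0 0 (- 2^-1); mx2 0 0 1 0] j.

Definition sl2_conj_mx' (a b c d D : C) (i j : 'I_3) : C :=
  nth 0 (nth [::] [:: [:: a ^+ 2 / D; a * b / D; b ^+ 2 / D];
                      [:: 2 * a * c / D; (a * d + b * c) / D; 2 * b * d / D];
                      [:: c ^+ 2 / D; c * d / D; d ^+ 2 / D]] i) j.

Lemma sl2_conj' (a b c d D : C) (j : 'I_3) :
  mx2 a b c d *m sl2_mx' j *m (D^-1 *: mx2 d (- b) (- c) a) =
  \sum_i sl2_conj_mx' a b c d D i j *: sl2_mx' i.
Proof.
elim/ord3_ind: j; rewrite sum3 /sl2_mx' /sl2_conj_mx' /= !mx2E; move: D^-1 => D';
  congr mx2; by field.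
Qed.

(** On p_- the group acts through the inverse transpose of h, whose entries appear here; hence the
    inverse determinant and a shift by (-1,-1). *)
Lemma sym2_sl2_dual' (a b c d : C) i j : a * d - b * c != 0 ->
  let D := (a * d - b * c)^-1 in
  \sum_k sym2_mx (D * d) (- (D * c)) (- (D * b)) (D * a) i k *
    sl2_conj_mx' a b c d (a * d - b * c) j k = D * (i == j)%:R.
Proof.
move=> D0 /=; elim/ord3_ind: i; elim/ord3_ind: j;
  rewrite sum3 /sym2_mx /sl2_conj_mx' /=; by field.
Qed.

End SchmidMaps.

(** * Multiplication of binary forms by equivariant quadratics *)

Section Multiplication.
Variable R : realType.
Local Notation C := R[i].
Local Notation poly2 := (mpoly.mpoly 2 C).
Local Notation homog2 p := (p \is mpoly.ishomog1 2 (@mpoly.mdeg 2)).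

(** The quadratics contragredient to [sym2] up to det^2: paired with p_+ they lower the degree by 2
    and raise the determinant exponent by 2, that is, they lead to Lambda + (0,2). *)
Definition quad_dual (A : pzRingType) (x y : A) (i : 'I_3) : A :=
  nth 0 [:: y ^+ 2; - (x * y); x ^+ 2] i.

(** Paired with p_-, on which h acts by its inverse transpose, these need no determinant: the
    exponent is unchanged and the degree drops by 2, that is, they lead to Lambda - (2,0). *)
Definition quad (A : pzRingType) (x y : A) (i : 'I_3) : A :=
  nth 0 [:: x ^+ 2; x * y; y ^+ 2] i.

(** The scalars enter through an abstract morphism f, which makes this an identity in a commutative
    ring; f is later the embedding of constants into polynomials. *)
Lemma quad_dual_equivariant (A : comPzRingType) (f : {rmorphism C -> A}) (x y : A)
    (a b c d : C) i :
  \sum_j f (sym2_mx a b c d i j) *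
    quad_dual (f a * x + f c * y) (f b * x + f d * y) j =
  f ((a * d - b * c) ^+ 2) * quad_dual x y i.
Proof.
elim/ord3_ind: i; rewrite sum3 /sym2_mx /quad_dual /=; ring.
Qed.

Lemma quad_equivariant (A : comPzRingType) (f : {rmorphism C -> A}) (x y : A)
    (a b c d D : C) i : D * (a * d - b * c) = 1 ->
  \sum_j f (sym2_mx (D * d) (- (D * c)) (- (D * b)) (D * a) i j) *
    quad (f a * x + f c * y) (f b * x + f d * y) j = quad x y i.
Proof.
move=> hD; have H : f D * f a * f d = 1 + f D * f b * f c.
  by rewrite -!rmorphM -(rmorph1 f) -rmorphD -hD; congr (f _); ring.
by elim/ord3_ind: i; rewrite sum3 /sym2_mx /quad /=; ring: H.
Qed.

Lemma xvar_homog i : xvar R i \is mpoly.ishomog1 1 (@mpoly.mdeg 2).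
Proof. by rewrite mpoly.dhomogX /= mpoly.mdeg1. Qed.

Lemma quad_dual_homog i : homog2 (quad_dual (xvar R 0) (xvar R 1) i).
Proof.
elim/ord3_ind: i; rewrite /quad_dual /=.
- exact: (mpoly.dhomogM (xvar_homog 1) (xvar_homog 1)).
- by rewrite rpredN; exact: (mpoly.dhomogM (xvar_homog 0) (xvar_homog 1)).
- exact: (mpoly.dhomogM (xvar_homog 0) (xvar_homog 0)).
Qed.

Lemma quad_homog i : homog2 (quad (xvar R 0) (xvar R 1) i).
Proof.
elim/ord3_ind: i; rewrite /quad /=.
- exact: (mpoly.dhomogM (xvar_homog 0) (xvar_homog 0)).
- exact: (mpoly.dhomogM (xvar_homog 0) (xvar_homog 1)).
- exact: (mpoly.dhomogM (xvar_homog 1) (xvar_homog 1)).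
Qed.

Definition mulform e (g : poly2) (hg : homog2 g) (w : binform R e) : binform R e.+2 :=
  mpoly.DHomog (mpoly.dhomogM hg (mpoly.dhomog_is_dhomog w)).

Lemma val_mulform e g (hg : homog2 g) (w : binform R e) :
  val (mulform hg w) = g * val w.
Proof. by []. Qed.

Lemma mulform_linear e g (hg : homog2 g) : linear (@mulform e g hg).
Proof.
move=> a u v; apply: val_inj; rewrite val_mulform.
have -> : val (a *: u + v) = a *: val u + val v by [].
have -> : val (a *: mulform hg u + mulform hg v) = a *: (g * val u) + g * val v by [].
by rewrite mulrDr scalerAr.
Qed.

Lemma subst_quad (q : poly2 -> poly2 -> 'I_3 -> poly2) (h : 'M[C]_2) a b c d j :
  (forall x y i, subst_form h (q x y i) = q (subst_form h x) (subst_form h y) i) ->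
  h = mx2 a b c d ->
  subst_form h (q (xvar R 0) (xvar R 1) j) =
  q (mpoly.mpolyC 2 a * xvar R 0 + mpoly.mpolyC 2 c * xvar R 1)
    (mpoly.mpolyC 2 b * xvar R 0 + mpoly.mpolyC 2 d * xvar R 1) j.
Proof.
move=> hq E; rewrite hq !subst_form_xvar E !mxE /= !mpoly.mul_mpolyC.
by [].
Qed.

Lemma subst_quad_dual h (x y : poly2) i : subst_form h (quad_dual x y i) =
  quad_dual (subst_form h x) (subst_form h y) i.
Proof.
elim/ord3_ind: i; rewrite /quad_dual /=.
- exact: subst_formX.
- by rewrite -scaleN1r subst_formZ subst_formM scaleN1r.
- exact: subst_formX.
Qed.

Lemma subst_quad_std h (x y : poly2) i : subst_form h (quad x y i) =
  quad (subst_form h x) (subst_form h y) i.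
Proof.
elim/ord3_ind: i; rewrite /quad /=.
- exact: subst_formX.
- exact: subst_formM.
- exact: subst_formX.
Qed.

Lemma tau_mulform e (b b' : int) (h : 'M[C]_2) (r : C) (g : 'I_3 -> poly2)
    (hg : forall j, homog2 (g j)) (M : 'I_3 -> 'I_3 -> C) i (w : binform R e) :
  (\sum_j mpoly.mpolyC 2 (M i j) * subst_form h (g j) = mpoly.mpolyC 2 r * g i) ->
  \det h ^ b * r = \det h ^ b' ->
  \sum_j M i j *: tau b h (mulform (hg j) w) = mulform (hg i) (tau b' h w).
Proof.
move=> hM hr; apply: val_inj.
have -> : val (\sum_j M i j *: tau b h (mulform (hg j) w)) =
    \sum_j M i j *: val (tau b h (mulform (hg j) w)).
  exact: (raddf_sum (@mpoly.mpoly_of_dhomog 2 C e.+2)).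
rewrite val_mulform (val_tau b' h w).
under eq_bigr => j _ do rewrite (val_tau b h (mulform (hg j) w)) val_mulform subst_formM.
rewrite -[RHS]scalerAr -hr -[RHS]scalerA [r *: _]scalerAl -(mpoly.mul_mpolyC r (g i)).
rewrite -hM mulr_suml.
rewrite scaler_sumr; apply: eq_bigr => j _.
by rewrite !scalerA mulrC -scalerA mpoly.mul_mpolyC -!scalerAl.
Qed.

End Multiplication.

(** * Vanishing of the maps from K-types of smaller norm *)

Section Vanishing.
Variables (R : realType) (V : gkmodule R).
Local Notation C := R[i].

Lemma K_to_U2_det (k : 'M[R]_4) : maxK k -> exists a b c d : C,
  [/\ K_to_U2 k = mx2 a b c d, a * d - b * c != 0,
    \det (K_to_U2 k) = a * d - b * c &
    forall j, [/\ cmx k *m PP (sym2 R j) *m cmx k^T =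
        \sum_i sym2_mx a b c d i j *: PP (sym2 R i),
      (let D := (a * d - b * c)^-1 in
      cmx k *m PM (sym2 R j) *m cmx k^T =
        \sum_i sym2_mx (D * d) (- (D * c)) (- (D * b)) (D * a) i j *: PM (sym2 R i)) &
      cmx k *m KC (sl2_mx R j) *m cmx k^T =
        \sum_i sl2_conj_mx a b c d (a * d - b * c) i j *: KC (sl2_mx R i) /\
      cmx k *m KC (sl2_mx' R j) *m cmx k^T =
        \sum_i sl2_conj_mx' a b c d (a * d - b * c) i j *: KC (sl2_mx' R i)]].
Proof.
move=> hk; have [A [B [kE ktE hE hinv]]] := maxK_unitary hk.
have [a [b [c [d hh]]]] := mx2P (A + 'i *: B).
have D0 : a * d - b * c != 0.
  have := congr1 determinant hinv; rewrite det_mulmx hh mx2_det det1 => H.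
  by apply/eqP => E; move: H; rewrite E mulr0 => /eqP; rewrite eq_sym oner_eq0.
have gE : (A - 'i *: B)^T = (a * d - b * c)^-1 *: mx2 d (- b) (- c) a.
  have h1 : mx2 a b c d *m ((a * d - b * c)^-1 *: mx2 d (- b) (- c) a) = 1%:M.
    by rewrite mx2Z mx2M mx2_scalar; congr mx2; field.
  by rewrite -[LHS]mulmx1 -h1 mulmxA -hh hinv mul1mx.
exists a, b, c, d; split=> //; first by rewrite hE hh.
  by rewrite hE hh mx2_det.
move=> j; split.
- rewrite ktE kE conj_PP hh sym2_conj; exact: PPE_sum.
- move=> D; rewrite ktE kE conj_PM.
  have -> : A - 'i *: B = mx2 (D * d) (- (D * c)) (- (D * b)) (D * a).
    by rewrite -[LHS]trmxK gE mx2Z mx2T -/D; congr mx2; ring.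
  rewrite sym2_conj; exact: PME_sum.
- split; rewrite ktE kE conj_KC hh gE.
    rewrite sl2_conj; exact: KCE_sum.
  rewrite sl2_conj'; exact: KCE_sum.
Qed.

Variables (a : int * int) (b : int).
Hypothesis hmin : is_minimal_K_type V a.

Lemma vogan_norm_pair (n : nat) (c : int) :
  hwdeg (c + n%:Z, c) = n /\ c <= (c + n%:Z, c).1.
Proof. by rewrite /hwdeg /=; split; [rewrite addrC addKr | rewrite lerDl]. Qed.

Lemma sum_linear n (U : lmodType C) (Z : 'I_n -> 'M[C]_4) (m : 'I_n -> U -> V) :
  (forall j, sp4C (Z j)) -> (forall j, linear (m j)) ->
  linear (fun w => \sum_j actC (@gact _ V) (Z j) (m j w)).
Proof.
move=> hZ hm c u v; rewrite scaler_sumr -big_split; apply: eq_bigr => j _ /=.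
by rewrite hm actCP.
Qed.

Lemma is_K_equivariant_vanish n e c (Z : 'I_n -> 'M[C]_4) (m : 'I_n -> binform R e -> V) :
  (forall j, sp4C (Z j)) -> (forall j, linear (m j)) ->
  vogan_norm (c + e%:Z, c) < vogan_norm a ->
  (forall k, maxK k -> exists M : 'I_n -> 'I_n -> C,
     (forall j, cmx k *m Z j *m cmx k^T = \sum_i M i j *: Z i) /\
     (forall i w, \sum_j M i j *: kact k (m j w) = m i (tau c (K_to_U2 k) w))) ->
  forall w, \sum_j actC (@gact _ V) (Z j) (m j w) = 0.
Proof.
move=> hZ hm hn hM w; have [h1 h2] := vogan_norm_pair e c.
apply: (@not_occurs_eq0 _ V a (c + e%:Z, c) e
  (fun w => \sum_j actC (@gact _ V) (Z j) (m j w)) hmin h1 h2 hn) => [|k p hk].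
  exact: sum_linear.
have [M [HZ Hm]] := hM k hk.
by rewrite (K_equivariant_sum hk hZ HZ Hm).
Qed.

Section Contraction.
Variable e : nat.
Variable iota : {linear binform R e.+2 -> V}.
Hypothesis iotaK : forall k p, maxK k -> iota (tau b (K_to_U2 k) p) = kact k (iota p).

(** Here Lambda = (b + e + 2, b), so the source has highest weight Lambda + (0,2). *)
Lemma schmid_plus2 : vogan_norm (b + 2 + e%:Z, b + 2) < vogan_norm a ->
  forall w, \sum_j actC (@gact _ V) (PP (sym2 R j))
    (iota (mulform (quad_dual_homog R j) w)) = 0.
Proof.
move=> hn; apply: is_K_equivariant_vanish hn _ => [j|j|k hk].
- exact/sp4C_PP/sym2T.
- by move=> c u v; rewrite mulform_linear linearP.
have [x [y [z [t [hE D0 hdet hconj]]]]] := K_to_U2_det hk.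
exists (sym2_mx x y z t); split=> [j|i w]; first by have [] := hconj j.
under eq_bigr do rewrite -iotaK // -linearZ.
rewrite -linear_sum; congr (iota _).
apply: (tau_mulform (r := (x * t - y * z) ^+ 2)).
  rewrite -(quad_dual_equivariant (@mpoly.mpolyC 2 C) _ _ x y z t).
  apply: eq_bigr => j _; congr (_ * _).
  exact: subst_quad (@subst_quad_dual R _) hE.
by rewrite hdet -[_ ^+ 2]/(_ ^ 2) -expfzDr.
Qed.

Lemma schmid_minus2 : vogan_norm (b + e%:Z, b) < vogan_norm a ->
  forall w, \sum_j actC (@gact _ V) (PM (sym2 R j))
    (iota (mulform (quad_homog R j) w)) = 0.
Proof.
move=> hn; apply: is_K_equivariant_vanish hn _ => [j|j|k hk].
- exact/sp4C_PM/sym2T.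
- by move=> c u v; rewrite mulform_linear linearP.
have [x [y [z [t [hE D0 hdet hconj]]]]] := K_to_U2_det hk.
set D := (x * t - y * z)^-1 in hconj.
exists (sym2_mx (D * t) (- (D * z)) (- (D * y)) (D * x)).
split=> [j|i w]; first by have [] := hconj j.
under eq_bigr do rewrite -iotaK // -linearZ.
rewrite -linear_sum; congr (iota _).
apply: (tau_mulform (r := 1)); last by rewrite mulr1.
have hD : D * (x * t - y * z) = 1 by rewrite mulVf.
rewrite rmorph1 mul1r.
rewrite -(quad_equivariant (@mpoly.mpolyC 2 C) (xvar R 0) (xvar R 1) i hD).
apply: eq_bigr => j _; congr (_ * _).
exact: subst_quad (@subst_quad_std R _) hE.
Qed.

End Contraction.

Section SameDegree.
Variable d : nat.
Variable iota : {linear binform R d -> V}.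
Hypothesis iotaK : forall k p, maxK k -> iota (tau b (K_to_U2 k) p) = kact k (iota p).

Lemma tau_detM (c : int) h (w : binform R d) : \det h != 0 ->
  tau (b + c) h w = \det h ^ c *: tau b h w.
Proof. by move=> D0; rewrite /tau expfzDr // mulrC scalerA. Qed.

Lemma iotaZ (c : C) w : iota (c *: w) = c *: iota w.
Proof. by have := linearP iota c w 0; rewrite linear0 !addr0. Qed.

Lemma kact_KC k X w : maxK k -> kact k (actC (@gact _ V) (KC X) (iota w)) =
  actC (@gact _ V) (cmx k *m KC X *m cmx k^T) (iota (tau b (K_to_U2 k) w)).
Proof. by move=> hk; rewrite kact_actC ?iotaK //; exact: sp4C_KC. Qed.

(** The degree does not change, so no multiplier is available. Instead the basis of sl_2 dual to p_+
    acts on V_Lambda through k_C, and [sym2_sl2_dual] collapses the double sum to the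
    determinant. *)
Lemma schmid_plus0 : vogan_norm (b + 1 + d%:Z, b + 1) < vogan_norm a ->
  forall w, \sum_j actC (@gact _ V) (PP (sym2 R j))
    (actC (@gact _ V) (KC (sl2_mx R j)) (iota w)) = 0.
Proof.
move=> hn; apply: is_K_equivariant_vanish hn _ => [j|j|k hk].
- exact/sp4C_PP/sym2T.
- by move=> c u v; rewrite linearP actCP //; exact: sp4C_KC.
have [x [y [z [t [hE D0 hdet hconj]]]]] := K_to_U2_det hk.
exists (sym2_mx x y z t); split=> [j|i w]; first by have [] := hconj j.
have sK j : sp4C (KC (sl2_mx R j)) by exact: sp4C_KC.
have E j : kact k (actC (@gact _ V) (KC (sl2_mx R j)) (iota w)) =
    \sum_l sl2_conj_mx x y z t (x * t - y * z) l j *: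
      actC (@gact _ V) (KC (sl2_mx R l)) (iota (tau b (K_to_U2 k) w)).
  have [_ _ [H _]] := hconj j.
  by rewrite (kact_KC _ _ hk) H (actC_sum _ _ sK).
under eq_bigr do rewrite E scaler_sumr.
rewrite exchange_big /=.
under eq_bigr => l _.
  under eq_bigr do rewrite scalerA.
  rewrite -scaler_suml sym2_sl2_dual //; over.
rewrite (bigD1 i) //= eqxx mulr1 big1 ?addr0; last first.
  by move=> l /negbTE; rewrite eq_sym => ->; rewrite mulr0 scale0r.
rewrite tau_detM ?hdet // expr1z.
by rewrite (iotaZ _ (tau b (K_to_U2 k) w)) (actCZ _ _ (sK i)).
Qed.

Lemma schmid_minus0 : vogan_norm (b - 1 + d%:Z, b - 1) < vogan_norm a ->
  forall w, \sum_j actC (@gact _ V) (PM (sym2 R j))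
    (actC (@gact _ V) (KC (sl2_mx' R j)) (iota w)) = 0.
Proof.
move=> hn; apply: is_K_equivariant_vanish hn _ => [j|j|k hk].
- exact/sp4C_PM/sym2T.
- by move=> c u v; rewrite linearP actCP //; exact: sp4C_KC.
have [x [y [z [t [hE D0 hdet hconj]]]]] := K_to_U2_det hk.
set D := (x * t - y * z)^-1 in hconj.
exists (sym2_mx (D * t) (- (D * z)) (- (D * y)) (D * x)).
split=> [j|i w]; first by have [] := hconj j.
have sK j : sp4C (KC (sl2_mx' R j)) by exact: sp4C_KC.
have E j : kact k (actC (@gact _ V) (KC (sl2_mx' R j)) (iota w)) =
    \sum_l sl2_conj_mx' x y z t (x * t - y * z) l j *:
      actC (@gact _ V) (KC (sl2_mx' R l)) (iota (tau b (K_to_U2 k) w)).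
  have [_ _ [_ H]] := hconj j.
  by rewrite (kact_KC _ _ hk) H (actC_sum _ _ sK).
under eq_bigr do rewrite E scaler_sumr.
rewrite exchange_big /=.
under eq_bigr => l _.
  under eq_bigr do rewrite scalerA.
  rewrite -scaler_suml /D sym2_sl2_dual' //; over.
rewrite (bigD1 i) //= eqxx mulr1 big1 ?addr0; last first.
  by move=> l /negbTE; rewrite eq_sym => ->; rewrite mulr0 scale0r.
rewrite tau_detM ?hdet // -[X in _ ^ X]/(- 1) -invr_expz expr1z.
by rewrite (iotaZ _ (tau b (K_to_U2 k) w)) (actCZ _ _ (sK i)).
Qed.

End SameDegree.

End Vanishing.

(** * Radial parts *)

Section Generators.
Variable R : realType.
Local Notation C := R[i].
Implicit Types (S : 'M[R]_2).

(** For symmetric S, [Hmx] and [Mmx] span p, [Nmx] the Siegel nilradical, and [Kmx] with [rotmx] the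
    algebra k; [U0mx] is the root vector of N_0 on which psi is nontrivial. The elements of p_+ and
    p_- are [Hmx] plus or minus i times [Mmx]. *)
Definition Hmx S : 'M[R]_4 := b4 S 0 0 (- S).
Definition Mmx S : 'M[R]_4 := b4 0 S S 0.
Definition Nmx S : 'M[R]_4 := b4 0 S 0 0.
Definition Kmx S : 'M[R]_4 := b4 0 S (- S) 0.
Definition rotmx : 'M[R]_4 := b4 (mx2 0 (-1) 1 0) 0 0 (mx2 0 (-1) 1 0).
Definition U0mx : 'M[R]_4 := b4 (mx2 0 1 0 0) 0 0 (mx2 0 0 (-1) 0).
Definition s_id : 'M[R]_2 := mx2 1 0 0 1.
Definition s_diag : 'M[R]_2 := mx2 1 0 0 (-1).
Definition s_anti : 'M[R]_2 := mx2 0 1 1 0.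

(** Iwasawa decomposition of the off-diagonal part of p. At a point of A the first term contributes
    nothing, since psi is trivial on the Siegel unipotent subgroup. *)
Lemma Mmx_split S : Mmx S = 2 *: Nmx S + (-1) *: Kmx S.
Proof.
case: (mx2P S) => a [b [c [d ->]]]; rewrite /Mmx /Nmx /Kmx !b4Z b4D !mx2E.
by congr b4; congr mx2; ring.
Qed.

(** The remaining direction of p, and the only one along which psi is felt: this is how c_0 enters
    the equations. *)
Lemma Hmx_anti_split : Hmx s_anti = 2 *: U0mx + rotmx.
Proof. by rewrite /Hmx /U0mx /rotmx /s_anti b4Z b4D !mx2E; congr b4; congr mx2; ring. Qed.

Lemma sp4_Hmx S : S^T = S -> sp4 (Hmx S).
Proof. by move=> hS; apply: sp4_b4; rewrite ?trmx0 ?hS. Qed.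
Lemma sp4_Mmx S : S^T = S -> sp4 (Mmx S).
Proof. by move=> hS; apply: sp4_b4; rewrite ?trmx0 ?oppr0. Qed.
Lemma sp4_Nmx S : S^T = S -> sp4 (Nmx S).
Proof. by move=> hS; apply: sp4_b4; rewrite ?trmx0 ?oppr0. Qed.
Lemma sp4_Kmx S : S^T = S -> sp4 (Kmx S).
Proof. by move=> hS; apply: sp4_b4; rewrite ?trmx0 ?oppr0 // linearN /= hS. Qed.
Lemma sp4_rotmx : sp4 rotmx.
Proof. by apply: sp4_b4; rewrite ?trmx0 // mx2T mx2N !opprK oppr0. Qed.
Lemma sp4_U0mx : sp4 U0mx.
Proof. by apply: sp4_b4; rewrite ?trmx0 // mx2T mx2N oppr0. Qed.

Lemma lieK_Kmx S : S^T = S -> lieK (Kmx S).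
Proof.
move=> hS; rewrite /lieK sp4_Kmx //=; apply/eqP.
by rewrite /Kmx b4T b4D linearN /= hS trmx0 addr0 addNr subrr -b4_0.
Qed.

Lemma lieK_rotmx : lieK rotmx.
Proof.
rewrite /lieK sp4_rotmx /=; apply/eqP.
by rewrite /rotmx b4T b4D !mx2E b4_0 mx2_0; congr b4; congr mx2; ring.
Qed.

Lemma s_idT : s_id^T = s_id. Proof. exact: mx2T. Qed.
Lemma s_diagT : s_diag^T = s_diag. Proof. exact: mx2T. Qed.
Lemma s_antiT : s_anti^T = s_anti. Proof. exact: mx2T. Qed.

Lemma Hmx_sqr S : S *m S = 1%:M -> Hmx S *m Hmx S = 1%:M.
Proof. by move=> SS; rewrite /Hmx b4M !mul0mx !mulmx0 mulNmx mulmxN opprK SS !(addr0, add0r) -b4_scalar. Qed.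
Lemma Kmx_sqr S : S *m S = 1%:M -> Kmx S *m Kmx S = - 1%:M.
Proof.
move=> SS; rewrite /Kmx b4M !mul0mx !mulmx0 mulNmx mulmxN SS !(add0r, addr0).
by rewrite b4_scalar b4N !oppr0.
Qed.
Lemma Nmx_sqr S : Nmx S *m Nmx S = 0.
Proof. by rewrite /Nmx b4M !mul0mx !mulmx0 !addr0 -b4_0. Qed.
Lemma rotmx_sqr : rotmx *m rotmx = - 1%:M.
Proof. by rewrite /rotmx b4M b4_scalar b4N !mx2E; congr b4; congr mx2; ring. Qed.
Lemma U0mx_sqr : U0mx *m U0mx = 0.
Proof. by rewrite /U0mx b4M b4_0 !mx2E; congr b4; congr mx2; ring. Qed.
Lemma s_id_sqr : s_id *m s_id = 1%:M.
Proof. by rewrite !mx2E; congr mx2; ring. Qed.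
Lemma s_diag_sqr : s_diag *m s_diag = 1%:M.
Proof. by rewrite !mx2E; congr mx2; ring. Qed.
Lemma s_anti_sqr : s_anti *m s_anti = 1%:M.
Proof. by rewrite !mx2E; congr mx2; ring. Qed.

Lemma Sp4_quadratic (X : 'M[R]_4) eps c s : sp4 X -> X *m X = eps%:M ->
  c ^+ 2 - s ^+ 2 * eps = 1 -> Sp4 (c%:M + s *: X).
Proof.
rewrite /sp4 addr_eq0 => /eqP hX XX hc.
have kT : (c%:M + s *: X)^T = c%:M + s *: X^T.
  by rewrite linearD /= tr_scalar_mx linearZ.
rewrite /Sp4 kT.
have -> : (c%:M + s *: X^T) *m J4 R = J4 R *m (c%:M - s *: X).
  by rewrite mulmxDl mulmxBr -scalemxAl hX scalar_mxC scalerN scalemxAr.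
have XX' : (s *: X) *m (s *: X) = (s ^+ 2 * eps)%:M.
  by rewrite -scalemxAl -scalemxAr XX scalerA scale_scalar_mx -expr2.
rewrite -mulmxA mulmxDr !mulmxBl XX' (scalar_mxC c (s *: X)) addrA subrK.
by rewrite -scalar_mxM -raddfB /= -expr2 hc mulmx1.
Qed.

Lemma Sp4M (g h : 'M[R]_4) : Sp4 g -> Sp4 h -> Sp4 (g *m h).
Proof.
rewrite /Sp4 => /eqP hg /eqP hh; rewrite trmx_mul.
by rewrite -!mulmxA (mulmxA g^T) (mulmxA _ g) hg mulmxA hh.
Qed.

Lemma Sp4_a0 (a1 a2 : R) : a1 != 0 -> a2 != 0 -> Sp4 (a0 a1 a2).
Proof.
move=> h1 h2; rewrite /Sp4 a0E J4E b4T !b4M !mx2E; apply/eqP.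
by congr b4; congr mx2; field; rewrite ?h1 ?h2.
Qed.

Lemma maxK_Sp4 (k : 'M[R]_4) : maxK k -> Sp4 k.
Proof. by case/andP. Qed.

Definition a_st (s t : R) : 'M[R]_4 := a0 (expR (s + t)) (expR (s - t)).

Lemma Sp4_a_st s t : Sp4 (a_st s t).
Proof. by apply: Sp4_a0; rewrite gt_eqF ?expR_gt0. Qed.

Lemma a_st_Hid s t r : a_st s t *m expm (r *: Hmx s_id) = a_st (s + r) t.
Proof.
rewrite (expm_involution _ (Hmx_sqr s_id_sqr)) /a_st !a0E /Hmx b4Z b4_scalar b4D b4M !mx2E.
rewrite -!expRN !(expRD, opprD).
by congr b4; congr mx2; field; rewrite ?gt_eqF ?expR_gt0.
Qed.

Lemma a_st_Hdiag s t r : a_st s t *m expm (r *: Hmx s_diag) = a_st s (t + r).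
Proof.
rewrite (expm_involution _ (Hmx_sqr s_diag_sqr)) /a_st !a0E /Hmx b4Z b4_scalar b4D b4M !mx2E.
rewrite -!expRN !(expRD, opprD, opprK).
by congr b4; congr mx2; field; rewrite ?gt_eqF ?expR_gt0.
Qed.

Lemma a_st_Nmx s t r (x y z : R) : a_st s t *m expm (r *: Nmx (mx2 x y y z)) =
  n0 0 (expR (2 * s + 2 * t) * r * x) (expR (2 * s) * r * y) (expR (2 * s - 2 * t) * r * z)
    *m a_st s t.
Proof.
rewrite expm_nilpotent ?Nmx_sqr // /a_st n0E !a0E /Nmx b4Z b4_scalar b4D !b4M !mx2E.
have -> : 2 * s + 2 * t = (s + t) + (s + t) by ring.
have -> : 2 * s - 2 * t = (s - t) + (s - t) by ring.
have -> : 2 * s = (s + t) + (s - t) by ring.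
rewrite !(expRD (s + t)) !(expRD (s - t)).
have h1 : expR (s + t) != 0 by rewrite gt_eqF ?expR_gt0.
have h2 : expR (s - t) != 0 by rewrite gt_eqF ?expR_gt0.
by congr b4; congr mx2; field; rewrite ?h1 ?h2.
Qed.

Lemma a_st_U0mx s t r : a_st s t *m expm (r *: U0mx) =
  n0 (expR (2 * t) * r) 0 0 0 *m a_st s t.
Proof.
rewrite expm_nilpotent ?U0mx_sqr // /a_st n0E !a0E /U0mx b4Z b4_scalar b4D !b4M !mx2E.
have -> : expR (2 * t) = expR (s + t) / expR (s - t).
  by rewrite -expRN -expRD; congr expR; ring.
have h1 : expR (s + t) != 0 by rewrite gt_eqF ?expR_gt0.
have h2 : expR (s - t) != 0 by rewrite gt_eqF ?expR_gt0.
by congr b4; congr mx2; field; rewrite ?h1 ?h2.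
Qed.

End Generators.

(** * The action of k in the basis u_k *)

Section CompactAction.
Variable R : realType.
Local Notation C := R[i].

Lemma pq_comb (al be : C) : al *: pvar R + be *: qvar R =
  (al + be) *: xvar R 0 + ('i * (al - be)) *: xvar R 1.
Proof.
rewrite /pvar /qvar -scaleNr !scalerDr !scalerA addrACA -!scalerDl.
by congr (_ *: _ + _ *: _); ring.
Qed.

Lemma subst_form_lin (h : 'M[C]_2) (w : C) : subst_form h (xvar R 0 + w *: xvar R 1) =
  (h 0 0 + w * h 0 1) *: xvar R 0 + (h 1 0 + w * h 1 1) *: xvar R 1.
Proof.
rewrite subst_formD subst_formZ !subst_form_xvar scalerDr !scalerA addrACA.
by rewrite -!scalerDl.
Qed.

Lemma subst_form_pq (h : 'M[C]_2) (a1 b1 a2 b2 : C) :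
  h 0 0 + 'i * h 0 1 = a1 + b1 -> h 1 0 + 'i * h 1 1 = 'i * (a1 - b1) ->
  h 0 0 - 'i * h 0 1 = a2 + b2 -> h 1 0 - 'i * h 1 1 = 'i * (a2 - b2) ->
  subst_form h (pvar R) = a1 *: pvar R + b1 *: qvar R /\
  subst_form h (qvar R) = a2 *: pvar R + b2 *: qvar R.
Proof.
move=> h1 h2 h3 h4; rewrite (pq_comb a1 b1) (pq_comb a2 b2) -h1 -h2 -h3 -h4.
have E1 := subst_form_lin h 'i; have E2 := subst_form_lin h (- 'i).
split; first exact: E1.
by rewrite -(mulNr 'i (h 0 1)) -(mulNr 'i (h 1 1)) -E2 scaleNr.
Qed.

Lemma expm_Kmx_U2 (x y z w t : R) :
  mx2 x y z w *m mx2 x y z w = 1%:M ->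
  K_to_U2 (expm (t *: Kmx (mx2 x y z w))) =
  mx2 (cos t +i* (sin t * x)) (0 +i* (sin t * y)) (0 +i* (sin t * z)) (cos t +i* (sin t * w)).
Proof.
move=> SS; rewrite expm_rotation ?Kmx_sqr // /Kmx b4Z b4_scalar b4D !mx2E K_to_U2_mx2.
by congr mx2; congr Complex; ring.
Qed.

Lemma expm_rotmx_U2 (t : R) : K_to_U2 (expm (t *: rotmx R)) =
  mx2 (cos t +i* 0) ((- sin t) +i* 0) (sin t +i* 0) (cos t +i* 0).
Proof.
rewrite expm_rotation ?rotmx_sqr // /rotmx b4Z b4_scalar b4D !mx2E K_to_U2_mx2.
by congr mx2; congr Complex; ring.
Qed.

Variables (d : nat) (b : int) (k : nat) (l : {scalar binform R d}).
Hypothesis kd : (k <= d)%N.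

Let eqC (x y : C) : complex.Re x = complex.Re y -> complex.Im x = complex.Im y -> x = y.
Proof. by move=> h1 h2; apply/eqP; rewrite eq_complex h1 h2 !eqxx. Qed.

Lemma tau_Kid_derive :
  is_deriveC (fun t => l (tau b (K_to_U2 (expm (t *: Kmx (s_id R)))) (ub R d k))) 0
    ('i%C * (2 * b%:~R + d%:R) * l (ub R d k)).
Proof.
have := is_deriveC_cexpi (2 * b%:~R + d%:R) (l (ub R d k)).
have -> : 'i * (2 * b%:~R + d%:R)%:C * l (ub R d k) =
    'i * (2 * b%:~R + d%:R) * l (ub R d k).
  by rewrite rmorphD rmorphM !rmorph_nat rmorph_int.
apply: is_deriveC_ext => t.
have -> : K_to_U2 (expm (t *: Kmx (s_id R))) = (cexpi t)%:M.
  rewrite expm_Kmx_U2 ?s_id_sqr // mx2_scalar /cexpi.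
  by congr mx2; congr Complex; ring.
by rewrite tau_scalar // linearZ.
Qed.

Lemma tau_Kdiag_derive :
  is_deriveC (fun t => l (tau b (K_to_U2 (expm (t *: Kmx (s_diag R)))) (ub R d k))) 0
    ('i%C * (k%:R * l (ub R d k.-1) + (d - k)%:R * l (ub R d k.+1))).
Proof.
have H t := subst_form_pq (h := K_to_U2 (expm (t *: Kmx (s_diag R))))
  (a1 := (cos t)%:C) (b1 := (sin t)%:C * 'i) (a2 := (sin t)%:C * 'i) (b2 := (cos t)%:C).
have {}H t : subst_form (K_to_U2 (expm (t *: Kmx (s_diag R)))) (pvar R) =
    (cos t)%:C *: pvar R + (sin t)%:C *: (0 *: pvar R + 'i *: qvar R) /\
  subst_form (K_to_U2 (expm (t *: Kmx (s_diag R)))) (qvar R) =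
    (cos t)%:C *: qvar R + (sin t)%:C *: ('i *: pvar R + 0 *: qvar R).
  rewrite !scale0r add0r addr0 !scalerA [X in _ /\ _ = X]addrC.
  apply: H; rewrite expm_Kmx_U2 ?s_diag_sqr // !mxE /=;
    apply: eqC;
    rewrite !(ReD, ImD, ReM, ImM) /=; ring.
have Hdet t : \det (K_to_U2 (expm (t *: Kmx (s_diag R)))) = 1.
  rewrite expm_Kmx_U2 ?s_diag_sqr // mx2_det; apply: eqC; rewrite !(ReD, ImD, ReM, ImM) /=; last by ring.
  by transitivity (cos t ^+ 2 + sin t ^+ 2); [ring | exact: cos2Dsin2].
apply: is_deriveC_eq (@tau_rotation_derive R d b k l _ 0 'i%C 'i%C 0 kd Hdet
  (fun t => (H t).1) (fun t => (H t).2)) _.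
by ring.
Qed.

Lemma tau_Kanti_derive :
  is_deriveC (fun t => l (tau b (K_to_U2 (expm (t *: Kmx (s_anti R)))) (ub R d k))) 0
    (- (k%:R * l (ub R d k.-1)) + (d - k)%:R * l (ub R d k.+1)).
Proof.
have H t := subst_form_pq (h := K_to_U2 (expm (t *: Kmx (s_anti R))))
  (a1 := (cos t)%:C) (b1 := - (sin t)%:C) (a2 := (sin t)%:C) (b2 := (cos t)%:C).
have {}H t : subst_form (K_to_U2 (expm (t *: Kmx (s_anti R)))) (pvar R) =
    (cos t)%:C *: pvar R + (sin t)%:C *: (0 *: pvar R + (-1) *: qvar R) /\
  subst_form (K_to_U2 (expm (t *: Kmx (s_anti R)))) (qvar R) =
    (cos t)%:C *: qvar R + (sin t)%:C *: (1 *: pvar R + 0 *: qvar R).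
  rewrite !scale0r add0r addr0 !scalerA mulrN1 mulr1 [X in _ /\ _ = X]addrC.
  apply: H; rewrite expm_Kmx_U2 ?s_anti_sqr // !mxE /=;
    apply: eqC;
    rewrite !(ReD, ImD, ReM, ImM) /=; ring.
have Hdet t : \det (K_to_U2 (expm (t *: Kmx (s_anti R)))) = 1.
  rewrite expm_Kmx_U2 ?s_anti_sqr // mx2_det; apply: eqC; rewrite !(ReD, ImD, ReM, ImM) /=; last by ring.
  by transitivity (cos t ^+ 2 + sin t ^+ 2); [ring | exact: cos2Dsin2].
apply: is_deriveC_eq (@tau_rotation_derive R d b k l _ 0 (-1) 1 0 kd Hdet
  (fun t => (H t).1) (fun t => (H t).2)) _.
by ring.
Qed.

(** The u_k are weight vectors of the rotation group, x_1 + i x_2 and x_1 - i x_2 being its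
    eigenvectors. Since [Hmx_anti_split] joins [rotmx] to the root vector seen by psi, [phi_Hanti]
    becomes diagonal in k. *)
Lemma tau_rotmx_derive :
  is_deriveC (fun t => l (tau b (K_to_U2 (expm (t *: rotmx R))) (ub R d k))) 0
    (- ('i%C * (k%:R - (d - k)%:R) * l (ub R d k))).
Proof.
have H t := subst_form_pq (h := K_to_U2 (expm (t *: rotmx R)))
  (a1 := (cos t)%:C + (sin t)%:C * - 'i) (b1 := 0)
  (a2 := 0) (b2 := (cos t)%:C + (sin t)%:C * 'i).
have {}H t : subst_form (K_to_U2 (expm (t *: rotmx R))) (pvar R) =
    (cos t)%:C *: pvar R + (sin t)%:C *: (- 'i *: pvar R + 0 *: qvar R) /\
  subst_form (K_to_U2 (expm (t *: rotmx R))) (qvar R) =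
    (cos t)%:C *: qvar R + (sin t)%:C *: (0 *: pvar R + 'i *: qvar R).
  have := H t; rewrite !scale0r !addr0 !add0r !scalerA -!scalerDl; apply; rewrite expm_rotmx_U2 !mxE /=;
    apply: eqC;
    rewrite !(ReD, ImD, ReM, ImM) /=; ring.
have Hdet t : \det (K_to_U2 (expm (t *: rotmx R))) = 1.
  rewrite expm_rotmx_U2 mx2_det; apply: eqC; rewrite !(ReD, ImD, ReM, ImM) /=; last by ring.
  by transitivity (cos t ^+ 2 + sin t ^+ 2); [ring | exact: cos2Dsin2].
apply: is_deriveC_eq (@tau_rotation_derive R d b k l _ (- 'i%C) 0 0 'i%C kd Hdet
  (fun t => (H t).1) (fun t => (H t).2)) _.
by ring.
Qed.

End CompactAction.

Section RadialParts.
Variables (R : realType) (V : gkmodule R) (c0 : R) (phi : V -> 'M[R]_4 -> R[i]).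
Hypothesis hphi : gk_hom phi.
Hypothesis hpsi : forall v, psi_equivariant c0 (phi v).
Local Notation C := R[i].

Lemma phiP (c : C) u v g : Sp4 g -> phi (c *: u + v) g = c * phi u g + phi v g.
Proof. by case: hphi => _ H _ _; exact: H. Qed.

Lemma phi0 g : Sp4 g -> phi 0 g = 0.
Proof.
by move=> hg; have := phiP (-1) 0 0 hg; rewrite scaler0 addr0 mulN1r addNr.
Qed.

Lemma phiD u v g : Sp4 g -> phi (u + v) g = phi u g + phi v g.
Proof. by move=> hg; have := phiP 1 u v hg; rewrite scale1r mul1r. Qed.

Lemma phiZ (c : C) u g : Sp4 g -> phi (c *: u) g = c * phi u g.
Proof. by move=> hg; have := phiP c u 0 hg; rewrite phi0 // !addr0. Qed.

Lemma phi_sum n (F : 'I_n -> V) g : Sp4 g -> phi (\sum_i F i) g = \sum_i phi (F i) g.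
Proof.
move=> hg; elim: n F => [|n IH] F; first by rewrite !big_ord0 phi0.
by rewrite !big_ord_recl phiD // IH.
Qed.

Lemma phi_gactE X v g z : sp4 X -> Sp4 g ->
  is_deriveC (fun t => phi v (g *m expm (t *: X))) 0 z -> phi (gact X v) g = z.
Proof. by case: hphi => _ _ H _ hX hg D; rewrite (H X v g hX hg); exact: deriveC_val. Qed.

Lemma phi_gact_derive X v g : sp4 X -> Sp4 g ->
  is_deriveC (fun t => phi v (g *m expm (t *: X))) 0 (phi (gact X v) g).
Proof.
case: hphi => hs _ H _ hX hg; rewrite (H X v g hX hg) /lieD.
by apply: derivableC_is_deriveC; have [_ D] := hs v [::] isT; exact: (D X g hX hg).
Qed.

(** The action of X is a derivative along a curve inside G, so it depends on v only through the
    function phi v on G. This allows an inner action of k to be replaced by a vector with the same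
    function, without comparing vectors of V. *)
Lemma phi_gact_congr X v v' g : sp4 X -> (forall t, Sp4 (expm (t *: X))) ->
  (forall g, Sp4 g -> phi v g = phi v' g) -> Sp4 g ->
  phi (gact X v) g = phi (gact X v') g.
Proof.
move=> hX hexp hv hg; apply: phi_gactE => //.
apply: is_deriveC_ext (phi_gact_derive v' hX hg) => t.
by rewrite (hv _ (Sp4M hg (hexp t))).
Qed.

Lemma is_deriveC_shift (f : R -> C) s z :
  is_deriveC (fun r => f (s + r)) 0 z -> is_deriveC f s z.
Proof.
have sh (h : R -> R) x : is_derive (0 : R) 1 (fun r => h (s + r)) x -> is_derive s 1 h x.
  move=> D; have D0 : is_derive (s - s) 1 (fun r => h (s + r)) x by rewrite subrr.
  have := dcomp (g := fun y => y - s) D0 (dB (did s) (dcst s s)).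
  rewrite subr0 mulr1; congr (is_derive _ _ _ _).
  by apply/funext => y; rewrite addrC subrK.
by case=> Dr Di; split; [exact: (sh (fun s => complex.Re (f s))) | exact: (sh (fun s => complex.Im (f s)))].
Qed.

Lemma phi_Hid v s t :
  is_deriveC (fun s => phi v (a_st s t)) s (phi (gact (Hmx (s_id R)) v) (a_st s t)).
Proof.
apply: is_deriveC_shift.
have := phi_gact_derive v (sp4_Hmx (s_idT R)) (Sp4_a_st s t).
by apply: is_deriveC_ext => r; rewrite a_st_Hid.
Qed.

Lemma phi_Hdiag v s t :
  is_deriveC (fun t => phi v (a_st s t)) t (phi (gact (Hmx (s_diag R)) v) (a_st s t)).
Proof.
apply: is_deriveC_shift.
have := phi_gact_derive v (sp4_Hmx (s_diagT R)) (Sp4_a_st s t).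
by apply: is_deriveC_ext => r; rewrite a_st_Hdiag.
Qed.

Lemma phi_Nmx v s t (x y z : R) : phi (gact (Nmx (mx2 x y y z)) v) (a_st s t) = 0.
Proof.
apply: phi_gactE; [exact: sp4_Nmx (mx2T _ _ _ _) | exact: Sp4_a_st |].
apply: is_deriveC_ext (is_deriveC_cst (phi v (a_st s t)) 0) => r.
by rewrite a_st_Nmx hpsi ?Sp4_a_st // mulr0 cexpi0 mul1r.
Qed.

Lemma phi_U0mx v s t : phi (gact (U0mx R) v) (a_st s t) =
  'i * (2 * pi * c0 * expR (2 * t))%:C * phi v (a_st s t).
Proof.
apply: phi_gactE; [exact: sp4_U0mx | exact: Sp4_a_st |].
apply: is_deriveC_ext (is_deriveC_cexpi _ _) => r.
by rewrite a_st_U0mx hpsi ?Sp4_a_st // mulrA.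
Qed.

Lemma phi_Mmx v s t (x y z : R) : phi (gact (Mmx (mx2 x y y z)) v) (a_st s t) =
  - phi (gact (Kmx (mx2 x y y z)) v) (a_st s t).
Proof.
have hS : (mx2 x y y z)^T = mx2 x y y z by exact: mx2T.
rewrite Mmx_split gact_comb ?sp4_Nmx //; last by apply: sp4Z; exact: sp4_Kmx.
rewrite -[_ *: Kmx _]addr0 gact_comb ?sp4_Kmx ?sp4_0 // gact0 addr0.
by rewrite phiP ?Sp4_a_st // phi_Nmx mulr0 add0r phiZ ?Sp4_a_st // rmorphN1 mulN1r.
Qed.

Lemma phi_Hanti v s t : phi (gact (Hmx (s_anti R)) v) (a_st s t) =
  2 * ('i * (2 * pi * c0 * expR (2 * t))%:C * phi v (a_st s t))
  + phi (gact (rotmx R) v) (a_st s t).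
Proof.
rewrite Hmx_anti_split gact_comb ?sp4_U0mx ?sp4_rotmx //.
by rewrite phiP ?Sp4_a_st // phi_U0mx rmorph_nat.
Qed.

End RadialParts.

Section SchmidEquations.
Variables (R : realType) (V : gkmodule R) (c0 : R) (phi : V -> 'M[R]_4 -> R[i]).
Hypothesis hphi : gk_hom phi.
Hypothesis hpsi : forall v, psi_equivariant c0 (phi v).
Local Notation C := R[i].
Local Notation I := ('i%R : C).
Local Notation act := (@gact _ V).

Lemma cmx_b4 (A B D E : 'M[R]_2) : cmx (b4 A B D E) = b4 (cmx A) (cmx B) (cmx D) (cmx E).
Proof. exact: (map_block_mx (real_complex R) A B D E). Qed.

Lemma cmx_mx2 (x y z w : R) : cmx (mx2 x y z w) = mx2 x%:C y%:C z%:C w%:C.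
Proof. by apply/matrixP => i j; rewrite !mxE; do 2 case: eqP. Qed.

Lemma cmx0 m n : cmx (0 : 'M[R]_(m, n)) = 0.
Proof. by apply/matrixP => i j; rewrite !mxE. Qed.

Lemma cmxN m n (A : 'M[R]_(m, n)) : cmx (- A) = - cmx A.
Proof. by apply/matrixP => i j; rewrite !mxE rmorphN. Qed.

Lemma PP_cmx (S : 'M[R]_2) : PP (cmx S) = I *: cmx (Mmx S) + cmx (Hmx S).
Proof. by rewrite /PP /Mmx /Hmx !cmx_b4 !cmx0 cmxN b4Z b4D !scaler0 !add0r !addr0. Qed.

Lemma PM_cmx (S : 'M[R]_2) : PM (cmx S) = - I *: cmx (Mmx S) + cmx (Hmx S).
Proof. by rewrite /PM /Mmx /Hmx !cmx_b4 !cmx0 cmxN b4Z b4D !scaler0 !add0r !addr0. Qed.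

Lemma phi_PP (x y z : R) v s t (S := mx2 x y y z) :
  phi (actC act (PP (cmx S)) v) (a_st s t) =
  phi (gact (Hmx S) v) (a_st s t) - I * phi (gact (Kmx S) v) (a_st s t).
Proof.
have hS : S^T = S by exact: mx2T.
have h1 := sp4C_cmx (sp4_Mmx hS); have h2 := sp4C_cmx (sp4_Hmx hS).
rewrite PP_cmx (actC_comb _ _ h1 h2) !actC_cmx (phiP hphi _ _ _ (Sp4_a_st s t)).
by rewrite (phi_Mmx hphi hpsi) mulrN addrC.
Qed.

Lemma phi_PM (x y z : R) v s t (S := mx2 x y y z) :
  phi (actC act (PM (cmx S)) v) (a_st s t) =
  phi (gact (Hmx S) v) (a_st s t) + I * phi (gact (Kmx S) v) (a_st s t).
Proof.
have hS : S^T = S by exact: mx2T.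
have h1 := sp4C_cmx (sp4_Mmx hS); have h2 := sp4C_cmx (sp4_Hmx hS).
rewrite PM_cmx (actC_comb _ _ h1 h2) !actC_cmx (phiP hphi _ _ _ (Sp4_a_st s t)).
by rewrite (phi_Mmx hphi hpsi) mulrNN addrC.
Qed.

Lemma Sp4_expm_Hmx (S : 'M[R]_2) t : S^T = S -> S *m S = 1%:M -> Sp4 (expm (t *: Hmx S)).
Proof.
move=> hS SS; rewrite expm_involution ?Hmx_sqr //.
apply: Sp4_quadratic (sp4_Hmx hS) (Hmx_sqr SS) _.
have := expRxMexpNx_1 t; move: (expR t) (expR (- t)) => x y xy.
by rewrite mulr1; transitivity (x * y); [field | ].
Qed.

Lemma Sp4_expm_Kmx (S : 'M[R]_2) t : S^T = S -> S *m S = 1%:M -> Sp4 (expm (t *: Kmx S)).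
Proof.
by move=> hS SS; apply/maxK_Sp4/maxK_rotation; [exact: Kmx_sqr | exact: lieK_Kmx].
Qed.

Lemma phi_PP_congr (x y z : R) v v' s t (S := mx2 x y y z) : S *m S = 1%:M ->
  (forall g, Sp4 g -> phi v g = phi v' g) ->
  phi (actC act (PP (cmx S)) v) (a_st s t) = phi (actC act (PP (cmx S)) v') (a_st s t).
Proof.
move=> SS hv; have hS : S^T = S by exact: mx2T.
rewrite !phi_PP.
rewrite (phi_gact_congr hphi (sp4_Hmx hS) (fun r => Sp4_expm_Hmx r hS SS) hv (Sp4_a_st s t)).
by rewrite (phi_gact_congr hphi (sp4_Kmx hS) (fun r => Sp4_expm_Kmx r hS SS) hv (Sp4_a_st s t)).
Qed.

Lemma phi_PM_congr (x y z : R) v v' s t (S := mx2 x y y z) : S *m S = 1%:M ->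
  (forall g, Sp4 g -> phi v g = phi v' g) ->
  phi (actC act (PM (cmx S)) v) (a_st s t) = phi (actC act (PM (cmx S)) v') (a_st s t).
Proof.
move=> SS hv; have hS : S^T = S by exact: mx2T.
rewrite !phi_PM.
rewrite (phi_gact_congr hphi (sp4_Hmx hS) (fun r => Sp4_expm_Hmx r hS SS) hv (Sp4_a_st s t)).
by rewrite (phi_gact_congr hphi (sp4_Kmx hS) (fun r => Sp4_expm_Kmx r hS SS) hv (Sp4_a_st s t)).
Qed.

Variables (d : nat) (b : int) (iota : {linear binform R d -> V}).
Hypothesis iotaK : forall k p, maxK k -> iota (tau b (K_to_U2 k) p) = kact k (iota p).
Variable Phi : 'M[R]_4 -> {scalar binform R d}.
Hypothesis hPhi : forall g v, Sp4 g -> Phi g v = phi (iota v) g.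

Lemma phi_lieK X g k z : Sp4 g -> lieK X -> X *m X = - 1%:M ->
  is_deriveC (fun t => Phi g (tau b (K_to_U2 (expm (t *: X))) (ub R d k))) 0 z ->
  phi (gact X (iota (ub R d k))) g = z.
Proof.
move=> hg hX XX D; have /andP[hX1 _] := hX; apply: (phi_gactE hphi hX1 hg).
apply: is_deriveC_ext D => t; have hk := maxK_rotation t XX hX.
rewrite (hPhi _ hg) (iotaK _ hk); case: hphi => _ _ _ H.
by rewrite (H _ _ _ hk hg).
Qed.

Section FixedIndex.
Variables (k : nat).
Hypothesis kd : (k <= d)%N.
Variable g : 'M[R]_4.
Hypothesis hg : Sp4 g.

Lemma phi_Kid : phi (gact (Kmx (s_id R)) (iota (ub R d k))) g =
  I * (2 * b%:~R + d%:R) * Phi g (ub R d k).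
Proof.
rewrite -complexiE; apply: phi_lieK (lieK_Kmx (s_idT R)) (Kmx_sqr (s_id_sqr R)) _ => //.
exact: tau_Kid_derive.
Qed.

Lemma phi_Kdiag : phi (gact (Kmx (s_diag R)) (iota (ub R d k))) g =
  I * (k%:R * Phi g (ub R d k.-1) + (d - k)%:R * Phi g (ub R d k.+1)).
Proof.
rewrite -complexiE; apply: phi_lieK (lieK_Kmx (s_diagT R)) (Kmx_sqr (s_diag_sqr R)) _ => //.
exact: tau_Kdiag_derive.
Qed.

Lemma phi_Kanti : phi (gact (Kmx (s_anti R)) (iota (ub R d k))) g =
  - (k%:R * Phi g (ub R d k.-1)) + (d - k)%:R * Phi g (ub R d k.+1).
Proof.
apply: phi_lieK (lieK_Kmx (s_antiT R)) (Kmx_sqr (s_anti_sqr R)) _ => //.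
exact: tau_Kanti_derive.
Qed.

Lemma phi_rot : phi (gact (rotmx R) (iota (ub R d k))) g =
  - (I * (k%:R - (d - k)%:R) * Phi g (ub R d k)).
Proof.
rewrite -complexiE; apply: phi_lieK (lieK_rotmx R) (rotmx_sqr R) _ => //.
exact: tau_rotmx_derive.
Qed.

End FixedIndex.

Variables (s t : R).
Local Notation F k := (Phi (a_st s t) (ub R d k)).
Local Notation eta := ((2 * pi * c0 * expR (2 * t))%:C).
Local Notation BP S k := (phi (actC act (PP (cmx S)) (iota (ub R d k))) (a_st s t)).
Local Notation BM S k := (phi (actC act (PM (cmx S)) (iota (ub R d k))) (a_st s t)).
Definition dsF k : C := phi (gact (Hmx (s_id R)) (iota (ub R d k))) (a_st s t).
Definition dtF k : C := phi (gact (Hmx (s_diag R)) (iota (ub R d k))) (a_st s t).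

Section Values.
Variable k : nat.
Hypothesis kd : (k <= d)%N.

Lemma BP_id : BP (s_id R) k = dsF k + (2 * b%:~R + d%:R) * F k.
Proof.
rewrite /dsF /dtF phi_PP -/(s_id R) phi_Kid ?Sp4_a_st //; ring: (iE R).
Qed.
Lemma BM_id : BM (s_id R) k = dsF k - (2 * b%:~R + d%:R) * F k.
Proof.
rewrite /dsF /dtF phi_PM -/(s_id R) phi_Kid ?Sp4_a_st //; ring: (iE R).
Qed.
Lemma BP_diag : BP (s_diag R) k = dtF k + (k%:R * F k.-1 + (d - k)%:R * F k.+1).
Proof.
rewrite /dsF /dtF phi_PP -/(s_diag R) phi_Kdiag ?Sp4_a_st //; ring: (iE R).
Qed.
Lemma BM_diag : BM (s_diag R) k = dtF k - (k%:R * F k.-1 + (d - k)%:R * F k.+1).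
Proof.
rewrite /dsF /dtF phi_PM -/(s_diag R) phi_Kdiag ?Sp4_a_st //; ring: (iE R).
Qed.
Lemma BP_anti : BP (s_anti R) k = I * (2 * eta * F k - (k%:R - (d - k)%:R) * F k
  + (k%:R * F k.-1 - (d - k)%:R * F k.+1)).
Proof.
rewrite /dsF /dtF phi_PP -/(s_anti R) phi_Kanti ?Sp4_a_st // (phi_Hanti hphi hpsi) phi_rot ?Sp4_a_st //.
rewrite -hPhi ?Sp4_a_st //; ring.
Qed.
Lemma BM_anti : BM (s_anti R) k = I * (2 * eta * F k - (k%:R - (d - k)%:R) * F k
  - (k%:R * F k.-1 - (d - k)%:R * F k.+1)).
Proof.
rewrite /dsF /dtF phi_PM -/(s_anti R) phi_Kanti ?Sp4_a_st // (phi_Hanti hphi hpsi) phi_rot ?Sp4_a_st //.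
rewrite -hPhi ?Sp4_a_st //; ring.
Qed.

End Values.
End SchmidEquations.

(** * Products of quadratics with u_k in the basis u_k *)

Section FormExpansions.
Variable R : realType.
Local Notation C := R[i].
Local Notation I := ('i%R : C).
Local Notation poly2 := (mpoly.mpoly 2 C).

Lemma xvar0_pq : xvar R 0 = (2^-1 : C) *: (pvar R + qvar R).
Proof.
have h (p : poly2) : p + p = (2 : C) *: p by rewrite scaler_nat mulr2n.
rewrite /pvar /qvar addrACA subrr addr0 h scalerA.
by rewrite mulVf ?scale1r // pnatr_eq0.
Qed.

Lemma xvar1_pq : xvar R 1 = (- (I / 2) : C) *: (pvar R - qvar R).
Proof.
have h (p : poly2) : p + p = (2 : C) *: p by rewrite scaler_nat mulr2n.
rewrite /pvar /qvar opprD opprK addrACA subrr add0r h !scalerA.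
have -> : - (I / 2) * 2 * 'i%C = 1; last by rewrite scale1r.
rewrite ?complexiE; have := iE R; rewrite ?complexiE => hI.
by transitivity (- (I * I)); [field | rewrite hI opprK].
Qed.

Lemma scaled_quadratic (A : comPzRingType) (f : {rmorphism C -> A}) (p q m : A) (x y : C) :
  (f x * (p + q)) * (f y * (p - q)) * m =
    f (x * y) * (p ^+ 2 * m) + (f 0 * (p * q * m) + f (- (x * y)) * (q ^+ 2 * m)) /\
  (f x * (p + q)) ^+ 2 * m =
    f (x ^+ 2) * (p ^+ 2 * m) + (f (2 * x ^+ 2) * (p * q * m) + f (x ^+ 2) * (q ^+ 2 * m)) /\
  (f y * (p - q)) ^+ 2 * m =
    f (y ^+ 2) * (p ^+ 2 * m) + (f (- 2 * y ^+ 2) * (p * q * m) + f (y ^+ 2) * (q ^+ 2 * m)).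
Proof. by split; [|split]; ring. Qed.

(** A quadratic in p and q times the form p^k q^(e-k) meets exactly these three basis vectors of
    degree e + 2. *)
Definition comb3 e k (c1 c2 c3 : C) : binform R e.+2 :=
  c1 *: ub R e.+2 k.+2 + (c2 *: ub R e.+2 k.+1 + c3 *: ub R e.+2 k).

Lemma val_comb3 e k c1 c2 c3 : (k <= e)%N ->
  let m := pvar R ^+ k * qvar R ^+ (e - k) in
  val (comb3 e k c1 c2 c3) = c1 *: (pvar R ^+ 2 * m) +
    (c2 *: (pvar R * qvar R * m) + c3 *: (qvar R ^+ 2 * m)).
Proof.
move=> ke m; have -> : val (comb3 e k c1 c2 c3) = c1 *: val (ub R e.+2 k.+2) +
   (c2 *: val (ub R e.+2 k.+1) + c3 *: val (ub R e.+2 k)) by [].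
rewrite !val_ub; try lia.
rewrite !subSS (_ : e.+1 - k = (e - k).+1)%N; last by lia.
rewrite (_ : e.+2 - k = (e - k).+2)%N; last by lia.
have -> : pvar R ^+ 2 * m = pvar R ^+ k.+2 * qvar R ^+ (e - k).
  by rewrite /m mulrA -exprD add2n.
have -> : pvar R * qvar R * m = pvar R ^+ k.+1 * qvar R ^+ (e - k).+1.
  by rewrite /m mulrACA -!exprS.
have -> : qvar R ^+ 2 * m = pvar R ^+ k * qvar R ^+ (e - k).+2.
  by rewrite /m mulrCA -exprD add2n.
exact: erefl.
Qed.

Lemma quadratic_uform (m : poly2) :
  [/\ xvar R 0 ^+ 2 * m = (4^-1 : C) *: (pvar R ^+ 2 * m) +
        ((2^-1 : C) *: (pvar R * qvar R * m) + (4^-1 : C) *: (qvar R ^+ 2 * m)),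
      xvar R 0 * xvar R 1 * m = (- (I / 4)) *: (pvar R ^+ 2 * m) +
        ((0 : C) *: (pvar R * qvar R * m) + (I / 4) *: (qvar R ^+ 2 * m)) &
      xvar R 1 ^+ 2 * m = (- 4^-1 : C) *: (pvar R ^+ 2 * m) +
        ((2^-1 : C) *: (pvar R * qvar R * m) + (- 4^-1 : C) *: (qvar R ^+ 2 * m))].
Proof.
have h := iE R.
have [E1 [E2 E3]] := scaled_quadratic (@mpoly.mpolyC 2 C) (pvar R) (qvar R)
   m 2^-1 (- (I / 2)).
rewrite !mpoly.mul_mpolyC -xvar0_pq -xvar1_pq in E1 E2 E3.
have y2 : (- (I / 2)) ^+ 2 = - 4^-1.
  by transitivity ((I * I) / 4); [field | rewrite h mulN1r].
have x2 : 2^-1 ^+ 2 = 4^-1 :> C by field.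
have xy : 2^-1 * (- (I / 2)) = - (I / 4) by field.
have z2 : -2 * - 4^-1 = 2^-1 :> C by field.
have w2 : 2 * 4^-1 = 2^-1 :> C by field.
rewrite y2 z2 in E3; rewrite x2 w2 in E2; rewrite xy opprK in E1.
by split; [exact: E2 | exact: E1 | exact: E3].
Qed.

Lemma scaled_opp3 (a b c : C) (x y z : poly2) :
  - (a *: x + (b *: y + c *: z)) = (- a) *: x + ((- b) *: y + (- c) *: z).
Proof. by rewrite !opprD !scaleNr. Qed.

Lemma mulform_quad e k j : (k <= e)%N ->
  mulform (quad_homog R j) (ub R e k) =
  nth (comb3 e k 4^-1 2^-1 4^-1)
   [:: comb3 e k 4^-1 2^-1 4^-1; comb3 e k (- (I / 4)) 0 (I / 4);
       comb3 e k (- 4^-1) 2^-1 (- 4^-1)] j.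
Proof.
move=> ke; have [E1 E2 E3] := quadratic_uform (pvar R ^+ k * qvar R ^+ (e - k)).
apply: val_inj; rewrite val_mulform (val_ub _ ke).
elim/ord3_ind: j; rewrite /quad [nth _ _ _]/=.
- exact: (etrans E1 (esym (val_comb3 4^-1 2^-1 4^-1 ke))).
- exact: (etrans E2 (esym (val_comb3 (- (I / 4)) 0 (I / 4) ke))).
- exact: (etrans E3 (esym (val_comb3 (- 4^-1) 2^-1 (- 4^-1) ke))).
Qed.

Lemma mulform_quad_dual e k j : (k <= e)%N ->
  mulform (quad_dual_homog R j) (ub R e k) =
  nth (comb3 e k 4^-1 2^-1 4^-1)
   [:: comb3 e k (- 4^-1) 2^-1 (- 4^-1); comb3 e k (I / 4) 0 (- (I / 4));
       comb3 e k 4^-1 2^-1 4^-1] j.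
Proof.
move=> ke; have [E1 E2 E3] := quadratic_uform (pvar R ^+ k * qvar R ^+ (e - k)).
apply: val_inj; rewrite val_mulform (val_ub _ ke).
elim/ord3_ind: j; rewrite /quad_dual [nth _ _ _]/=.
- exact: (etrans E3 (esym (val_comb3 (- 4^-1) 2^-1 (- 4^-1) ke))).
- have E : - (xvar R 0 * xvar R 1) * (pvar R ^+ k * qvar R ^+ (e - k)) = _ :=
    etrans (mulNr _ _) (congr1 -%R E2).
  by rewrite E (scaled_opp3 (- (I / 4)) 0) oppr0 opprK;
    exact: (esym (val_comb3 (I / 4) 0 (- (I / 4)) ke)).
- exact: (etrans E1 (esym (val_comb3 4^-1 2^-1 4^-1 ke))).
Qed.

End FormExpansions.

Section PhiSchmid.
Variables (R : realType) (V : gkmodule R) (c0 : R) (phi : V -> 'M[R]_4 -> R[i]).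
Hypothesis hphi : gk_hom phi.
Hypothesis hpsi : forall v, psi_equivariant c0 (phi v).
Local Notation C := R[i].
Local Notation I := ('i%R : C).
Local Notation act := (@gact _ V).

Lemma PP_comb (x : C) (S T : 'M[C]_2) : PP (x *: S + T) = x *: PP S + PP T.
Proof. by rewrite /PP b4Z b4D !scalerDr !scalerA opprD scalerN (mulrC _ x). Qed.
Lemma PM_comb (x : C) (S T : 'M[C]_2) : PM (x *: S + T) = x *: PM S + PM T.
Proof. by rewrite /PM b4Z b4D !scalerDr !scalerA opprD scalerN (mulrC _ x). Qed.

(** The trailing zeros present every matrix as an iterated x *: S + T, the shape in which the
    linearity of [PP] and [PM] is stated. *)
Lemma sym2E : [/\ sym2 R 0 = 2^-1 *: cmx (s_id R) + (2^-1 *: cmx (s_diag R) + 0),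
    sym2 R 1 = cmx (s_anti R) &
    sym2 R 2 = 2^-1 *: cmx (s_id R) + ((- 2^-1) *: cmx (s_diag R) + 0)].
Proof.
rewrite !cmx_mx2 !(mx2_0, mx2Z, mx2D) /sym2 /= !rmorphN !rmorph1 !rmorph0.
by split; congr mx2; field.
Qed.

Lemma sp4C_cmxPP (S : 'M[R]_2) : S^T = S -> sp4C (PP (cmx S)).
Proof. by move=> hS; apply: sp4C_PP; rewrite /cmx matrix.map_trmx hS. Qed.
Lemma sp4C_cmxPM (S : 'M[R]_2) : S^T = S -> sp4C (PM (cmx S)).
Proof. by move=> hS; apply: sp4C_PM; rewrite /cmx matrix.map_trmx hS. Qed.

Lemma PP0 : PP (0 : 'M[C]_2) = 0.
Proof. by rewrite /PP scaler0 oppr0 -b4_0. Qed.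
Lemma PM0 : PM (0 : 'M[C]_2) = 0.
Proof. by rewrite /PM scaler0 oppr0 -b4_0. Qed.

Lemma sp4C_0 : sp4C (0 : 'M[C]_4).
Proof. by rewrite -(cmx0 R); apply/sp4C_cmx/sp4_0. Qed.

Lemma actC_sym2 (P : 'M[C]_2 -> 'M[C]_4) (v : 'I_3 -> V) g : Sp4 g ->
  (forall x S T, P (x *: S + T) = x *: P S + P T) -> P 0 = 0 ->
  (forall S : 'M[R]_2, S^T = S -> sp4C (P (cmx S))) ->
  phi (\sum_j actC act (P (sym2 R j)) (v j)) g =
    2^-1 * (phi (actC act (P (cmx (s_id R))) (v 0)) g + phi (actC act (P (cmx (s_id R))) (v 2)) g)
  + 2^-1 * (phi (actC act (P (cmx (s_diag R))) (v 0)) g - phi (actC act (P (cmx (s_diag R))) (v 2)) g)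
  + phi (actC act (P (cmx (s_anti R))) (v 1)) g.
Proof.
move=> hg hP hP0 hS; have [e0 e1 e2] := sym2E.
have h1 := hS _ (s_idT R); have h2 := hS _ (s_diagT R).
have comb x y w : phi (actC act (P (x *: cmx (s_id R) + (y *: cmx (s_diag R) + 0))) w) g =
    x * phi (actC act (P (cmx (s_id R))) w) g + y * phi (actC act (P (cmx (s_diag R))) w) g.
  rewrite !hP hP0 (actC_comb _ _ h1 (sp4C_comb _ h2 sp4C_0)) (actC_comb _ _ h2 sp4C_0).
  by rewrite actC0 addr0 (phiP hphi _ _ _ hg) (phiZ hphi _ _ hg).
rewrite (phi_sum hphi _ hg) sum3 e0 e1 e2 !comb.
ring.
Qed.

Lemma cmx_rot_anti (x y : C) : x *: cmx (rotmx R) + (y *: cmx (Kmx (s_anti R)) + 0) =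
  b4 (mx2 0 (- x) x 0) (mx2 0 y y 0) (mx2 0 (- y) (- y) 0) (mx2 0 (- x) x 0).
Proof.
rewrite addr0 /rotmx /Kmx !cmx_b4 cmx0 cmxN !cmx_mx2 mx2_0 !b4Z b4D.
rewrite !(mx2Z, mx2D, mx2N) !rmorphN !rmorph1 !rmorph0.
by congr b4; congr mx2; ring.
Qed.

Lemma cmx_Kdiag (y : C) : y *: cmx (Kmx (s_diag R)) + 0 =
  b4 (mx2 0 0 0 0) (mx2 y 0 0 (- y)) (mx2 (- y) 0 0 y) (mx2 0 0 0 0).
Proof.
rewrite addr0 /Kmx !cmx_b4 cmx0 cmxN !cmx_mx2 mx2_0 !b4Z.
rewrite !(mx2Z, mx2N) !rmorphN !rmorph1 !rmorph0.
by congr b4; congr mx2; ring.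
Qed.

Lemma KC_sl2E : [/\ KC (sl2_mx R 0) = 2^-1 *: cmx (rotmx R) + ((- (I / 2)) *: cmx (Kmx (s_anti R)) + 0),
    KC (sl2_mx R 1) = (I / 2) *: cmx (Kmx (s_diag R)) + 0 &
    KC (sl2_mx R 2) = 2^-1 *: cmx (rotmx R) + ((I / 2) *: cmx (Kmx (s_anti R)) + 0)].
Proof.
rewrite !cmx_rot_anti cmx_Kdiag /KC /sl2_mx /= !mx2T !(mx2N, mx2D, mx2Z).
by split; congr b4; congr mx2; field.
Qed.

Lemma KC_sl2E' :
  [/\ KC (sl2_mx' R 0) = 2^-1 *: cmx (rotmx R) + ((I / 2) *: cmx (Kmx (s_anti R)) + 0),
    KC (sl2_mx' R 1) = (- (I / 2)) *: cmx (Kmx (s_diag R)) + 0 &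
    KC (sl2_mx' R 2) = 2^-1 *: cmx (rotmx R) + ((- (I / 2)) *: cmx (Kmx (s_anti R)) + 0)].
Proof.
rewrite !cmx_rot_anti cmx_Kdiag /KC /sl2_mx' /= !mx2T !(mx2N, mx2D, mx2Z).
by split; congr b4; congr mx2; field.
Qed.

Section Equations.
Variables (a : int * int) (b : int) (e : nat).
Hypothesis hmin : is_minimal_K_type V a.
Variable iota : {linear binform R e.+2 -> V}.
Hypothesis iotaK : forall k p, maxK k -> iota (tau b (K_to_U2 k) p) = kact k (iota p).
Variable Phi : 'M[R]_4 -> {scalar binform R e.+2}.
Hypothesis hPhi : forall g v, Sp4 g -> Phi g v = phi (iota v) g.
Variables (s t : R).
Local Notation d := e.+2.
Local Notation F k := (Phi (a_st s t) (ub R d k)).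
Local Notation eta := ((2 * pi * c0 * expR (2 * t))%:C).
Local Notation BP S k := (phi (actC act (PP (cmx S)) (iota (ub R d k))) (a_st s t)).
Local Notation BM S k := (phi (actC act (PM (cmx S)) (iota (ub R d k))) (a_st s t)).
Local Notation DS k := (dsF phi iota s t k).
Local Notation DT k := (dtF phi iota s t k).
Let hg := Sp4_a_st s t.

Lemma phi_actC_comb3 Z k c1 c2 c3 : sp4C Z ->
  phi (actC act Z (iota (comb3 e k c1 c2 c3))) (a_st s t) =
  c1 * phi (actC act Z (iota (ub R d k.+2))) (a_st s t) +
  (c2 * phi (actC act Z (iota (ub R d k.+1))) (a_st s t) +
   c3 * phi (actC act Z (iota (ub R d k))) (a_st s t)).
Proof.
move=> hZ; rewrite /comb3 !linearP iotaZ !(actCP _ _ _ hZ) (actCZ _ _ hZ).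
by rewrite !(phiP hphi _ _ _ hg) (phiZ hphi _ _ hg).
Qed.

Lemma schmid_plus2_phi k : (k <= e)%N ->
  vogan_norm (b + 2 + e%:Z, b + 2) < vogan_norm a ->
  2 * BP (s_id R) k.+1 - BP (s_diag R) k.+2 - BP (s_diag R) k
  + I * (BP (s_anti R) k.+2 - BP (s_anti R) k) = 0.
Proof.
move=> ke hn; have := schmid_plus2 hmin iotaK hn (ub R e k).
move=> /(congr1 (fun v => phi v (a_st s t))).
rewrite (actC_sym2 _ hg PP_comb PP0 sp4C_cmxPP) (phi0 hphi hg).
rewrite !(@mulform_quad_dual _ _ _ _ ke) [nth _ _ 0]/= [nth _ _ 1]/= [nth _ _ 2]/=.
have h1 := sp4C_cmxPP (s_idT R); have h2 := sp4C_cmxPP (s_diagT R).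
have h3 := sp4C_cmxPP (s_antiT R).
move: (PP (cmx (s_id R))) (PP (cmx (s_diag R))) (PP (cmx (s_anti R))) h1 h2 h3 =>
  Z1 Z2 Z3 h1 h2 h3.
rewrite !(phi_actC_comb3 _ _ _ _ h1) !(phi_actC_comb3 _ _ _ _ h2) !(phi_actC_comb3 _ _ _ _ h3).
by move=> H; rewrite -[RHS](mulr0 4) -H; field.
Qed.

Lemma schmid_minus2_phi k : (k <= e)%N ->
  vogan_norm (b + e%:Z, b) < vogan_norm a ->
  2 * BM (s_id R) k.+1 + BM (s_diag R) k.+2 + BM (s_diag R) k
  - I * (BM (s_anti R) k.+2 - BM (s_anti R) k) = 0.
Proof.
move=> ke hn; have := schmid_minus2 hmin iotaK hn (ub R e k).
move=> /(congr1 (fun v => phi v (a_st s t))).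
rewrite (actC_sym2 _ hg PM_comb PM0 sp4C_cmxPM) (phi0 hphi hg).
rewrite !(@mulform_quad _ _ _ _ ke) [nth _ _ 0]/= [nth _ _ 1]/= [nth _ _ 2]/=.
have h1 := sp4C_cmxPM (s_idT R); have h2 := sp4C_cmxPM (s_diagT R).
have h3 := sp4C_cmxPM (s_antiT R).
move: (PM (cmx (s_id R))) (PM (cmx (s_diag R))) (PM (cmx (s_anti R))) h1 h2 h3 =>
  Z1 Z2 Z3 h1 h2 h3.
rewrite !(phi_actC_comb3 _ _ _ _ h1) !(phi_actC_comb3 _ _ _ _ h2) !(phi_actC_comb3 _ _ _ _ h3).
by move=> H; rewrite -[RHS](mulr0 4) -H; field.
Qed.

End Equations.

End PhiSchmid.

Section PhiSchmidSameDegree.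
Variables (R : realType) (V : gkmodule R) (c0 : R) (phi : V -> 'M[R]_4 -> R[i]).
Hypothesis hphi : gk_hom phi.
Hypothesis hpsi : forall v, psi_equivariant c0 (phi v).
Local Notation C := R[i].
Local Notation I := ('i%R : C).
Local Notation act := (@gact _ V).
Variables (a : int * int) (b : int) (d : nat).
Hypothesis hmin : is_minimal_K_type V a.
Variable iota : {linear binform R d -> V}.
Hypothesis iotaK : forall k p, maxK k -> iota (tau b (K_to_U2 k) p) = kact k (iota p).
Variable Phi : 'M[R]_4 -> {scalar binform R d}.
Hypothesis hPhi : forall g v, Sp4 g -> Phi g v = phi (iota v) g.
Variables (s t : R).
Local Notation BP S k := (phi (actC act (PP (cmx S)) (iota (ub R d k))) (a_st s t)).
Local Notation BM S k := (phi (actC act (PM (cmx S)) (iota (ub R d k))) (a_st s t)).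
Let hg := Sp4_a_st s t.

Lemma gact_Kmx_on k S (x y : C) : (k <= d)%N ->
  (forall g, Sp4 g -> phi (gact S (iota (ub R d k))) g =
     x * Phi g (ub R d k.-1) + y * Phi g (ub R d k.+1)) ->
  forall g, Sp4 g -> phi (gact S (iota (ub R d k))) g =
    phi (iota (x *: ub R d k.-1 + y *: ub R d k.+1)) g.
Proof.
move=> kd H g hg'; rewrite H // linearP iotaZ (phiP hphi _ _ _ hg') (phiZ hphi _ _ hg').
by rewrite -!hPhi.
Qed.

Lemma phi_rot_on k : (k <= d)%N -> forall g, Sp4 g ->
  phi (gact (rotmx R) (iota (ub R d k))) g =
  phi (iota ((- (I * (k%:R - (d - k)%:R))) *: ub R d k)) g.
Proof.
move=> kd g hg'; rewrite (phi_rot hphi iotaK hPhi kd hg') iotaZ (phiZ hphi _ _ hg').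
by rewrite -hPhi // mulNr.
Qed.

Lemma phi_Kdiag_on k : (k <= d)%N -> forall g, Sp4 g ->
  phi (gact (Kmx (s_diag R)) (iota (ub R d k))) g =
  phi (iota ((I * k%:R) *: ub R d k.-1 + (I * (d - k)%:R) *: ub R d k.+1)) g.
Proof.
move=> kd; apply: gact_Kmx_on => // g hg'.
by rewrite (phi_Kdiag hphi iotaK hPhi kd hg') mulrDr !mulrA.
Qed.

Lemma phi_Kanti_on k : (k <= d)%N -> forall g, Sp4 g ->
  phi (gact (Kmx (s_anti R)) (iota (ub R d k))) g =
  phi (iota ((- k%:R) *: ub R d k.-1 + (d - k)%:R *: ub R d k.+1)) g.
Proof.
move=> kd; apply: gact_Kmx_on => // g hg'.
by rewrite (phi_Kanti hphi iotaK hPhi kd hg') mulNr.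
Qed.

Lemma phi_actC_comb2 Z x y p q : sp4C Z ->
  phi (actC act Z (iota (x *: p + y *: q))) (a_st s t) =
  x * phi (actC act Z (iota p)) (a_st s t) + y * phi (actC act Z (iota q)) (a_st s t).
Proof.
move=> hZ; rewrite linearP iotaZ (actCP _ _ _ hZ) (actCZ _ _ hZ).
by rewrite (phiP hphi _ _ _ hg) (phiZ hphi _ _ hg).
Qed.

Lemma phi_actC_scale Z x p : sp4C Z ->
  phi (actC act Z (iota (x *: p))) (a_st s t) =
  x * phi (actC act Z (iota p)) (a_st s t).
Proof. by move=> hZ; rewrite iotaZ (actCZ _ _ hZ) (phiZ hphi _ _ hg). Qed.

Lemma phi_actC_pair Z X Y (x y : C) v : sp4C Z -> sp4 X -> sp4 Y ->
  phi (actC act Z (actC act (x *: cmx X + (y *: cmx Y + 0)) v)) (a_st s t) =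
  x * phi (actC act Z (gact X v)) (a_st s t) + y * phi (actC act Z (gact Y v)) (a_st s t).
Proof.
move=> hZ /sp4C_cmx hX /sp4C_cmx hY.
rewrite addr0 -[y *: _]addr0 (actC_comb _ _ hX (sp4C_comb _ hY (sp4C_0 R))).
rewrite (actC_comb _ _ hY (sp4C_0 R)) actC0 addr0 !actC_cmx.
by rewrite (actCP _ _ _ hZ) (actCZ _ _ hZ) (phiP hphi _ _ _ hg) (phiZ hphi _ _ hg).
Qed.

Lemma phi_actC_single Z X (x : C) v : sp4C Z -> sp4 X ->
  phi (actC act Z (actC act (x *: cmx X + 0) v)) (a_st s t) =
  x * phi (actC act Z (gact X v)) (a_st s t).
Proof.
move=> hZ /sp4C_cmx hX.
rewrite (actC_comb _ _ hX (sp4C_0 R)) actC0 addr0 actC_cmx (actCZ _ _ hZ).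
by rewrite (phiZ hphi _ _ hg).
Qed.

(** One computation for both signs: x is i/2 for p_+ and -i/2 for p_-. *)
Lemma sl2_contraction (P : 'M[C]_2 -> 'M[C]_4) (X : 'I_3 -> 'M[C]_2) (x : C) (v : V) :
  (forall x S T, P (x *: S + T) = x *: P S + P T) -> P 0 = 0 ->
  (forall S : 'M[R]_2, S^T = S -> sp4C (P (cmx S))) ->
  KC (X 0) = 2^-1 *: cmx (rotmx R) + ((- x) *: cmx (Kmx (s_anti R)) + 0) ->
  KC (X 1) = x *: cmx (Kmx (s_diag R)) + 0 ->
  KC (X 2) = 2^-1 *: cmx (rotmx R) + (x *: cmx (Kmx (s_anti R)) + 0) ->
  phi (\sum_j actC act (P (sym2 R j)) (actC act (KC (X j)) v)) (a_st s t) =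
    2^-1 * phi (actC act (P (cmx (s_id R))) (gact (rotmx R) v)) (a_st s t)
    - x * phi (actC act (P (cmx (s_diag R))) (gact (Kmx (s_anti R)) v)) (a_st s t)
    + x * phi (actC act (P (cmx (s_anti R))) (gact (Kmx (s_diag R)) v)) (a_st s t).
Proof.
move=> hP hP0 hS e0 e1 e2.
apply: etrans (actC_sym2 hphi (fun j => actC act (KC (X j)) v) hg hP hP0 hS) _.
have h1 := hS _ (s_idT R); have h2 := hS _ (s_diagT R); have h3 := hS _ (s_antiT R).
have E0 Z : sp4C Z -> phi (actC act Z (actC act (KC (X 0)) v)) (a_st s t) =
    2^-1 * phi (actC act Z (gact (rotmx R) v)) (a_st s t)
    + - x * phi (actC act Z (gact (Kmx (s_anti R)) v)) (a_st s t).
  by move=> hZ; rewrite e0; apply: phi_actC_pair;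
    [exact: hZ | exact: sp4_rotmx | exact: (sp4_Kmx (s_antiT R))].
have E2 Z : sp4C Z -> phi (actC act Z (actC act (KC (X 2)) v)) (a_st s t) =
    2^-1 * phi (actC act Z (gact (rotmx R) v)) (a_st s t)
    + x * phi (actC act Z (gact (Kmx (s_anti R)) v)) (a_st s t).
  by move=> hZ; rewrite e2; apply: phi_actC_pair;
    [exact: hZ | exact: sp4_rotmx | exact: (sp4_Kmx (s_antiT R))].
have E1 Z : sp4C Z -> phi (actC act Z (actC act (KC (X 1)) v)) (a_st s t) =
    x * phi (actC act Z (gact (Kmx (s_diag R)) v)) (a_st s t).
  by move=> hZ; rewrite e1; apply: phi_actC_single;
    [exact: hZ | exact: (sp4_Kmx (s_diagT R))].
have comb (u0 u2 w0 w2 z1 u0' u2' w0' w2' z1' : C) : u0 = u0' -> u2 = u2' ->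
    w0 = w0' -> w2 = w2' -> z1 = z1' -> 2^-1 * (u0 + u2) + 2^-1 * (w0 - w2) + z1 =
    2^-1 * (u0' + u2') + 2^-1 * (w0' - w2') + z1' by move=> -> -> -> -> ->.
apply: etrans (comb _ _ _ _ _ _ _ _ _ _ (E0 _ h1) (E2 _ h1) (E0 _ h2) (E2 _ h2) (E1 _ h3)) _.
move: (phi _ _) => x1; move: (phi _ _) => x2; move: (phi _ _) => x3.
by field.
Qed.

Lemma schmid_plus0_phi k : (k <= d)%N ->
  vogan_norm (b + 1 + d%:Z, b + 1) < vogan_norm a ->
  - (k%:R - (d - k)%:R) * BP (s_id R) k
  - (- (k%:R * BP (s_diag R) k.-1) + (d - k)%:R * BP (s_diag R) k.+1)
  + I * (k%:R * BP (s_anti R) k.-1 + (d - k)%:R * BP (s_anti R) k.+1) = 0.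
Proof.
move=> kd hn; have := schmid_plus0 hmin iotaK hn (ub R d k).
move=> /(congr1 (fun v => phi v (a_st s t))).
have [e0 e1 e2] := KC_sl2E R.
rewrite (sl2_contraction _ (@PP_comb R) (PP0 R) (@sp4C_cmxPP R) e0 e1 e2) (phi0 hphi hg).
have h1 := sp4C_cmxPP (s_idT R); have h2 := sp4C_cmxPP (s_diagT R).
have h3 := sp4C_cmxPP (s_antiT R).
(* The inner elements of k are now traded for combinations of neighbouring u_k under iota, after
   which only one action remains. *)
rewrite (phi_PP_congr hphi hpsi s t (s_id_sqr R) (phi_rot_on kd)) (phi_actC_scale _ _ h1).
rewrite (phi_PP_congr hphi hpsi s t (s_diag_sqr R) (phi_Kanti_on kd)) (phi_actC_comb2 _ _ _ _ h2).
rewrite (phi_PP_congr hphi hpsi s t (s_anti_sqr R) (phi_Kdiag_on kd)) (phi_actC_comb2 _ _ _ _ h3).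
set x1 := phi _ _; set x2 := phi _ _; set x3 := phi _ _.
set x4 := phi _ _; set x5 := phi _ _ => H.
have hI : I != 0 by apply/eqP => h0; have := iE R; rewrite -[X in X * _]/I h0 mul0r => /eqP;
  rewrite eq_sym oppr_eq0 oner_eq0.
by apply: (mulfI hI); rewrite mulr0 -[RHS](mulr0 2) -H; field.
Qed.

Lemma schmid_minus0_phi k : (k <= d)%N ->
  vogan_norm (b - 1 + d%:Z, b - 1) < vogan_norm a ->
  - (k%:R - (d - k)%:R) * BM (s_id R) k
  + (- (k%:R * BM (s_diag R) k.-1) + (d - k)%:R * BM (s_diag R) k.+1)
  - I * (k%:R * BM (s_anti R) k.-1 + (d - k)%:R * BM (s_anti R) k.+1) = 0.
Proof.
move=> kd hn; have := schmid_minus0 hmin iotaK hn (ub R d k).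
move=> /(congr1 (fun v => phi v (a_st s t))).
(* Writes the coefficient i/2 as the opposite of x = -(i/2), as [sl2_contraction] requires. *)
have [e0 e1 e2] := KC_sl2E' R; rewrite -[X in X *: cmx (Kmx (s_anti R))]opprK in e0.
rewrite (sl2_contraction _ (@PM_comb R) (PM0 R) (@sp4C_cmxPM R) e0 e1 e2) (phi0 hphi hg).
have h1 := sp4C_cmxPM (s_idT R); have h2 := sp4C_cmxPM (s_diagT R).
have h3 := sp4C_cmxPM (s_antiT R).
rewrite (phi_PM_congr hphi hpsi s t (s_id_sqr R) (phi_rot_on kd)) (phi_actC_scale _ _ h1).
rewrite (phi_PM_congr hphi hpsi s t (s_diag_sqr R) (phi_Kanti_on kd)) (phi_actC_comb2 _ _ _ _ h2).
rewrite (phi_PM_congr hphi hpsi s t (s_anti_sqr R) (phi_Kdiag_on kd)) (phi_actC_comb2 _ _ _ _ h3).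
set x1 := phi _ _; set x2 := phi _ _; set x3 := phi _ _.
set x4 := phi _ _; set x5 := phi _ _ => H.
have hI : I != 0 by apply/eqP => h0; have := iE R; rewrite -[X in X * _]/I h0 mul0r => /eqP;
  rewrite eq_sym oppr_eq0 oner_eq0.
by apply: (mulfI hI); rewrite mulr0 -[RHS](mulr0 2) -H; field.
Qed.

End PhiSchmidSameDegree.

(** * The difference-differential equations for the components *)

Section ComplexSystem.
Variables (R : realType) (V : gkmodule R) (c0 : R) (phi : V -> 'M[R]_4 -> R[i]).
Hypothesis hphi : gk_hom phi.
Hypothesis hpsi : forall v, psi_equivariant c0 (phi v).
Local Notation C := R[i].
Local Notation I := ('i%R : C).
Local Notation act := (@gact _ V).
Variables (a : int * int) (b : int) (e : nat).
Local Notation d := e.+2.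
Hypothesis hmin : is_minimal_K_type V a.
Variable iota : {linear binform R d -> V}.
Hypothesis iotaK : forall k p, maxK k -> iota (tau b (K_to_U2 k) p) = kact k (iota p).
Variable Phi : 'M[R]_4 -> {scalar binform R d}.
Hypothesis hPhi : forall g v, Sp4 g -> Phi g v = phi (iota v) g.
Variables (s t : R).
Local Notation F k := (Phi (a_st s t) (ub R d k)).
Local Notation eta := ((2 * pi * c0 * expR (2 * t))%:C).
Local Notation DS k := (dsF phi iota s t k).
Local Notation DT k := (dtF phi iota s t k).
Local Notation BP S k := (phi (actC act (PP (cmx S)) (iota (ub R d k))) (a_st s t)).
Local Notation BM S k := (phi (actC act (PM (cmx S)) (iota (ub R d k))) (a_st s t)).
(** The components k+1 and k-1 and their derivatives enter the relations at index k only through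
    these two expressions; k is the index of the relation, not of the component. *)
Definition raising k : C :=
  DT k.+1 + (2 * eta - (2 * k%:R - d%:R) - 2) * F k.+1.
Definition lowering k : C :=
  DT k.-1 + (- (2 * eta) + (2 * k%:R - d%:R) - 2) * F k.-1.

Let BP_id := BP_id hphi hpsi iotaK hPhi s t.
Let BM_id := BM_id hphi hpsi iotaK hPhi s t.
Let BP_diag := BP_diag hphi hpsi iotaK hPhi s t.
Let BM_diag := BM_diag hphi hpsi iotaK hPhi s t.
Let BP_anti := BP_anti hphi hpsi iotaK hPhi s t.
Let BM_anti := BM_anti hphi hpsi iotaK hPhi s t.

Let natS k : (k.+1)%:R = k%:R + 1 :> C. Proof. by rewrite natr1. Qed.

Lemma eq_plus2 k : (0 < k < d)%N -> vogan_norm (b + 2 + e%:Z, b + 2) < vogan_norm a ->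
  2 * DS k + (4 * b%:~R - 4) * F k - raising k - lowering k = 0.
Proof.
case: k => // k /andP[_ ke] hn; have ke' : (k <= e)%N by lia.
have := schmid_plus2_phi hphi hmin iotaK s t ke' hn.
rewrite BP_id ?BP_diag ?BP_anti; try lia.
rewrite /raising /lowering /=.
rewrite !natrB; try lia; rewrite !natS.
by move=> H; rewrite -[RHS]H; ring: (iE R).
Qed.

Lemma eq_minus2 k : (0 < k < d)%N -> vogan_norm (b + e%:Z, b) < vogan_norm a ->
  2 * DS k - (4 * b%:~R + 4 * d%:R + 4) * F k + raising k + lowering k = 0.
Proof.
case: k => // k /andP[_ ke] hn; have ke' : (k <= e)%N by lia.
have := schmid_minus2_phi hphi hmin iotaK s t ke' hn.
rewrite BM_id ?BM_diag ?BM_anti; try lia.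
rewrite /raising /lowering /=.
rewrite !natrB; try lia; rewrite !natS.
by move=> H; rewrite -[RHS]H; ring: (iE R).
Qed.

(** The formulas for [BP] and [BM] hold for indices up to d only; the vanishing factors k and d - k
    dispense with them beyond the ends. *)
Let shift_values (B : nat -> C) (f : nat -> C) k :
  (forall j, (j <= d)%N -> B j = f j) -> (k <= d)%N ->
  k%:R * B k.-1 = k%:R * f k.-1 /\ (d - k)%:R * B k.+1 = (d - k)%:R * f k.+1.
Proof.
move=> H kd; split; first by rewrite H //; lia.
case: (ltnP k d) => kd'; first by rewrite H.
by rewrite (_ : d - k = 0)%N ?mul0r //; lia.
Qed.

Lemma eq_plus0 k : (k <= d)%N -> vogan_norm (b + 1 + d%:Z, b + 1) < vogan_norm a ->
  (2 * k%:R - d%:R) * (- DS k - (2 * b%:~R + d%:R - 2) * F k)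
  + k%:R * lowering k - (d%:R - k%:R) * raising k = 0.
Proof.
move=> kd hn.
have := schmid_plus0_phi hphi hpsi hmin iotaK hPhi s t kd hn.
have [-> ->] := shift_values (fun j jd => BP_diag jd) kd.
have [-> ->] := shift_values (fun j jd => BP_anti jd) kd.
rewrite BP_id // /raising /lowering.
case: k kd => [|k] kd /=.
  rewrite subn0 subn1 /= !natS; move: (F _) => x1; move: (F _) => x2; move: (F _) => x3.
  by move=> H; rewrite -[RHS]H; ring: (iE R).
case: (ltnP k.+1 d) => kd'.
  rewrite !natrB; try lia; rewrite !natS.
  by move=> H; rewrite -[RHS]H; ring: (iE R).
have -> : k = e.+1 by lia.
rewrite subSnn !subnn /= !natS.
by move=> H; rewrite -[RHS]H; ring: (iE R).
Qed.

Lemma eq_minus0 k : (k <= d)%N -> vogan_norm (b - 1 + d%:Z, b - 1) < vogan_norm a ->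
  (2 * k%:R - d%:R) * (- DS k + (2 * b%:~R + d%:R + 2) * F k)
  - k%:R * lowering k + (d%:R - k%:R) * raising k = 0.
Proof.
move=> kd hn.
have := schmid_minus0_phi hphi hpsi hmin iotaK hPhi s t kd hn.
have [-> ->] := shift_values (fun j jd => BM_diag jd) kd.
have [-> ->] := shift_values (fun j jd => BM_anti jd) kd.
rewrite BM_id // /raising /lowering.
case: k kd => [|k] kd /=.
  rewrite subn0 subn1 /= !natS; move: (F _) => x1; move: (F _) => x2; move: (F _) => x3.
  by move=> H; rewrite -[RHS]H; ring: (iE R).
case: (ltnP k.+1 d) => kd'.
  rewrite !natrB; try lia; rewrite !natS.
  by move=> H; rewrite -[RHS]H; ring: (iE R).
have -> : k = e.+1 by lia.
rewrite subSnn !subnn /= !natS.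
by move=> H; rewrite -[RHS]H; ring: (iE R).
Qed.

End ComplexSystem.

(** * Symmetries and solution of the relations as linear algebra *)

Section SchmidRelations.
Variable K : numFieldType.
Implicit Types (u b : K) (f x y : nat -> K).

Definition raise_by u d f y k : K := y k.+1 + (u - (2 * k%:R - d%:R) - 2) * f k.+1.
Definition lower_by u d f y k : K := y k.-1 + (- u + (2 * k%:R - d%:R) - 2) * f k.-1.

Definition schmid_relations u b d f x y : Prop :=
  [/\ forall k, (0 < k < d)%N ->
        2 * x k + (4 * b - 4) * f k - raise_by u d f y k - lower_by u d f y k = 0,
      forall k, (0 < k < d)%N ->
        2 * x k - (4 * b + 4 * d%:R + 4) * f k + raise_by u d f y k + lower_by u d f y k = 0 &
      forall k, (k <= d)%N ->
        (2 * k%:R - d%:R) * (- x k + (2 * b + d%:R + 2) * f k)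
        - k%:R * lower_by u d f y k + (d%:R - k%:R) * raise_by u d f y k = 0].

(** The reflection exchanges [raise_by] and [lower_by] when u changes sign. The first two relations
    are symmetric in them, and the third is multiplied by -1. *)
Lemma schmid_relations_flip u b d f x y : schmid_relations u b d f x y ->
  schmid_relations (- u) b d (fun k => f (d - k)%N) (fun k => x (d - k)%N) (fun k => y (d - k)%N).
Proof.
case=> h1 h2 h3.
have R k : (k < d)%N ->
    raise_by (- u) d (fun k => f (d - k)%N) (fun k => y (d - k)%N) k = lower_by u d f y (d - k).
  move=> kd; rewrite /raise_by /lower_by (_ : (d - k).-1 = d - k.+1)%N; last by lia.
  by rewrite natrB; [congr (_ + _ * _); ring | lia].
have L k : (0 < k <= d)%N ->
    lower_by (- u) d (fun k => f (d - k)%N) (fun k => y (d - k)%N) k = raise_by u d f y (d - k).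
  move=> kd; rewrite /raise_by /lower_by (_ : (d - k).+1 = d - k.-1)%N; last by lia.
  by rewrite natrB; [congr (_ + _ * _); ring | lia].
split=> k kd.
- by rewrite R ?L; [rewrite -[RHS](h1 (d - k)%N); [ring | lia] | lia | lia].
- by rewrite R ?L; [rewrite -[RHS](h2 (d - k)%N); [ring | lia] | lia | lia].
have := h3 (d - k)%N (leq_subr _ _); rewrite natrB //.
(* At k = 0 and at k = d one neighbour term has coefficient 0, exactly where the exchange rule [L]
   or [R] fails for it. *)
case: (posnP k) kd => [-> | k0] kd; [rewrite subn0 | case: (ltngtP k d) kd => // kd _].
- case: (posnP d) => [-> | d0]; first by rewrite !(subrr, mulr0, mul0r, subr0, addr0).
  by rewrite R // subn0 => /(congr1 -%R); rewrite oppr0 => H; rewrite -[RHS]H; ring.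
- by rewrite R // L; [move=> /(congr1 -%R); rewrite oppr0 => H; rewrite -[RHS]H; ring | lia].
- by rewrite L; [rewrite kd subnn => /(congr1 -%R); rewrite oppr0 => H; rewrite -[RHS]H; ring | lia].
Qed.

(* the sign change exchanges the two families of large discrete series *)
Lemma schmid_relations_sign u b d f x y :
  (forall k, (0 < k < d)%N ->
     2 * x k + (4 * b - 4) * f k - raise_by u d f y k - lower_by u d f y k = 0) ->
  (forall k, (0 < k < d)%N ->
     2 * x k - (4 * b + 4 * d%:R + 4) * f k + raise_by u d f y k + lower_by u d f y k = 0) ->
  (forall k, (k <= d)%N ->
     (2 * k%:R - d%:R) * (- x k - (2 * b + d%:R - 2) * f k)
     + k%:R * lower_by u d f y k - (d%:R - k%:R) * raise_by u d f y k = 0) ->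
  schmid_relations u (- b - d%:R) d (fun k => (-1) ^+ k * f k) (fun k => (-1) ^+ k * x k)
    (fun k => (-1) ^+ k * y k).
Proof.
move=> h1 h2 h3.
have R k : raise_by u d (fun k => (-1) ^+ k * f k) (fun k => (-1) ^+ k * y k) k =
    - ((-1) ^+ k * raise_by u d f y k) by rewrite /raise_by !exprS; ring.
have L k : k%:R * lower_by u d (fun k => (-1) ^+ k * f k) (fun k => (-1) ^+ k * y k) k =
    - (k%:R * ((-1) ^+ k * lower_by u d f y k)).
  by case: k => [|k]; rewrite ?mul0r ?oppr0 // /lower_by /= !exprS; ring.
have L' k : (0 < k)%N -> lower_by u d (fun k => (-1) ^+ k * f k) (fun k => (-1) ^+ k * y k) k =
    - ((-1) ^+ k * lower_by u d f y k).
  by case: k => // k _; rewrite /lower_by /= !exprS; ring.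
split=> k kd; rewrite ?R ?L ?L'; try lia.
- by rewrite -[RHS](mulr0 ((-1) ^+ k)) -(h2 k kd); ring.
- by rewrite -[RHS](mulr0 ((-1) ^+ k)) -(h1 k kd); ring.
- by rewrite -[RHS](mulr0 ((-1) ^+ k)) -(h3 k kd); ring.
Qed.

(** The sum of the first two relations gives x k. What is left is a linear system for the two
    neighbour expressions, of determinant -d. At k = d the third relation alone remains and is
    divided by d. *)
Lemma schmid_relations_solve u b d f x y : schmid_relations u b d f x y ->
  [/\ forall k, (0 < k < d)%N -> x k = (d%:R + 2) * f k,
      forall k, (0 < k < d)%N -> raise_by u d f y k = 2 * (k%:R + b) * f k,
      forall k, (0 < k < d)%N -> lower_by u d f y k = 2 * (b + d%:R - k%:R) * f k &
      (0 < d)%N -> lower_by u d f y d = - x d + (2 * b + d%:R + 2) * f d].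
Proof.
case=> h1 h2 h3.
have hx k : (0 < k < d)%N -> x k = (d%:R + 2) * f k.
  move=> kd; have := h1 k kd; have := h2 k kd.
  move: (raise_by _ _ _ _ _) (lower_by _ _ _ _ _) => r l e2 e1.
  apply: (mulfI (_ : 4 != 0 :> K)); first by rewrite pnatr_eq0.
  by apply/eqP; rewrite -subr_eq0 -[X in _ == X](addr0 0) -{1}e1 -e2; apply/eqP; ring.
have hr k : (0 < k < d)%N -> raise_by u d f y k = 2 * (k%:R + b) * f k.
  move=> kd; have d0 : d%:R != 0 :> K by rewrite pnatr_eq0; lia.
  have := h1 k kd; have := h3 k (ltnW (proj2 (andP kd))); rewrite hx //.
  move: (raise_by _ _ _ _ _) (lower_by _ _ _ _ _) => r l e3 e1.
  apply: (mulfI d0); apply/eqP.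
  by rewrite -subr_eq0 -[X in _ == X]e3 -subr_eq0 -[X in _ == X](mulr0 (- k%:R)) -e1; apply/eqP; ring.
split=> // [k kd | d0].
  have := h1 k kd; rewrite hx // hr //; move: (lower_by _ _ _ _ _) => l e1.
  by apply/eqP; rewrite -subr_eq0 -[X in _ == X]oppr0 -e1; apply/eqP; ring.
have d0' : d%:R != 0 :> K by rewrite pnatr_eq0; lia.
have := h3 d (leqnn d); rewrite subrr mul0r addr0.
move: (lower_by _ _ _ _ _) => l e3; apply: (mulfI d0'); apply/eqP.
by rewrite -subr_eq0 -[X in _ == X]oppr0 -e3; apply/eqP; ring.
Qed.

End SchmidRelations.

Section ComplexSolution.
Variable R : realType.
Local Notation C := R[i].

Lemma ReZr (r : R) (z : C) : complex.Re (r%:C * z) = r * complex.Re z.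
Proof. by case: z => x y /=; rewrite mul0r subr0. Qed.
Lemma ImZr (r : R) (z : C) : complex.Im (r%:C * z) = r * complex.Im z.
Proof. by case: z => x y /=; rewrite mul0r addr0. Qed.

Lemma normc_ge_Im (z : C) : `|complex.Im z|%:C <= `|z|.
Proof. by rewrite normc_def lecR -sqrtr_sqr ler_wsqrtr // lerDr sqr_ge0. Qed.

Lemma schmid_solution_pos (q : R) (d L : nat) (F Fs Ft : nat -> R -> R -> C) :
  0 < q -> (1 < L < d)%N ->
  (forall k s t, (k <= d)%N -> is_deriveC (fun s => F k s t) s (Fs k s t)) ->
  (forall k s t, (k <= d)%N -> is_deriveC (F k s) t (Ft k s t)) ->
  (forall s t, schmid_relations (q * expR (2 * t))%:C (L%:R - d%:R) d
     (fun k => F k s t) (fun k => Fs k s t) (fun k => Ft k s t)) ->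
  (forall k s, (k <= d)%N -> exists A N : R, forall t : R, 0 <= t ->
     `|F k s t| <= (A * expR (N * t))%:C) ->
  exists C0 C1 : C, forall k s t, (k <= d)%N ->
    F k s t = C0 * ((if (k < L)%N then 0 else ((k - L)`!)%:R^-1)
        * expR ((d%:R + 2) * s) * wlag (L%:R - d%:R / 2) (k - L) (q * expR (2 * t)))%:C
      + C1 * ((k == d)%:R * expR ((2 * L%:R - d%:R + 2) * s + d%:R * t
           - q * expR (2 * t) / 2))%:C.
Proof.
move=> q0 Ld hs ht hrel hgr.
(* X stands for Re or Im: the relations have real coefficients, so both parts satisfy the real
   system separately. *)
have part (X : C -> R) : (forall x y, X (x + y) = X x + X y) -> (forall (r : R) z, X (r%:C * z) = r * X z) ->
    (forall z, `|X z|%:C <= `|z|) ->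
    (forall f (s : R) z, is_deriveC f s z -> is_derive s 1 (fun s => X (f s)) (X z)) ->
    exists C0 C1 : R, forall k s t, (k <= d)%N ->
    X (F k s t) = C0 * (if (k < L)%N then 0 else ((k - L)`!)%:R^-1)
        * expR ((d%:R + 2) * s) * wlag (L%:R - d%:R / 2) (k - L) (q * expR (2 * t))
      + C1 * (k == d)%:R * expR ((2 * L%:R - d%:R + 2) * s + d%:R * t
           - q * expR (2 * t) / 2).
  move=> XD XZ Xle Xd.
  have XN z : X (- z) = - X z by rewrite -mulN1r -(rmorphN1 (real_complex R)) XZ mulN1r.
  apply: (@schmid_system_solution _ q d L (fun k s t => X (F k s t))
    (fun k s t => X (Fs k s t)) (fun k s t => X (Ft k s t)) q0 Ld).
  - by move=> k s t kd; apply: (Xd (fun s => F k s t)); exact: hs.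
  - by move=> k s t kd; apply: Xd; exact: ht.
  - move=> k s t kd; have [h _ _ _] := schmid_relations_solve (hrel s t).
    by rewrite h // -XZ !(rmorphD, rmorph_nat).
  - move=> k s t kd; have [_ h _ _] := schmid_relations_solve (hrel s t).
    have := h k kd; rewrite /raise_by => /(congr1 X) H.
    rewrite -!XZ -XD; apply: etrans; [apply: etrans; [|exact: H] |]; congr X.
      by rewrite !(rmorphD, rmorphM, rmorphN, rmorphB, rmorph_nat).
    by rewrite !(rmorphD, rmorphM, rmorphN, rmorphB, rmorph_nat) addrA.
  - move=> k s t kd; have [_ _ h _] := schmid_relations_solve (hrel s t).
    have := h k kd; rewrite /lower_by => /(congr1 X) H.
    rewrite -!XZ -XD; apply: etrans; [apply: etrans; [|exact: H] |]; congr X.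
      by rewrite !(rmorphD, rmorphM, rmorphN, rmorphB, rmorph_nat).
    by rewrite !(rmorphD, rmorphM, rmorphN, rmorphB, rmorph_nat) subrK.
  - move=> s t; have [_ _ _ h] := schmid_relations_solve (hrel s t).
    have d0 : (0 < d)%N by lia.
    have := h d0; rewrite /lower_by => /(congr1 X) H.
    rewrite -!XZ -XN -!XD; apply: etrans; [apply: etrans; [|exact: H] |]; congr X.
      by rewrite !(rmorphD, rmorphM, rmorphN, rmorphB, rmorph_nat); ring.
    by rewrite !(rmorphD, rmorphM, rmorphN, rmorphB, rmorph_nat).
  - move=> k s kd; have [A [N H]] := hgr k s kd; exists A, N => t t0.
    by rewrite -lecR; apply: le_trans (Xle _) (H t t0).
have [A0 [A1 HA]] : exists C0 C1 : R, forall k s t, (k <= d)%N ->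
    complex.Re (F k s t) = C0 * (if (k < L)%N then 0 else ((k - L)`!)%:R^-1)
        * expR ((d%:R + 2) * s) * wlag (L%:R - d%:R / 2) (k - L) (q * expR (2 * t))
      + C1 * (k == d)%:R * expR ((2 * L%:R - d%:R + 2) * s + d%:R * t
           - q * expR (2 * t) / 2).
  apply: part => [[? ?] [? ?]| |z|f s z []] //; [exact: ReZr | exact: normc_ge_Re].
have [B0 [B1 HB]] : exists C0 C1 : R, forall k s t, (k <= d)%N ->
    complex.Im (F k s t) = C0 * (if (k < L)%N then 0 else ((k - L)`!)%:R^-1)
        * expR ((d%:R + 2) * s) * wlag (L%:R - d%:R / 2) (k - L) (q * expR (2 * t))
      + C1 * (k == d)%:R * expR ((2 * L%:R - d%:R + 2) * s + d%:R * t
           - q * expR (2 * t) / 2).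
  apply: part => [[? ?] [? ?]| |z|f s z []] //; [exact: ImZr | exact: normc_ge_Im].
exists (A0 +i* B0), (A1 +i* B1) => k s t kd.
apply/eqP; rewrite eq_complex; apply/andP; split; apply/eqP.
  by rewrite HA //= !mulr0 !subr0 !mulrA.
by rewrite HB //= !mulr0 !add0r !mulrA.
Qed.
End ComplexSolution.

(** * Explicit solutions *)

Section Assembly.
Variable R : realType.
Local Notation C := R[i].

(** Negative q is reduced to -q by the reflection k |-> d - k, which is recorded in [k_of]. *)
Lemma schmid_solution (q : R) (d L : nat) (F Fs Ft : nat -> R -> R -> C)
    (k_of := fun i => if 0 < q then i else (d - i)%N) :
  q != 0 -> (1 < L < d)%N ->
  (forall k s t, (k <= d)%N -> is_deriveC (fun s => F k s t) s (Fs k s t)) ->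
  (forall k s t, (k <= d)%N -> is_deriveC (F k s) t (Ft k s t)) ->
  (forall s t, schmid_relations (q * expR (2 * t))%:C (L%:R - d%:R) d
     (fun k => F k s t) (fun k => Fs k s t) (fun k => Ft k s t)) ->
  (forall k s, (k <= d)%N -> exists A N : R, forall t : R, 0 <= t ->
     `|F k s t| <= (A * expR (N * t))%:C) ->
  exists C0 C1 : C, forall i s t, (i <= d)%N -> let k := k_of i in
    F i s t = C0 * ((if (k < L)%N then 0 else ((k - L)`!)%:R^-1)
        * expR ((d%:R + 2) * s) * wlag (L%:R - d%:R / 2) (k - L) (`|q| * expR (2 * t)))%:C
      + C1 * ((k == d)%:R * expR ((2 * L%:R - d%:R + 2) * s + d%:R * t
           - `|q| * expR (2 * t) / 2))%:C.
Proof.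
move=> q0 Ld hs ht hrel hgr; rewrite /k_of; case: ltrP => [qp | qn].
  have [C0 [C1 H]] := schmid_solution_pos qp Ld hs ht hrel hgr.
  by exists C0, C1 => i s t id; rewrite /= (gtr0_norm qp); exact: H.
have qp : 0 < - q by rewrite oppr_gt0 lt_neqAle q0.
have [] := @schmid_solution_pos _ (- q) d L (fun k => F (d - k)%N) (fun k => Fs (d - k)%N)
  (fun k => Ft (d - k)%N) qp Ld.
- by move=> k s t _; apply: hs; exact: leq_subr.
- by move=> k s t _; apply: ht; exact: leq_subr.
- by move=> s t; rewrite mulNr rmorphN; exact: schmid_relations_flip (hrel s t).
- by move=> k s _; apply: hgr; exact: leq_subr.
move=> C0 [C1 H]; exists C0, C1 => i s t id /=.
by rewrite (ler0_norm qn) -(H (d - i)%N s t (leq_subr _ _)) subKn.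
Qed.

Lemma norm_mx2_diag_le (x y B : R) i j : `|x| <= B -> `|y| <= B -> `|mx2 x 0 0 y i j| <= B.
Proof.
move=> hx hy; have B0 := le_trans (normr_ge0 _) hx.
by rewrite mxE; case: ifP => _; case: ifP => _ //; rewrite normr0.
Qed.

Lemma norm_a_st_le (s t : R) : 0 <= t -> `|a_st s t| <= expR (`|s| + t).
Proof.
move=> t0; have := ler_norm s; have := ler_norm (- s); rewrite normrN => h1 h2.
have le (x : R) : x <= `|s| + t -> `|expR x| <= expR (`|s| + t).
  by move=> hx; rewrite gtr0_norm ?expR_gt0 // ler_expR.
have -> : `|a_st s t| = \big[Num.max/0]_ij `|a_st s t ij.1 ij.2| by exact: mx_normrE.
apply/bigmax_leP; split; first exact: expR_ge0.
case=> i j _ /=; rewrite /a_st a0E -!expRN.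
rewrite /b4 !mxE; case: splitP => i' _; rewrite mxE; case: splitP => j' _;
  do ?[by rewrite mxE normr0 expR_ge0].
- by apply: norm_mx2_diag_le; apply: le; lra.
- by apply: norm_mx2_diag_le; apply: le; lra.
Qed.

Lemma a_st_ln (a1 a2 : R) : 0 < a1 -> 0 < a2 ->
  a0 a1 a2 = a_st ((ln a1 + ln a2) / 2) ((ln a1 - ln a2) / 2).
Proof.
move=> p1 p2; rewrite /a_st (_ : _ + _ = ln a1); last by field.
by rewrite (_ : _ - _ = ln a2) ?lnK //; field.
Qed.

Lemma expR_ln_z (x : R) (n : int) : 0 < x -> x ^ n = expR (n%:~R * ln x).
Proof.
move=> x0; case: n => n.
  by rewrite -exprnP -[in LHS](lnK x0) -expRM_natl.
by rewrite NegzE -exprnN -[in LHS](lnK x0) -expRM_natl -expRN rmorphN mulNr.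
Qed.

(** The coefficients, exponents and mu are variables bound by equations, so that one statement
    serves both families and both signs of c_0; eps carries the sign (-1)^i of the second family. *)
Lemma whittaker_formulaE (c0 : R) (a : int * int) (d L : nat) (C0 C1 : C) (eps alpha beta mu : R)
    (e1 e2 : int) (i : nat) (s t : R) (q := 4 * pi * `|c0|)
    (k := if 0 < 4 * pi * c0 then i else (d - i)%N) :
  c0 != 0 -> hwdeg a = d -> (i <= d)%N ->
  alpha = eps * (if (k < L)%N then 0 else ((k - L)`!)%:R^-1) ->
  beta = eps * (k == d)%:R ->
  mu ^+ 2 = (L%:R - d%:R / 2 - 2^-1) ^+ 2 ->
  e1 = L%:Z + 1 -> e2 = L%:Z - d%:Z + 1 ->
  whittaker_formula c0 a C0 C1 alpha beta mu e1 e2 i (expR (s + t)) (expR (s - t)) =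
  eps%:C * (C0 * ((if (k < L)%N then 0 else ((k - L)`!)%:R^-1)
        * expR ((d%:R + 2) * s) * wlag (L%:R - d%:R / 2) (k - L) (q * expR (2 * t)))%:C
      + C1 * ((k == d)%:R * expR ((2 * L%:R - d%:R + 2) * s + d%:R * t
           - q * expR (2 * t) / 2))%:C).
Proof.
move=> c0n ad id -> -> hmu -> ->; rewrite /whittaker_formula ad.
have pi4 : 0 < 4 * pi :> R by rewrite mulr_gt0 // pi_gt0.
have hdiv : expR (s + t) / expR (s - t) = expR (2 * t).
  by rewrite -expRN -expRD; congr expR; ring.
have hpow : (expR (s + t) * expR (s - t)) `^ ((d%:R + 2) / 2) = expR ((d%:R + 2) * s).
  by rewrite -expRD -expRM; congr expR; field.
(* For both signs of c_0 the first index of W is k - d/2 = m + (k - L) with m = L - d/2, so for k >=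
   L the function W is a [wlag]. *)
have hk : Num.sg c0 * (i%:R - d%:R / 2) = k%:R - d%:R / 2.
  rewrite /k pmulr_rgt0 //; case: ltrP => c0s; first by rewrite gtr0_sg // mul1r.
  by rewrite ltr0_sg ?lt_neqAle ?c0n // natrB //; field.
have hexp : expR (s + t) ^ (L%:Z + 1) * expR (s - t) ^ (L%:Z - d%:Z + 1)
      * expR (- (2 * pi * `|c0| * expR (2 * t))) =
    expR ((2 * L%:R - d%:R + 2) * s + d%:R * t - q * expR (2 * t) / 2).
  rewrite !expR_ln_z ?expR_gt0 // !expRK -!expRD !(rmorphD, rmorphN) /= /q -!pmulrn.
  by congr expR; field.
rewrite hdiv hpow hk /=.
have comb (A B A' B' : R) : A = eps * A' -> B = eps * B' ->
    C0 * A%:C + C1 * B%:C = eps%:C * (C0 * A'%:C + C1 * B'%:C).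
  by move=> -> ->; rewrite !rmorphM /=; ring.
apply: comb; last by rewrite -hexp; ring.
case: ltnP => kL; first by rewrite !(mulr0, mul0r).
rewrite -(@whittakerW_wlag _ (L%:R - d%:R / 2) (k - L) mu _ hmu); last first.
  by rewrite !mulr_gt0 ?expR_gt0 ?normr_gt0 ?pi_gt0.
rewrite (_ : _ - _ / 2 + _ = k%:R - d%:R / 2); first by rewrite /q; ring.
by rewrite natrB //; field.
Qed.

End Assembly.

Section Radial.
Variables (R : realType) (V : gkmodule R) (c0 : R) (phi : V -> 'M[R]_4 -> R[i]).
Hypothesis hphi : gk_hom phi.
Hypothesis hpsi : forall v, psi_equivariant c0 (phi v).
Variable a : int * int.
Hypothesis hmin : is_minimal_K_type V a.
Local Notation C := R[i].

Lemma schmid_relations_II b d (iota : {linear binform R d -> V})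
    (Phi : 'M[R]_4 -> {scalar binform R d}) (s t : R) :
  (forall k p, maxK k -> iota (tau b (K_to_U2 k) p) = kact k (iota p)) ->
  (forall g v, Sp4 g -> Phi g v = phi (iota v) g) ->
  (1 < d)%N ->
  vogan_norm (b + d%:Z, b + 2) < vogan_norm a ->
  vogan_norm (b + d%:Z - 2, b) < vogan_norm a ->
  vogan_norm (b - 1 + d%:Z, b - 1) < vogan_norm a ->
  schmid_relations (4 * pi * c0 * expR (2 * t))%:C b%:~R d
    (fun k => Phi (a_st s t) (ub R d k)) (dsF phi iota s t) (dtF phi iota s t).
Proof.
case: d iota Phi => [|[|e]] // iota Phi iotaK hPhi _ n1 n2 n3.
have m1 : vogan_norm (b + 2 + e%:Z, b + 2) < vogan_norm a.
  by rewrite (_ : b + 2 + e%:Z = b + e.+2%:Z) //; lia.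
have m2 : vogan_norm (b + e%:Z, b) < vogan_norm a.
  by rewrite (_ : b + e%:Z = b + e.+2%:Z - 2) //; lia.
have etaE : (4 * pi * c0 * expR (2 * t))%:C = 2 * (2 * pi * c0 * expR (2 * t))%:C :> C.
  by rewrite -(rmorph_nat (real_complex R)) -rmorphM; congr _%:C; ring.
rewrite etaE; split=> k kd.
- exact: (eq_plus2 hphi hpsi hmin iotaK hPhi s t kd m1).
- exact: (eq_minus2 hphi hpsi hmin iotaK hPhi s t kd m2).
- exact: (eq_minus0 hphi hpsi hmin iotaK hPhi s t kd n3).
Qed.

Lemma schmid_relations_III b d (iota : {linear binform R d -> V})
    (Phi : 'M[R]_4 -> {scalar binform R d}) (s t : R) :
  (forall k p, maxK k -> iota (tau b (K_to_U2 k) p) = kact k (iota p)) ->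
  (forall g v, Sp4 g -> Phi g v = phi (iota v) g) ->
  (1 < d)%N ->
  vogan_norm (b + d%:Z, b + 2) < vogan_norm a ->
  vogan_norm (b + d%:Z - 2, b) < vogan_norm a ->
  vogan_norm (b + 1 + d%:Z, b + 1) < vogan_norm a ->
  schmid_relations (4 * pi * c0 * expR (2 * t))%:C (- b%:~R - d%:R) d
    (fun k => (-1) ^+ k * Phi (a_st s t) (ub R d k))
    (fun k => (-1) ^+ k * dsF phi iota s t k) (fun k => (-1) ^+ k * dtF phi iota s t k).
Proof.
case: d iota Phi => [|[|e]] // iota Phi iotaK hPhi _ n1 n2 n3.
have m1 : vogan_norm (b + 2 + e%:Z, b + 2) < vogan_norm a.
  by rewrite (_ : b + 2 + e%:Z = b + e.+2%:Z) //; lia.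
have m2 : vogan_norm (b + e%:Z, b) < vogan_norm a.
  by rewrite (_ : b + e%:Z = b + e.+2%:Z - 2) //; lia.
have etaE : (4 * pi * c0 * expR (2 * t))%:C = 2 * (2 * pi * c0 * expR (2 * t))%:C :> C.
  by rewrite -(rmorph_nat (real_complex R)) -rmorphM; congr _%:C; ring.
rewrite etaE; apply: schmid_relations_sign => k kd.
- exact: (eq_plus2 hphi hpsi hmin iotaK hPhi s t kd m1).
- exact: (eq_minus2 hphi hpsi hmin iotaK hPhi s t kd m2).
- exact: (eq_plus0 hphi hpsi hmin iotaK hPhi s t kd n3).
Qed.

Lemma moderate_growth_a_st d (Phi : 'M[R]_4 -> {scalar binform R d}) v (s : R) :
  moderate_growth Phi -> exists A N : R, forall t : R, 0 <= t ->
    `|Phi (a_st s t) v| <= (A * expR (N * t))%:C.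
Proof.
move=> /(_ v) [c [N H]]; exists (`|c| * expR (N%:R * `|s|)), N%:R => t t0.
apply: le_trans (H _ (Sp4_a_st s t)) _; rewrite lecR.
apply: (@le_trans _ _ (`|c| * `|a_st s t| ^+ N)).
  by rewrite ler_wpM2r ?exprn_ge0 // ler_norm.
rewrite -mulrA -expRD -mulrDr expRM_natl ler_wpM2l // lerXn2r ?nnegrE ?expR_ge0 //.
exact: norm_a_st_le.
Qed.

(** Xi_II is the case sigma = 1, L = Lambda_1, and Xi_III the case sigma = -1, L = -Lambda_2. The
    condition sigma^2 = 1 serves to undo the twist of the components by sigma^k. *)
Lemma whittaker_solution (d := hwdeg a) (L : nat) (sigma : R)
    (iota : {linear binform R d -> V}) (Phi : 'M[R]_4 -> {scalar binform R d}) :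
  c0 != 0 -> sigma ^+ 2 = 1 -> (1 < L < d)%N ->
  (forall g v, Sp4 g -> Phi g v = phi (iota v) g) ->
  moderate_growth Phi ->
  (forall s t, schmid_relations (4 * pi * c0 * expR (2 * t))%:C (L%:R - d%:R) d
    (fun k => (sigma ^+ k)%:C * Phi (a_st s t) (ub R d k))
    (fun k => (sigma ^+ k)%:C * dsF phi iota s t k)
    (fun k => (sigma ^+ k)%:C * dtF phi iota s t k)) ->
  exists C0 C1 : C, forall (i : 'I_d.+1) a1 a2 alpha beta mu e1 e2,
    let k := if 0 < c0 then i : nat else (d - i)%N in
    0 < a1 -> 0 < a2 ->
    alpha = sigma ^+ i * (if (k < L)%N then 0 else ((k - L)`!)%:R^-1) ->
    beta = sigma ^+ i * (k == d)%:R ->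
    mu ^+ 2 = (L%:R - d%:R / 2 - 2^-1) ^+ 2 ->
    e1 = L%:Z + 1 -> e2 = L%:Z - d%:Z + 1 ->
    Phi (a0 a1 a2) (uvec R i) = whittaker_formula c0 a C0 C1 alpha beta mu e1 e2 i a1 a2.
Proof.
move=> c0n sig2 Ld hPhi hmod hrel.
have sigK k : sigma ^+ k * sigma ^+ k = 1 by rewrite -exprD addnn -muln2 mulnC exprM sig2 expr1n.
have pi4 : 0 < 4 * pi :> R by rewrite mulr_gt0 // pi_gt0.
have q0 : 4 * pi * c0 != 0 by rewrite mulf_neq0 // gt_eqF.
have [] := @schmid_solution _ (4 * pi * c0) d L
  (fun k s t => (sigma ^+ k)%:C * Phi (a_st s t) (ub R d k))
  (fun k s t => (sigma ^+ k)%:C * dsF phi iota s t k)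
  (fun k s t => (sigma ^+ k)%:C * dtF phi iota s t k) q0 Ld.
- move=> k s t _; have [Dr Di] := phi_Hid hphi (iota (ub R d k)) s t.
  have E s' : Phi (a_st s' t) (ub R d k) = phi (iota (ub R d k)) (a_st s' t).
    by rewrite hPhi ?Sp4_a_st.
  by split; [under eq_fun do rewrite E ReZr | under eq_fun do rewrite E ImZr];
    rewrite ?ReZr ?ImZr; exact: dZ.
- move=> k s t _; have [Dr Di] := phi_Hdiag hphi (iota (ub R d k)) s t.
  have E t' : Phi (a_st s t') (ub R d k) = phi (iota (ub R d k)) (a_st s t').
    by rewrite hPhi ?Sp4_a_st.
  by split; [under eq_fun do rewrite E ReZr | under eq_fun do rewrite E ImZr];
    rewrite ?ReZr ?ImZr; exact: dZ.
- exact: hrel.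
- move=> k s _; have [A [N H]] := moderate_growth_a_st (ub R d k) s hmod.
  exists (`|sigma ^+ k| * A), N => t t0.
  have -> : (`|sigma ^+ k| * A * expR (N * t))%:C = `|(sigma ^+ k)%:C| * (A * expR (N * t))%:C :> C.
    by rewrite normc_def /= expr0n addr0 sqrtr_sqr -mulrA rmorphM.
  by rewrite normrM ler_wpM2l //; exact: H.
move=> C0 [C1 H]; exists C0, C1 => i a1 a2 alpha beta mu e1 e2 k p1 p2 ha hb hmu he1 he2.
have kE : k = if 0 < 4 * pi * c0 then i : nat else (d - i)%N by rewrite pmulr_rgt0.
have id : (i <= d)%N by rewrite -ltnS.
rewrite (a_st_ln p1 p2) uvec_ub; set s := (_ + _) / 2; set t := (_ - _) / 2.
have -> : a1 = expR (s + t) by rewrite (_ : s + t = ln a1) ?lnK // /s /t; field.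
have -> : a2 = expR (s - t) by rewrite (_ : s - t = ln a2) ?lnK // /s /t; field.
rewrite (@whittaker_formulaE _ c0 a d L C0 C1 (sigma ^+ i) alpha beta mu e1 e2 i s t) -?kE //.
have := H i s t id; rewrite /= -kE (normrM (4 * pi)) (gtr0_norm pi4) => <-.
by rewrite mulrA -rmorphM sigK mul1r.
Qed.

End Radial.

Theorem theorem5p6 (R : realType) (c0 : R) (hc0 : c0 != 0)
    (lam : int * int) (V : gkmodule R) (hV : is_large_discrete_series lam V)
    (Phi : 'M[R]_4 -> {scalar binform R (hwdeg (Lam lam))})
    (hPhi : is_whittaker_function c0 V Phi) (hmod : moderate_growth Phi) :
  (Xi_II lam ->
   exists C0 C1 : R[i],
   forall (i : 'I_(hwdeg (Lam lam)).+1) (a1 a2 : R), 0 < a1 -> 0 < a2 ->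
     Phi (a0 a1 a2) (uvec R i) =
     whittaker_formula c0 (Lam lam) C0 C1
       (alphaII c0 (Lam lam) i) (betaII c0 (Lam lam) i)
       (((Lam lam).1 + (Lam lam).2 - 1)%:~R / 2)
       ((Lam lam).1 + 1) ((Lam lam).2 + 1) i a1 a2)
  /\
  (Xi_III lam ->
   exists C0 C1 : R[i],
   forall (i : 'I_(hwdeg (Lam lam)).+1) (a1 a2 : R), 0 < a1 -> 0 < a2 ->
     Phi (a0 a1 a2) (uvec R i) =
     whittaker_formula c0 (Lam lam) C0 C1
       (alphaIII c0 (Lam lam) i) (betaIII c0 (Lam lam) i)
       (((Lam lam).1 + (Lam lam).2 + 1)%:~R / 2)
       (- (Lam lam).2 + 1) (- (Lam lam).1 + 1) i a1 a2).
Proof.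
have [_ _ _ hmin _] := hV.
have [phi [iota [hphi hpsi iotaK _ hPhiE]]] := hPhi.
split=> /and3P[l1 l2 l12].
- have Lam1 : (Lam lam).1 = lam.1 + 1 by rewrite /Lam l12.
  have Lam2 : (Lam lam).2 = lam.2 by rewrite /Lam l12.
  set b := (Lam lam).2; set d := hwdeg (Lam lam).
  have dE : d%:Z = (Lam lam).1 - b by rewrite /d /hwdeg -/b; lia.
  have [L LE] : exists L : nat, L%:Z = (Lam lam).1 by exists (absz (Lam lam).1); lia.
  have dR : d%:R = (Lam lam).1%:~R - b%:~R :> R by rewrite -rmorphB /= -dE.
  have LR : L%:R = (Lam lam).1%:~R :> R by rewrite -LE.
  (* lambda_1 > -lambda_2 >= 1 gives L = lambda_1 + 1 >= 3, and d = L - Lambda_2 with Lambda_2 <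
     0. *)
  have Ld : (1 < L < d)%N by lia.
  have hrel s t : schmid_relations (4 * pi * c0 * expR (2 * t))%:C (L%:R - d%:R) d
    (fun k => (1 ^+ k)%:C * Phi (a_st s t) (ub R d k))
    (fun k => (1 ^+ k)%:C * dsF phi iota s t k)
    (fun k => (1 ^+ k)%:C * dtF phi iota s t k).
    have E (f : nat -> R[i]) : (fun k => (1 ^+ k)%:C * f k) = f.
      by apply/funext => k; rewrite expr1n mul1r.
    rewrite !E (_ : L%:R - d%:R = b%:~R); last first.
      have -> : b = L%:Z - d%:Z by lia.
      by rewrite rmorphB.
    have aE : (Lam lam).1 = b + d%:Z by lia.
    apply: (schmid_relations_II hphi hpsi hmin s t iotaK hPhiE); first by lia.
    (* The three drops of the norm are -4 Lambda_2, 4 Lambda_1 and 2(Lambda_1 + Lambda_2) - 2; the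
       last is positive because Lambda_1 + Lambda_2 = lambda_1 + lambda_2 + 1 >= 2. *)
    + rewrite -subr_gt0 /vogan_norm /= -/b aE (_ : _ - _ = - 4 * b); [lia | ring].
    + rewrite -subr_gt0 /vogan_norm /= -/b aE (_ : _ - _ = 4 * (b + d%:Z)); [lia | ring].
    + rewrite -subr_gt0 /vogan_norm /= -/b aE (_ : _ - _ = 2 * (d%:Z + 2 * b) - 2); [lia | ring].
  have [C0 [C1 H]] := whittaker_solution hphi hc0 (expr1n _ 2) Ld hPhiE hmod hrel.
  exists C0, C1 => i a1 a2 p1 p2; have id : (i <= d)%N by rewrite -ltnS.
  apply: H => //.
  + rewrite expr1n mul1r /alphaII -/d -/b; move: (nat_of_ord i) id => {}i id.
    clear - LE dE id Ld; case: ifP => _.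
      rewrite -LE ltz_nat; case: ltnP => // Li; congr (_ `!%:R^-1); lia.
    case: ltnP => h; first by rewrite ifF //; lia.
    rewrite ifT; last by lia.
    congr (_ `!%:R^-1); lia.
  + rewrite expr1n mul1r /betaII -/d; move: (nat_of_ord i) id => {}i id.
    clear - LE dE id Ld; case: ifP => _ //; congr (nat_of_bool _)%:R; lia.
  + by rewrite LR dR !(rmorphD, rmorphN) /= -/b; field.
  + by rewrite LE.
  + by rewrite LE; lia.
- have l12' : (- lam.2 < lam.1) = false by lia.
  have Lam1 : (Lam lam).1 = lam.1 by rewrite /Lam l12'.
  have Lam2 : (Lam lam).2 = lam.2 - 1 by rewrite /Lam l12'.
  set b := (Lam lam).2; set d := hwdeg (Lam lam).
  have dE : d%:Z = (Lam lam).1 - b by rewrite /d /hwdeg -/b; lia.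
  have [L LE] : exists L : nat, L%:Z = - b by exists (absz b); lia.
  have dR : d%:R = (Lam lam).1%:~R - b%:~R :> R by rewrite -rmorphB /= -dE.
  have LR : L%:R = - b%:~R :> R by rewrite -rmorphN /= -LE.
  have Ld : (1 < L < d)%N by lia.
  have hrel s t : schmid_relations (4 * pi * c0 * expR (2 * t))%:C (L%:R - d%:R) d
    (fun k => ((-1) ^+ k)%:C * Phi (a_st s t) (ub R d k))
    (fun k => ((-1) ^+ k)%:C * dsF phi iota s t k)
    (fun k => ((-1) ^+ k)%:C * dtF phi iota s t k).
    have E (f : nat -> R[i]) : (fun k => ((-1) ^+ k)%:C * f k) = (fun k => (-1) ^+ k * f k).
      by apply/funext => k; rewrite rmorphXn rmorphN1.
    rewrite !E (_ : L%:R = - b%:~R); last by rewrite -rmorphN /= -LE.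
    have aE : (Lam lam).1 = b + d%:Z by lia.
    apply: (schmid_relations_III hphi hpsi hmin s t iotaK hPhiE); first by lia.
    + rewrite -subr_gt0 /vogan_norm /= -/b aE (_ : _ - _ = - 4 * b); [lia | ring].
    + rewrite -subr_gt0 /vogan_norm /= -/b aE (_ : _ - _ = 4 * (b + d%:Z)); [lia | ring].
    (* Positive because Lambda_1 + Lambda_2 = lambda_1 + lambda_2 - 1 <= -2 in this family. *)
    + rewrite -subr_gt0 /vogan_norm /= -/b aE (_ : _ - _ = - 2 * (d%:Z + 2 * b) - 2); [lia | ring].
  have sig2 : (-1) ^+ 2 = 1 :> R by rewrite sqrrN expr1n.
  have [C0 [C1 H]] := whittaker_solution hphi hc0 sig2 Ld hPhiE hmod hrel.
  exists C0, C1 => i a1 a2 p1 p2; have id : (i <= d)%N by rewrite -ltnS.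
  apply: H => //.
  + rewrite /alphaIII -/d -/b; move: (nat_of_ord i) id => {}i id.
    clear - LE dE id Ld; case: ifP => _.
      rewrite -/b -LE ltz_nat; case: ltnP => // Li; first by rewrite mulr0.
      congr (_ * _ `!%:R^-1); lia.
    case: ltnP => h; first by rewrite mulr0 ifF //; lia.
    rewrite ifT; last by lia.
    congr (_ * _ `!%:R^-1); lia.
  + rewrite /betaIII -/d; move: (nat_of_ord i) id => {}i id.
    clear - LE dE id Ld; case: ifP => _ //; congr (_ * (nat_of_bool _)%:R); lia.
  (* With L = -Lambda_2 the number L - d/2 - 1/2 is the opposite of mu, which the squares ignore. *)
  + by rewrite LR dR !(rmorphD, rmorphN) /= -/b; field.
  + by rewrite LE.
  + by rewrite LE; lia.
Qed.
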